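(* Let $\beta_r>0$, $c>0$, $m\ge 0$ and $\kappa\in(0,1]$ be fixed. Assume (i) $r_0\in\mathcal{H}^{\beta_r}_{\mathrm{Loc}}(\mathbb{R}^d,B_u)$ with $B_u\le c(u^m+1)$ for all $u>0$; (ii) $r_0(X^s)$ and $\|X^s\|_\infty$ are sub-exponentially distributed. Let $\hat r_{\mathrm{LS}}$ be the least squares density ratio estimator computed over $\mathcal{F}_{\mathrm{NN}}$ with depth $L$ of order $n^{d/(2d+4\beta_r)}\log n$, width $M$ of order $1$ (with suitably chosen constants), lower bound $\underline\delta=0$ and upper bound $\bar\delta=\bar\delta_n=(\log n)^{1+\kappa}$. Then for all $n\ge 2$, $$\mathcal{R}^s(\hat r_{\mathrm{LS}})\le c^* n^{-\frac{2\beta_r}{d+2\beta_r}}(\log n)^{(8+4\kappa)\vee(2m)},\qquad \mathcal{R}^t(\hat r_{\mathrm{LS}})\le c^{**} n^{-\frac{2\beta_r}{d+2\beta_r}}(\log n)^{(8+4\kappa)\vee(2m)+1},$$ where $c^*,c^{**}$ are constants not depending on $n$.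
   Context: Let $X^s$ (source) and $X^t$ (target) be random vectors in $\mathbb{R}^d$ with Lebesgue densities $p$ and $q$; $\mathcal{X}^s=\{x:p(x)>0\}$, $\mathcal{X}^t=\{x:q(x)>0\}$, and assume $\mathcal{X}^t\subset\mathcal{X}^s$. The density ratio is $r_0(x)=q(x)/p(x)$ with the convention $0/0=0$. A real random variable $V$ is called sub-exponentially distributed if $\mathbb{E}\exp(\varsigma|V|)<\infty$ for some $\varsigma>0$. Hölder class: for $\beta=s+r$ with $s=\lfloor\beta\rfloor$ the largest integer strictly smaller than $\beta$ and $r\in(0,1]$, and $B>0$, $\mathcal{H}^\beta([0,1]^d,B)$ is the set of $f:[0,1]^d\to\mathbb{R}$ with $\max_{\|\alpha\|_1\le s}\|\partial^\alpha f\|_\infty\le B$ and $\max_{\|\alpha\|_1=s}\sup_{x\ne y}|\partial^\alpha f(x)-\partial^\alpha f(y)|/\|x-y\|_2^r\le B$. Local Hölder class: for a function $u\mapsto B_u>0$ on $u>0$, $\mathcal{H}^\beta_{\mathrm{Loc}}(\mathbb{R}^d,B_u)$ is the set of $f:\mathbb{R}^d\to\mathbb{R}$ such that for every $u>0$ the function $g(x)=f(2ux-u\mathbf{1}_d)$, $x\in[0,1]^d$, belongs to $\mathcal{H}^\beta([0,1]^d,B_u)$. Neural network class: $\mathcal{F}^{d_{\mathrm{out}}}_{\mathrm{NN}}$ is the class of functions $f(x)=\phi_{L+1}\circ\sigma\circ\phi_L\circ\cdots\circ\sigma\circ\phi_1(x)$ with affine maps $\phi_i(x)=W_ix+b_i$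 ($W_i\in\mathbb{R}^{d_i\times d_{i-1}}$), $\sigma$ the componentwise ReLU $\max(\cdot,0)$, output dimension $d_{\mathrm{out}}$, depth $L$, width $M=\max_{1\le i\le L}d_i$, $S$ parameters, and all outputs lying in $[\underline\delta,\bar\delta]$ (componentwise); $\mathcal{F}_{\mathrm{NN}}=\mathcal{F}^1_{\mathrm{NN}}$. Data: $X^s_1,\dots,X^s_n$ i.i.d. copies of $X^s$ and $X^t_1,\dots,X^t_n$ i.i.d. copies of $X^t$, all mutually independent. The least squares estimator is $\hat r_{\mathrm{LS}}\in\arg\min_{f\in\mathcal{F}_{\mathrm{NN}}}\frac1n\sum_{i=1}^n f(X^s_i)^2-\frac2n\sum_{i=1}^n f(X^t_i)$. For an estimator $\hat r$ and $\jmath\in\{s,t\}$, $\mathcal{R}^\jmath(\hat r)=\mathbb{E}[r_0(X^\jmath)-\hat r(X^\jmath)]^2$, where $X^\jmath$ is independent of the sample and the expectation is over both. $a\vee b=\max(a,b)$. *)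

(* Defs.v *)
From HB Require Import structures.
From mathcomp Require Import all_boot all_order all_algebra.
From mathcomp Require Import all_classical all_reals all_analysis.
Set Implicit Arguments.
Unset Strict Implicit.
Unset Printing Implicit Defensive.
Import Order.TTheory GRing.Theory Num.Theory.
Import numFieldNormedType.Exports.
Local Open Scope classical_set_scope.
Local Open Scope ring_scope.

Section Defs.
Variable R : realType.

(* Lebesgue integral over R^d of a nonnegative function, written as the
   iterated integral dx_1 ... dx_k (Tonelli). *)
Fixpoint lint (k : nat) : (k.-tuple R -> \bar R) -> \bar R :=
  match k with
  | 0 => fun g => g [tuple]
  | k'.+1 => fun g =>
      (\int[@lebesgue_measure R]_x lint (fun t : k'.-tuple R => g (cons_tuple x t)))%E
  end.

Definition has_lebesgue_density (d : nat) (P : probability (d.-tuple R) R)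
  (p : d.-tuple R -> R) : Prop :=
  (forall x, 0 <= p x) /\ measurable_fun setT p /\
  forall A : set (d.-tuple R), measurable A ->
    P A = lint (fun x => ((\1_A x : R) * p x)%:E).

(* expectation of a nonnegative function of k i.i.d. draws from P
   (iterated integral = integral w.r.t. the product law, by Tonelli) *)
Fixpoint iter_int {dT} {T : measurableType dT} (P : probability T R) (k : nat)
  : (k.-tuple T -> \bar R) -> \bar R :=
  match k with
  | 0 => fun g => g [tuple]
  | k'.+1 => fun g =>
      (\int[P]_x iter_int P (fun t : k'.-tuple T => g (cons_tuple x t)))%E
  end.

Definition subexponential {dT} {T : measurableType dT} (P : probability T R)
  (v : T -> R) : Prop :=
  exists s : R, 0 < s /\ (\int[P]_x (expR (s * `|v x|))%:E < +oo)%E.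

Definition sup_norm (d : nat) (x : d.-tuple R) : R := \big[Num.max/0]_(i < d) `|tnth x i|.

Definition euclid_dist (d : nat) (x y : d.-tuple R) : R :=
  Num.sqrt (\sum_(i < d) (tnth x i - tnth y i) ^+ 2).

Definition shift (d : nat) (x : d.-tuple R) (i : 'I_d) (h : R) : d.-tuple R :=
  [tuple tnth x j + (if j == i then h else 0) | j < d].

Definition pderiv (d : nat) (i : 'I_d) (f : d.-tuple R -> R) : d.-tuple R -> R :=
  fun x => derive1 (fun h => f (shift x i h)) 0.

Definition pdiffble (d : nat) (i : 'I_d) (f : d.-tuple R -> R) (x : d.-tuple R) : Prop :=
  derivable (fun h => f (shift x i h)) 0 1.

Definition pderivs (d : nat) (a : 'I_d -> nat) (f : d.-tuple R -> R) : d.-tuple R -> R :=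
  foldr (fun i g => iter (a i) (pderiv i) g) f (enum 'I_d).

Definition mi_order (d : nat) (a : 'I_d -> nat) : nat := (\sum_(i < d) a i)%N.

Definition cube01 (d : nat) : set (d.-tuple R) :=
  [set x | forall i, 0 <= tnth x i <= 1].

(* s = largest integer strictly smaller than beta (beta > 0) *)
Definition hfloor (beta : R) : nat := `|Num.ceil beta - 1|%N.

(* Hoelder class H^beta([0,1]^d, B); the derivatives of g are those of its
   (given) extension to R^d, required to exist on the cube up to order s. *)
Definition holder_cube (d : nat) (beta B : R) (g : d.-tuple R -> R) : Prop :=
  let s := hfloor beta in
  let r := beta - s%:R in
  (forall a : 'I_d -> nat, (mi_order a < s)%N ->
     forall i x, cube01 x -> pdiffble i (pderivs a g) x) /\
  (forall a : 'I_d -> nat, (mi_order a <= s)%N ->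
     forall x, cube01 x -> `|pderivs a g x| <= B) /\
  (forall a : 'I_d -> nat, mi_order a = s ->
     forall x y, cube01 x -> cube01 y -> x <> y ->
       `|pderivs a g x - pderivs a g y| / (euclid_dist x y) `^ r <= B).

Definition holder_loc (d : nat) (beta : R) (B : R -> R) (f : d.-tuple R -> R) : Prop :=
  forall u : R, 0 < u ->
    holder_cube beta (B u) (fun x => f (map_tuple (fun t => 2 * u * t - u) x)).

Definition affine (n m : nat) (W : nat -> nat -> R) (b : nat -> R) (x : seq R) : seq R :=
  mkseq (fun j => \sum_(k < n) W j k * nth 0 x k + b j) m.

Definition relu (x : seq R) : seq R := map (fun y => Num.max y 0) x.

Fixpoint hidden (dims : nat -> nat) (W : nat -> nat -> nat -> R)
  (b : nat -> nat -> R) (x : seq R) (k : nat) : seq R :=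
  match k with
  | 0 => x
  | k'.+1 => relu (affine (dims k') (dims k) (W k) (b k) (hidden dims W b x k'))
  end.

Definition nn_eval (L : nat) (dims : nat -> nat) (W : nat -> nat -> nat -> R)
  (b : nat -> nat -> R) (x : seq R) : R :=
  nth 0 (affine (dims L) 1 (W L.+1) (b L.+1) (hidden dims W b x L)) 0.

Definition F_NN (d L M : nat) (lo hi : R) : set (d.-tuple R -> R) :=
  [set f | exists (dims : nat -> nat) (W : nat -> nat -> nat -> R) (b : nat -> nat -> R),
     dims 0%N = d /\ (\max_(1 <= i < L.+1) dims i)%N = M /\
     (forall x : d.-tuple R, f x = nn_eval L dims W b (val x)) /\
     (forall x, lo <= f x <= hi)].

Definition ls_crit (d n : nat) (xs ys : n.-tuple (d.-tuple R)) (f : d.-tuple R -> R) : R :=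
  n%:R^-1 * \sum_(i < n) f (tnth xs i) ^+ 2 - 2 / n%:R * \sum_(i < n) f (tnth ys i).

End Defs.

(* Main.v *)
(* For a network f, E[f(X^s)^2] - 2 E[f(X^t)] differs from E[(r_0 - f)(X^s)^2] by a constant,
   because r_0 is the density of the law of X^t with respect to that of X^s; so the estimator
   is compared with one good network g of the class.

   Estimation. Let a ghost sample replace the expectations. Swapping coordinates between the
   sample and the ghost sample does not change the joint law, and the average over all swaps of
   exp of the deviation, penalized by a multiple of (f - g)^2, is at most 1 for a fixed f. A
   union bound over the patterns of the tests [t/n <= f(z)] at the 4n sample points costs the
   logarithm of the number of patterns. For bounded width and depth L this is O(L^2): once the
   outcomes of the ReLU tests are prescribed, f(z) is a polynomial in the weights, and the
   sign patterns of a family of polynomials are counted by exhibiting in each cell a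
   critical point of a product of perturbed polynomials (Warren). Since r_0 is
   unbounded, the penalty on the target side is moved to the source side by truncating r_0 at
   a multiple of log n, which costs O(1/n) by the exponential moment.

   Approximation. A network of width 12 + d works as a register machine. It reads the binary
   digits of the input to locate it in a grid of mesh 4^-nu, and evaluates the Taylor polynomial
   of r_0 at the corner of the cell. The cells are grouped into 2^(nu d) coarse cells, and the
   coefficients of all the fine cells of a coarse cell are packed in the binary digits of a
   single weight, so that depth of order nu 2^(nu d) serves 4^(nu d) cells. The ball of
   radius of order log n carries all but O(1/n) of the mass. *)

(* A ReLU network is continuous, while extracting digits requires step functions. The register
   machine is therefore a pointwise limit of networks, exact from some index on at each input, and
   dominated convergence selects a network of the class whose risk exceeds that of the machine by at
   most 1/n.

   The supremum over the class is never formed: the swap inequality holds for four fixed samples and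
   an arbitrary choice of one function per swap, so measurability only concerns single networks and
   the estimator.

   Origin of the exponents: the depth gives L^2 / n of order n^(-2 beta / (d + 2 beta)) (log n)^2,
   and the squared clipping level contributes (log n)^(2 + 2 kappa). Since kappa > 0, exp(-a (log
   n)^(1 + kappa)) is O(1/n) for every a > 0, whatever the exponential moment. A ball of radius of
   order log n puts (log n)^m into the Hoelder constant, hence 2m after squaring. The last logarithm
   of the target rate is the truncation level of r_0. Smaller powers of log n are absorbed into
   larger ones at the price of a constant, because log n >= 1/2. *)
Require Import Defs.
From HB Require Import structures.
From mathcomp Require Import all_boot all_order all_algebra.
From mathcomp Require Import all_classical all_reals all_analysis.
From mathcomp Require Import ring lra zify.
Import Order.TTheory GRing.Theory Num.Theory.
Import numFieldNormedType.Exports measurable_realfun.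
Local Open Scope classical_set_scope.
Local Open Scope ring_scope.

(** * Sign patterns of polynomial families *)

Section Polyfun.
Context {R : realType} {W : nat}.
Local Notation V := 'rV[R]_W.
Implicit Types (f g : V -> R) (x : V).

(** A predicate on functions instead of formal polynomials in several variables. [D] is an upper
    bound on the total degree, and bounds on degree, growth, derivatives and reductions all become
    inductions on this derivation. *)
Inductive polyfun : nat -> (V -> R) -> Prop :=
| polyfun_cst D c : polyfun D (fun=> c)
| polyfun_mulX i D f : polyfun D f -> polyfun D.+1 (fun x => x 0 i * f x)
| polyfun_add D f g : polyfun D f -> polyfun D g -> polyfun D (fun x => f x + g x).

Lemma eq_polyfun D f g : f =1 g -> polyfun D f -> polyfun D g.
Proof. by move=> /funext ->. Qed.

Lemma polyfunS D E f : (D <= E)%N -> polyfun D f -> polyfun E f.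
Proof.
move=> + pf; elim: pf E => {D f} [D c E _|i D f _ IH [//|E] DE|D f g _ IHf _ IHg E DE].
- exact: polyfun_cst.
- exact/polyfun_mulX/IH.
- by apply: polyfun_add; [exact: IHf|exact: IHg].
Qed.

Lemma polyfunZ D c f : polyfun D f -> polyfun D (fun x => c * f x).
Proof.
elim=> {D f} [D c'|i D f _ IH|D f g _ IHf _ IHg].
- exact: polyfun_cst.
- by apply: eq_polyfun (polyfun_mulX i _ _ IH) => x; rewrite mulrCA.
- by apply: eq_polyfun (polyfun_add _ _ _ IHf IHg) => x; rewrite mulrDr.
Qed.

Lemma polyfunM D E f g : polyfun D f -> polyfun E g ->
  polyfun (D + E) (fun x => f x * g x).
Proof.
move=> pf pg; elim: pf => {D f} [D c|i D f _ IH|D f f' _ IHf _ IHf'].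
- by apply: polyfunS (polyfunZ E c _ pg); rewrite leq_addl.
- by rewrite addSn; apply: eq_polyfun (polyfun_mulX i _ _ IH) => x; rewrite mulrA.
- by apply: eq_polyfun (polyfun_add _ _ _ IHf IHf') => x; rewrite mulrDl.
Qed.

Lemma polyfun_sum (I : Type) (r : seq I) (P : pred I) D (F : I -> V -> R) :
  (forall i, P i -> polyfun D (F i)) -> polyfun D (fun x => \sum_(i <- r | P i) F i x).
Proof.
move=> pF; elim: r => [|i r IH].
  by apply: eq_polyfun (polyfun_cst D 0) => x; rewrite big_nil.
have [Pi|Pi] := boolP (P i).
  by apply: eq_polyfun (polyfun_add _ _ _ (pF i Pi) IH) => x; rewrite big_cons Pi.
by apply: eq_polyfun IH => x; rewrite big_cons (negPf Pi).
Qed.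

Lemma polyfun_prod (I : Type) (r : seq I) (P : pred I) (D : I -> nat)
    (F : I -> V -> R) : (forall i, P i -> polyfun (D i) (F i)) ->
  polyfun (\sum_(i <- r | P i) D i) (fun x => \prod_(i <- r | P i) F i x).
Proof.
move=> pF; elim: r => [|i r IH].
  by apply: eq_polyfun (polyfun_cst _ 1) => x; rewrite big_nil.
rewrite big_cons; have [Pi|Pi] := boolP (P i).
  by apply: eq_polyfun (polyfunM _ _ _ _ (pF i Pi) IH) => x; rewrite big_cons Pi.
by apply: eq_polyfun IH => x; rewrite big_cons (negPf Pi).
Qed.

Lemma polyfun_coord i : polyfun 1 (fun x => x 0 i).
Proof.
by apply: eq_polyfun (polyfun_mulX i _ _ (polyfun_cst 0 1)) => x; rewrite mulr1.
Qed.

Lemma polyfun_coordX i n : polyfun n (fun x => x 0 i ^+ n).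
Proof.
elim: n => [|n IH]; first exact: eq_polyfun (polyfun_cst 0 1).
by apply: eq_polyfun (polyfun_mulX i _ _ IH) => x; rewrite exprS.
Qed.

Lemma polyfun_continuous D f : polyfun D f -> continuous f.
Proof.
elim=> {D f} [D c|i D f _ IH|D f g _ IHf _ IHg] x; first exact: cst_continuous.
- by apply: continuousM; [exact: (@coord_continuous R 1 W 0 i x)|exact: IH].
- by apply: continuousD; [exact: IHf|exact: IHg].
Qed.

(** Used to see that a penalty of higher degree dominates far from the origin. *)
Lemma polyfun_growth D f : polyfun D f -> exists2 C : R, 0 <= C &
  forall x N, 1 <= N -> (forall j, `|x 0 j| <= N) -> `|f x| <= C * N ^+ D.
Proof.
elim=> {D f} [D c|i D f _ [C C0 IH]|D f g _ [C C0 IHf] _ [C' C'0 IHg]].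
- by exists `|c| => // x N N1 _; rewrite ler_peMr ?normr_ge0// exprn_ege1.
- exists C => // x N N1 xN; rewrite normrM exprS mulrCA.
  by apply: ler_pM; rewrite ?normr_ge0//; exact: IH.
- exists (C + C'); first exact: addr_ge0.
  move=> x N N1 xN; rewrite mulrDl (le_trans (ler_normD _ _))//.
  by apply: lerD; [exact: IHf|exact: IHg].
Qed.

Definition setc x i (t : R) : V := \row_j (if j == i then t else x 0 j).

Lemma setc_id x i : setc x i (x 0 i) = x.
Proof. by apply/rowP => j; rewrite mxE; case: eqP => // ->. Qed.

(** In degree 0 the derivative has to be recorded as zero and not just as constant: otherwise the
    summand [x 0 k * f' x] in the product rule would have degree 1 where 0 is claimed. *)
Lemma polyfun_derive i D f : polyfun D f -> exists2 f',
  (if D is D'.+1 then polyfun D' f' else forall x, f' x = 0) &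
  forall x t, is_derive t (1 : R) (fun t => f (setc x i t)) (f' (setc x i t)).
Proof.
elim=> {D f} [D c|k D f pf [f' pf' IH]|D f g _ [f' pf' IHf] _ [g' pg' IHg]].
- exists (fun=> 0); first by case: D => // D; exact: polyfun_cst.
  by move=> x t; exact: is_derive_cst.
- exists (fun x => (k == i)%:R * f x + x 0 k * f' x).
    apply: polyfun_add; first exact: polyfunZ.
    case: D {pf IH} pf' => [f'0|D pf']; last exact: polyfun_mulX.
    by apply: eq_polyfun (polyfun_cst 0 0) => x; rewrite f'0 mulr0.
  move=> x t; have dk : is_derive t (1 : R) (fun t => setc x i t 0 k) (k == i)%:R.
    have [->|ki] := eqVneq k i.
      rewrite (_ : (fun _ => _) = id); first exact: is_derive_id.
      by apply/funext => u; rewrite mxE eqxx.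
    rewrite (_ : (fun _ => _) = cst (x 0 k)); first exact: is_derive_cst.
    by apply/funext => u; rewrite mxE (negPf ki).
  have := is_deriveM dk (IH x t) => /is_derive_eq; apply.
  by rewrite /GRing.scale/= addrC mulrC.
- exists (fun x => f' x + g' x).
    by case: D pf' pg' {IHf IHg} => [a b x|D]; [rewrite a b addr0|exact: polyfun_add].
  by move=> x t; exact: is_deriveD (IHf x t) (IHg x t).
Qed.

Lemma polyfun_derive_pred i D f : polyfun D f -> exists2 f', polyfun D.-1 f' &
  forall x t, is_derive t (1 : R) (fun t => f (setc x i t)) (f' (setc x i t)).
Proof.
move=> /(polyfun_derive i)[f' pf' df]; exists f' => //.
case: D pf' => //= f'0; by apply: eq_polyfun (polyfun_cst 0 0) => x; rewrite f'0.
Qed.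

(** By compactness [G] has a maximum on the closed cell cut down to [G >= G x0]. On the walls [G] is
    at most 0, so the maximum lies in the open cell and remains a local maximum along every
    coordinate line. *)
Lemma cell_critical_point (I : finType) (f : I -> V -> R) (G : V -> R)
    (dG : 'I_W -> V -> R) (x0 : V) (b : R) :
  (forall k x i t0, derivable (fun t => f k (setc x i t)) t0 1) ->
  (forall k, continuous (f k)) -> continuous G ->
  (forall i x t, is_derive t (1 : R) (fun t => G (setc x i t)) (dG i (setc x i t))) ->
  (forall k, 0 < f k x0) -> 0 < G x0 ->
  (forall k x, f k x = 0 -> G x <= 0) ->
  (forall x, 0 < G x -> forall j, `|x 0 j| <= b) ->
  exists2 x, forall k, 0 < f k x & forall i, dG i x = 0.
Proof.
move=> df cf cG dGE f0 G0 fG Gb.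
pose A := [set x | [/\ forall k, 0 <= f k x, G x0 <= G x & forall j, x 0 j \in `[- b, b]]].
have cA : compact A.
  rewrite (_ : A = (\bigcap_k [set x | 0 <= f k x]) `&` [set x | G x0 <= G x] `&`
      [set x : V | forall j, `[- b, b]%classic (x 0 j)]); last first.
    apply/seteqP; split => x /=.
      by move=> [fx Gx xb]; split; [split|] => // k _; exact: fx.
    by move=> [[fx Gx] xb]; split => // k; exact: fx.
  rewrite setIC; apply: compact_closedI.
    have := @rV_compact R W (fun=> `[- b, b]%classic) (fun _ => @segment_compact _ _ _). by [].
  apply: closedI.
    by apply: closed_bigI => k _; exact: (@preimage_closed V R (f k) [set y | 0 <= y] (fun x _ => cf k x) (@closed_ge R 0)).
  exact: (@preimage_closed V R G [set y | G x0 <= y] (fun x _ => cG x) (@closed_ge R _)).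
have xA x : (forall k, 0 <= f k x) -> G x0 <= G x -> A x.
  move=> fx Gx; split => // j; rewrite in_itv/= -ler_norml; apply: Gb.
  exact: lt_le_trans G0 Gx.
have [||x] := compact_EVT_max _ cA (f := G).
- by exists x0; apply: xA => // k; exact/ltW.
- exact: continuous_subspaceT.
rewrite inE => -[fx Gx xb] xmax.
have fxp k : 0 < f k x.
  rewrite lt_neqAle fx andbT eq_sym; apply/eqP => /fG.
  by rewrite leNgt (lt_le_trans G0 Gx).
exists x => // i.
have : \forall t \near (x 0 i : R), forall k, 0 < f k (setc x i t).
  refine (@filter_forall R I (fun k t => 0 < f k (setc x i t)) (nbhs (x 0 i : R)) _ _) => k.
  have /differentiable_continuous : differentiable (fun t => f k (setc x i t)) (x 0 i).
    exact/derivable1_diffP.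
  by move=> /(cvgr_gt (f k (setc x i (x 0 i)))); apply; rewrite setc_id.
move=> /nbhs_ballP[e /= e0 be].
have xI : x 0 i \in `](x 0 i - e), (x 0 i + e)[ by rewrite in_itv/=; lra.
have d0 : is_derive (x 0 i : R) (1 : R) (fun t => G (setc x i t)) 0.
  apply: (@derive1_at_max _ _ (x 0 i - e) (x 0 i + e)) => //.
  - lra.
  - move=> t; rewrite in_itv/= => /andP[t1 t2]; rewrite setc_id.
    (* A competitor below the level [G x0] cannot beat [x]; one above that level belongs to [A]. *)
    have [//|/ltW] := leP (G (setc x i t)) (G x0); first by move/le_trans; apply.
    move=> h; apply: xmax; rewrite inE; apply: xA => // k; apply/ltW.
    by apply: (be t); rewrite /ball/= ltr_distl; lra.
have d1 := dGE i x (x 0 i); rewrite setc_id in d1.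
by rewrite -(@derive_val _ _ _ _ _ _ _ d1) (@derive_val _ _ _ _ _ _ _ d0).
Qed.

End Polyfun.

(** * Counting sign patterns through critical points *)

Section Counting.
Context {R : realType} {W : nat}.
Local Notation V := 'rV[R]_W.

Section Reduction.
Variables (e' K : nat) (Z : 'I_K -> V) (P : 'I_W -> V -> R).
Hypothesis polP : forall i, polyfun e' (P i).
Hypothesis Z_P : forall i k, Z k 0 i ^+ e'.+1 = P i (Z k).
Local Notation expo := {ffun 'I_W -> 'I_e'.+1}.

Let mono (a : expo) (x : V) : R := \prod_i x 0 i ^+ a i.

Let deg (a : expo) := (\sum_i a i)%N.

(** Row [a] lists the values of one monomial at the points. Monomials of total degree above [D] give
    zero rows, so the size of the matrix does not depend on [D] while its row space grows with
    [D]. *)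
Definition evmx D : 'M[R]_(#|{: expo}|, K) :=
  \matrix_(a, k) if (deg (enum_val a) <= D)%N then mono (enum_val a) (Z k) else 0.

Let mono_sub D (a : expo) : (deg a <= D)%N ->
  ((\row_k mono a (Z k)) <= evmx D)%MS.
Proof.
move=> aD; have <- : row (enum_rank a) (evmx D) = \row_k mono a (Z k).
  by apply/rowP => k; rewrite !mxE enum_rankK aD.
exact: row_sub.
Qed.

Let evmx_mono D E : (D <= E)%N -> (evmx D <= evmx E)%MS.
Proof.
move=> DE; apply/row_subP => a; have [aD|aD] := boolP (deg (enum_val a) <= D)%N.
  rewrite (_ : row a _ = \row_k mono (enum_val a) (Z k)).
    exact/mono_sub/(leq_trans aD).
  by apply/rowP => k; rewrite !mxE aD.
rewrite (_ : row a _ = 0) ?sub0mx//.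
by apply/rowP => k; rewrite !mxE (negPf aD).
Qed.

(** At the given points a power [x_i ^ e'.+1] can be replaced by [P i], whose degree is smaller.
    Each replacement lowers the total degree, so every polynomial restricted to the points ends up
    in the span of the monomials with all exponents at most [e']. *)
Lemma polyfun_reduction D f : polyfun D f -> ((\row_k f (Z k)) <= evmx D)%MS.
Proof.
elim/ltn_ind: D f => D IHD f pf; elim: pf IHD => {D f} [D c|i D f pf _|D f g _ IHf _ IHg] IHD.
- rewrite (_ : (\row_k c) = c *: \row_k mono [ffun=> ord0] (Z k)).
    by apply/scalemx_sub/mono_sub; rewrite /deg big1// => j _; rewrite ffunE.
  by apply/rowP => k; rewrite !mxE /mono big1 ?mulr1// => j _; rewrite ffunE.
- have /submxP[u uE] := IHD D (ltnSn D) f pf.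
  rewrite (_ : (\row_k _) = \sum_a u 0 a *: \row_k (Z k 0 i * evmx D a k)); last first.
    apply/rowP => k; rewrite mxE summxE.
    have := congr1 (fun v : 'rV_K => v 0 k) uE; rewrite mxE => ->.
    by rewrite mxE mulr_sumr; apply: eq_bigr => a _; rewrite !mxE mulrCA.
  apply: summx_sub => a _; apply: scalemx_sub.
  set b := enum_val a; have [bD|bD] := boolP (deg b <= D)%N; last first.
    rewrite (_ : (\row_k _) = 0) ?sub0mx//.
    by apply/rowP => k; rewrite !mxE -/b (negPf bD) mulr0.
  rewrite (_ : (\row_k _) = \row_k (Z k 0 i * mono b (Z k))); last first.
    by apply/rowP => k; rewrite !mxE -/b bD.
  move: bD; rewrite /deg (bigD1 i)//= => bD.
  have [bi|bi] := ltnP (b i) e'.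
    pose b' : expo := [ffun j => if j == i then inord (b i).+1 else b j].
    have b'i : b' i = (b i).+1 :> nat by rewrite ffunE eqxx inordK.
    have b'j j : j != i -> b' j = b j by move=> ji; rewrite ffunE (negPf ji).
    rewrite (_ : (\row_k _) = \row_k mono b' (Z k)).
      apply: mono_sub; rewrite /deg (bigD1 i)//= b'i.
      by rewrite (eq_bigr (fun j => b j : nat)) => [|j /b'j -> //].
    apply/rowP => k; rewrite !mxE /mono (bigD1 i)//= [RHS](bigD1 i)//= b'i exprS mulrA.
    by congr *%R; apply: eq_bigr => j /b'j ->.
  (* Multiplying by [x_i] would overflow the exponent. After the replacement by [P i] the degree is
     at most [e'] plus the remaining exponents, hence at most [D], and the strong induction
     hypothesis applies. *)
  have bie : b i = e' :> nat by apply/eqP; rewrite eqn_leq bi -ltnS ltn_ord.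
  pose h x := P i x * \prod_(j < W | j != i) x 0 j ^+ b j.
  rewrite (_ : (\row_k _) = \row_k h (Z k)).
    apply: submx_trans (evmx_mono _ _ (leqnSn D)); apply: IHD => //.
    apply: (@polyfunS _ _ (e' + \sum_(j < W | j != i) b j)); first by rewrite -{1}bie.
    apply: polyfunM => //; apply: polyfun_prod => j _; exact: polyfun_coordX.
  apply/rowP => k; rewrite !mxE /mono (bigD1 i)//= bie mulrA -exprS Z_P//.
- rewrite (_ : (\row_k _) = \row_k f (Z k) + \row_k g (Z k)).
    by apply: addmx_sub; [exact: IHf|exact: IHg].
  by apply/rowP => k; rewrite !mxE.
Qed.

(** Lagrange interpolation: the indicator of each point is a polynomial, so the evaluation matrix
    has rank [K], which cannot exceed its number of rows. *)
Lemma leq_reduced_points : injective Z -> (K <= e'.+1 ^ W)%N.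
Proof.
move=> injZ; pose D := (K * 1)%N.
have sub1 : (1%:M <= evmx D)%MS.
  apply/row_subP => k.
  pose q (l : 'I_K) (x : V) := if [pick j | Z k 0 j - Z l 0 j != 0] is Some j
    then (Z k 0 j - Z l 0 j)^-1 * (x 0 j + - Z l 0 j) else 1.
  have pq l : polyfun 1 (q l).
    rewrite /q; case: pickP => [j _|_]; last exact: polyfun_cst.
    apply: polyfunZ; apply: polyfun_add; first exact: polyfun_coord.
    exact: polyfun_cst.
  have q1 l : q l (Z k) = 1 by rewrite /q; case: pickP => // j; exact: mulVf.
  have q0 l : l != k -> q l (Z l) = 0.
    rewrite /q; case: pickP => [j _ _|kl]; first by rewrite subrr mulr0.
    case/eqP; apply: injZ; apply/rowP => j; apply/esym/eqP.
    by rewrite -subr_eq0; have /negbFE := kl j.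
  pose p (x : V) := \prod_(l < K | l != k) q l x.
  have pp : polyfun D p.
    apply: (@polyfunS _ _ (\sum_(l < K | l != k) 1)); last exact: polyfun_prod.
    by rewrite sum_nat_const leq_mul2r -[X in (_ <= X)%N]card_ord max_card orbT.
  have := polyfun_reduction _ _ pp; rewrite (_ : \row_k0 _ = row k 1%:M)//.
  apply/rowP => l; rewrite !mxE; have [<-|kl] := eqVneq k l.
    by rewrite /p big1.
  by rewrite /p (bigD1 l) 1?eq_sym//= q0 ?mul0r// eq_sym.
rewrite -[X in (X <= _)%N](@mxrank1 R) (leq_trans (mxrankS sub1))//.
rewrite (leq_trans (rank_leq_row _))//.
by rewrite card_ffun !card_ord.
Qed.
End Reduction.

(** Source of the two perturbation sizes of the next count. Halving the minimum makes the inequality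
    strict, and the 1 covers a family without positive values. *)
Lemma finite_lower_bound (J : finType) (a : J -> R) :
  exists2 e : R, 0 < e & forall j, 0 < a j -> e < a j.
Proof.
exists (\big[Num.min/1]_(j | 0 < a j) a j / 2).
  by rewrite divr_gt0//; apply: lt_bigmin.
move=> j aj; have : 0 < \big[Num.min/1]_(j | 0 < a j) a j by exact: lt_bigmin.
have := @bigmin_le_cond _ _ _ 1 j (fun j => 0 < a j) a aj; lra.
Qed.

Lemma is_derive_sum_coordX n i (x : V) t :
  is_derive t (1 : R) (fun t => \sum_j (setc x i t) 0 j ^+ n.+1)
    (n.+1%:R * (setc x i t) 0 i ^+ n).
Proof.
rewrite (_ : (fun _ => _) = (fun t => t ^+ n.+1 + \sum_(j | j != i) x 0 j ^+ n.+1)).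
  set c := \sum_(j | _) _.
  have := is_deriveD (is_deriveX n.+1 (is_derive_id t (1 : R))) (is_derive_cst c t (1 : R)).
  by rewrite exprfctE => /is_derive_eq; apply; rewrite addr0 mxE eqxx /GRing.scale/= mulr1.
apply/funext => u; rewrite (bigD1 i)//= mxE eqxx; congr (_ + _).
by apply: eq_bigr => j /negPf ji; rewrite mxE ji.
Qed.

(* Each cell of the sign arrangement of the [f i + delta] contains a local
   maximum of [prod (f i + delta)^2 - eps * sum x_j^(2E)]; at the critical points
   of this function [x_j^(2E-1)] equals a polynomial of lower degree, hence
   there are at most [(2E-1)^W] of them. *)
Lemma card_sign_patterns (I : finType) (f : I -> V -> R) D
    (S : {set {ffun I -> bool}}) : (0 < W)%N ->
  (forall i, polyfun D (f i)) ->
  (forall s, s \in S -> exists x, forall i, s i = (0 <= f i x)) ->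
  (#|S| <= (2 * (#|I| * D)).+1 ^ W)%N.
Proof.
move=> W0 pf Sf; set m := (#|I| * D)%N.
pose J := {s : {ffun I -> bool} | s \in S}.
have /choice[y yP] (s : J) : exists x, forall i, val s i = (0 <= f i x).
  exact/Sf/valP.
(* Adding [d] makes the nonnegative values at the chosen points positive and is too small to bring a
   negative value up to 0. All cells thus become open. *)
have [d d0 dP] := finite_lower_bound (J * I)%type (fun si => - f si.2 (y si.1)).
pose f' i x := f i x + d.
have pf' i : polyfun D (f' i) by apply: polyfun_add => //; exact: polyfun_cst.
pose g (s : J) i x := (-1) ^+ (~~ val s i) * f' i x.
have pg s i : polyfun D (g s i) by exact: polyfunZ.
have g_gt0 s i : 0 < g s i (y s).
  rewrite /g yP; have [fy|fy] := leP 0 (f i (y s)); rewrite /= /f'.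
    by rewrite expr0 mul1r; lra.
  have := dP (s, i); rewrite /= oppr_gt0 => /(_ fy); rewrite expr1; lra.
pose F x := \prod_i (f' i x * f' i x).
have pF : polyfun (2 * m) F.
  rewrite (_ : (2 * m)%N = (\sum_(i : I) (D + D))%N).
    by apply: polyfun_prod => i _; exact: polyfunM.
  by rewrite sum_nat_const /m addnn mul2n doubleMr.
(* The exponent is even, exceeds the degree [2 * m] of [F], and its derivative produces
   [x_i ^ (2 * m).+1] equal to a polynomial of degree at most [2 * m], which is the shape required
   by the reduction. *)
pose H (x : V) := \sum_j x 0 j ^+ (2 * m).+2.
have H_ge0 x : 0 <= H x.
  by apply: sumr_ge0 => j _; rewrite exprn_even_ge0//= oddM.
have F_gt0 s : 0 < F (y s).
  apply: prodr_gt0 => i _; rewrite -expr2 exprn_even_gt0//=.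
  by apply/eqP => f'0; have := g_gt0 s i; rewrite /g f'0 mulr0 ltxx.
(* With this [e] the penalized function is still positive at every chosen point [y s]. *)
have [e e0 eP] := finite_lower_bound J (fun s => F (y s) / (1 + H (y s))).
have eH s : e * H (y s) < F (y s).
  have H1 : 0 < 1 + H (y s) by rewrite ltr_pwDl.
  have : 0 < F (y s) / (1 + H (y s)) by rewrite divr_gt0.
  by move=> /eP; rewrite ltr_pdivlMr// mulrDr mulr1; lra.
have dFP i : exists2 h, polyfun (2 * m) h & forall x t,
    is_derive t (1 : R) (fun t => F (setc x i t)) (h (setc x i t)).
  have [h ph hP] := polyfun_derive_pred i _ _ pF.
  by exists h => //; apply: polyfunS ph; exact: leq_pred.
have /choice[dF dFE] i : exists h, polyfun (2 * m) h /\ forall x t,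
    is_derive t (1 : R) (fun t => F (setc x i t)) (h (setc x i t)).
  by have [h ph hP] := dFP i; exists h.
pose G x := F x + (- e) * H x.
pose dG i x := dF i x + (- e) * ((2 * m).+2%:R * x 0 i ^+ (2 * m).+1).
have [C C0 FC] := polyfun_growth _ _ pF.
have crit (s : J) : exists x, (forall i, 0 < g s i x) /\ forall i, dG i x = 0.
  have [||||||||x xg xG] := @cell_critical_point R W I (g s) G dG (y s) (1 + C / e).
  - move=> k x i t; have [h _ hP] := polyfun_derive_pred i _ _ (pg s k).
    exact: (@ex_derive _ _ _ _ _ _ _ (hP x t)).
  - by move=> k; exact: polyfun_continuous (pg s k).
  - apply: (@polyfun_continuous _ _ (2 * m).+2); apply: polyfun_add.
      by apply: polyfunS pF; exact/leqW/leqnSn.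
    by apply: polyfunZ; apply: polyfun_sum => j _; exact: polyfun_coordX.
  - move=> i x t; apply: is_deriveD; first by case: (dFE i).
    have := is_derive_sum_coordX (2 * m).+1 i x t => hd.
    exact: is_deriveZ.
  - exact: g_gt0.
  - by rewrite /G mulNr subr_gt0.
  - move=> k x gx; rewrite /G (_ : F x = 0).
      by rewrite add0r mulNr oppr_le0 mulr_ge0// ltW.
    have f'x : f' k x = 0.
      by move/eqP: gx; rewrite /g mulf_eq0 signr_eq0 => /eqP.
    by rewrite /F (bigD1 k)//= f'x !mul0r.
  (* Let [N] be the largest absolute coordinate. If [N > 1], then [e * N ^ (2m + 2) <= e * H x < F x
     <= C * N ^ (2m)], hence [N <= N ^ 2 < C / e]. *)
  - move=> x Gx; pose i0 := Ordinal W0.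
    pose j := [arg max_(j > i0) `|x 0 j|]%O.
    have xj k : `|x 0 k| <= `|x 0 j|.
      by rewrite /j; case: (@Order.TotalTheory.arg_maxP _ _ _ i0 xpredT (fun j => `|x 0 j|)) => // l _; exact.
    move=> k; apply: le_trans (xj k) _.
    have [xj1|xj1] := leP `|x 0 j| 1.
      by rewrite (le_trans xj1)// lerDl divr_ge0// ltW.
    have := FC x _ (ltW xj1) xj => /(le_trans (ler_norm _)) FxC.
    have Hj : `|x 0 j| ^+ (2 * m).+2 <= H x.
      rewrite /H (bigD1 j)//= -normrX ger0_norm ?exprn_even_ge0//= ?oddM//.
      by rewrite lerDl sumr_ge0// => l _; rewrite exprn_even_ge0//= oddM.
    have {}Gx : e * H x < F x by move: Gx; rewrite /G; lra.
    have : e * `|x 0 j| ^+ (2 * m).+2 < C * `|x 0 j| ^+ (2 * m).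
      by apply: le_lt_trans (lt_le_trans Gx FxC); rewrite ler_pM2l.
    rewrite -addn2 exprD mulrCA mulrC ltr_pM2r ?exprn_gt0 ?(lt_trans ltr01)//.
    move=> h; have {h} h : `|x 0 j| ^+ 2 < C / e by rewrite ltr_pdivlMr// mulrC.
    have : `|x 0 j| <= `|x 0 j| ^+ 2 by rewrite expr2 ler_peMr//; exact: ltW.
    by move: h; lra.
  by exists x.
have {crit} /choice[z zP] := crit.
pose Z (k : 'I_#|S|) := z (exist _ (enum_val k) (enum_valP k)).
(* A common critical point would have the strict signs of both patterns, so the patterns would
   coincide. *)
have injZ : injective Z.
  move=> k l kl; apply: enum_val_inj; apply/ffunP => i.
  pose sk : J := exist _ (enum_val k) (enum_valP k).
  pose sl : J := exist _ (enum_val l) (enum_valP l).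
  have := (zP sk).1 i; have := (zP sl).1 i; rewrite -/(Z k) -/(Z l) -kl /g /=.
  by do 2 case: (fun_of_fin _ i) => //=; rewrite ?expr0 ?expr1; lra.
pose P i x := (e * (2 * m).+2%:R)^-1 * dF i x.
apply: (@leq_reduced_points (2 * m) #|S| Z P) => // [i|i k].
  by apply: polyfunZ; case: (dFE i).
rewrite /P; have := (zP (exist _ (enum_val k) (enum_valP k))).2 i; rewrite -/(Z k) /dG.
move=> h; have {h} -> : dF i (Z k) = e * (2 * m).+2%:R * Z k 0 i ^+ (2 * m).+1 by lra.
by rewrite mulKf// mulf_neq0// ?gt_eqF// ltr0n.
Qed.
End Counting.

(** * Activation patterns of networks *)

Section NetworkPatterns.
Context {R : realType}.

Section Layers.
Variables (dims : nat -> nat) (w : nat -> nat -> nat -> R) (b : nat -> nat -> R).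
Variable x : seq R.

Definition preact (h : nat -> R) k j : R := \sum_(l < dims k.-1) w k j l * h l + b k j.

Fixpoint act k : nat -> R :=
  if k is k'.+1 then fun j => Num.max (preact (act k') k j) 0 else nth 0 x.

(* The forward pass in which the outcomes of all ReLU tests are prescribed by [A]. *)
Fixpoint forced (A : nat -> nat -> bool) k : nat -> R :=
  if k is k'.+1 then fun j => if A k j then preact (forced A k') k j else 0
  else nth 0 x.

Lemma nth_hidden k j : (j < dims k)%N || (k == 0)%N ->
  nth 0 (hidden dims w b x k) j = act k j.
Proof.
elim: k j => [|k IH] j //=; rewrite orbF => jk.
rewrite (nth_map 0) ?size_mkseq// nth_mkseq//; congr Num.max.
by rewrite /preact; congr (_ + _); apply: eq_bigr => l _; rewrite IH ?ltn_ord.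
Qed.

Lemma nn_evalE L : nn_eval L dims w b x = preact (act L) L.+1 0.
Proof.
rewrite /nn_eval /affine nth_mkseq//; congr (_ + _); apply: eq_bigr => l _.
by rewrite nth_hidden ?ltn_ord.
Qed.

Lemma eq_preact h h' k j : (forall l, (l < dims k.-1)%N -> h l = h' l) ->
  preact h k j = preact h' k j.
Proof. by move=> hh'; congr (_ + _); apply: eq_bigr => l _; rewrite hh'. Qed.

(** [A] is compared with the tests as they come out in the forced pass itself, and agreement
    propagates from layer to layer. A statement about signs of polynomials thus certifies the true
    forward pass. *)
Lemma forced_act A L :
  (forall k j, (0 < k <= L)%N -> (j < dims k)%N -> A k j = (0 <= preact (forced A k.-1) k j)) ->
  forall k j, (k <= L)%N -> (j < dims k)%N || (k == 0)%N -> forced A k j = act k j.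
Proof.
move=> AL; elim=> [//|k IH] j kL; rewrite orbF => jk.
have E : preact (forced A k) k.+1 j = preact (act k) k.+1 j.
  by apply: eq_preact => l lk; rewrite IH ?lk// ltnW.
rewrite /= AL//= E; case: leP => //.
Qed.

End Layers.

(** Packing a network into a parameter vector keeps only the entries with indices in range; this
    shows that the forward pass sees no others. *)
Lemma eq_act dims dims' w w' b b' x L Q :
  (forall k, (k <= L)%N -> dims k = dims' k) ->
  (forall k, (0 < k <= L)%N -> (dims k <= Q)%N) ->
  (forall k j l, (0 < k <= L.+1)%N -> (j < Q)%N -> (l < dims k.-1)%N -> w k j l = w' k j l) ->
  (forall k j, (0 < k <= L.+1)%N -> (j < Q)%N -> b k j = b' k j) ->
  forall k j, (k <= L)%N -> (j < dims k)%N || (k == 0)%N ->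
    act dims w b x k j = act dims' w' b' x k j.
Proof.
move=> dd dQ ww bb; elim=> [//|k IH] j kL; rewrite orbF => jk /=.
have jQ : (j < Q)%N by rewrite (leq_trans jk)// dQ.
congr Num.max; rewrite /preact /= -dd ?(ltnW kL)// bb// ?(leqW kL)//; congr (_ + _).
apply: eq_bigr => l _; congr (_ * _); last by rewrite IH ?ltn_ord// ltnW.
by apply: ww; rewrite //= ltnS ltnW.
Qed.

Section NetworkParameters.
Variables (L Q : nat).
(** One parameter space for all architectures of depth [L] and width at most [Q]. The value [Q.+1]
    of the last index addresses the bias. *)
Definition pidx : finType := ('I_L.+2 * 'I_Q.+1 * 'I_Q.+2)%type.
Local Notation V := 'rV[R]_#|pidx|.

Definition param (th : V) (k j l : nat) : R :=
  th 0 (enum_rank ((inord k, inord j, inord l) : pidx)).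

Definition pack (w : nat -> nat -> nat -> R) (b : nat -> nat -> R) : V :=
  \row_i let u : pidx := enum_val i in
    if (u.2 <= Q)%N then w u.1.1 u.1.2 u.2 else b u.1.1 u.1.2.

Lemma param_pack w b k j l : (k <= L.+1)%N -> (j <= Q)%N -> (l <= Q.+1)%N ->
  param (pack w b) k j l = if (l <= Q)%N then w k j l else b k j.
Proof. by move=> kL jQ lQ; rewrite /param mxE enum_rankK /= !inordK. Qed.

Definition weight th k j l := param th k j l.
Definition bias th k j := param th k j Q.+1.

Lemma polyfun_preact dims D (h : V -> nat -> R) k j :
  (forall l, polyfun D (fun th => h th l)) ->
  polyfun D.+1 (fun th => preact dims (weight th) (bias th) (h th) k j).
Proof.
move=> ph; apply: polyfun_add; last exact: polyfunS (polyfun_coord _).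
by apply: polyfun_sum => l _; exact: polyfun_mulX.
Qed.

Lemma polyfun_forced dims x A k j :
  polyfun k (fun th => forced dims (weight th) (bias th) x A k j).
Proof.
elim: k j => [|k IH] j /=; first exact: polyfun_cst.
by case: (A _ _); [exact: polyfun_preact|exact: polyfun_cst].
Qed.

End NetworkParameters.

(** [fam] counts the polynomials: one for each sample point, each prescription of the ReLU outcomes,
    and each ReLU test or threshold. They have degree at most [L.+1] in the parameters, whose number
    is the exponent; the first factor counts architectures. The factor exponential in [L] only
    enters through its logarithm, which keeps the total at order [L ^ 2]. *)
Definition capacity (L Q N T : nat) : nat :=
  let fam := (N * 2 ^ (L.+1 * Q.+1) * (L.+1 * Q.+1 + T))%N in
  ((Q.+1 ^ L.+1) * (2 * (fam * L.+1)).+1 ^ (L.+2 * Q.+1 * Q.+2))%N.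

(** All prescriptions of the ReLU outcomes are included, consistent or not, so the family of
    polynomials does not depend on the parameters. Their signs reveal which prescription is the true
    one, and then the outcome of every threshold test. *)
Lemma card_threshold_patterns d L M Q (lo hi : R) (N T : nat)
    (z : 'I_N -> d.-tuple R) (t : 'I_T -> R) (S : {set {ffun 'I_N * 'I_T -> bool}}) :
  (d <= Q)%N -> (M <= Q)%N ->
  (forall s, s \in S -> exists2 f, @F_NN R d L M lo hi f &
     forall i, s i = (t i.2 <= f (z i.1))) ->
  (#|S| <= capacity L Q N T)%N.
Proof.
move=> dQ MQ SF.
pose pat := {ffun 'I_L.+1 * 'I_Q.+1 -> bool}.
pose FI : finType := ('I_N * pat * ('I_L.+1 * 'I_Q.+1 + 'I_T))%type.
pose arch : finType := {ffun 'I_L.+1 -> 'I_Q.+1}.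
pose dm (a : arch) (k : nat) : nat := if (k == 0)%N then d else a (inord k).
pose AA (A : pat) (k j : nat) := A (inord k, inord j).
pose V := 'rV[R]_#|pidx L Q|.
pose pol (a : arch) (u : FI) (th : V) : R :=
  let: (i, A, v) := u in
  let h k := forced (dm a) (weight _ _ th) (bias _ _ th) (val (z i)) (AA A) k in
  match v with
  | inl (k, j) => preact (dm a) (weight _ _ th) (bias _ _ th) (h k.-1) k j
  | inr tau => preact (dm a) (weight _ _ th) (bias _ _ th) (h L) L.+1 0 - t tau
  end.
have ppol a u : polyfun L.+1 (pol a u).
  case: u => [[i A] [[k j]|tau]] /=.
    apply: (@polyfunS _ _ k.-1.+1); first by case: k => -[|k] //= /ltnW.
    by apply: polyfun_preact => l; exact: polyfun_forced.
  apply: polyfun_add; last exact: polyfun_cst.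
  by apply: polyfun_preact => l; exact: polyfun_forced.
pose true_out a (th : V) i :=
  preact (dm a) (weight _ _ th) (bias _ _ th) (act (dm a) (weight _ _ th) (bias _ _ th) (val (z i)) L) L.+1 0.
have dmQ a k : (k != 0)%N -> (dm a k <= Q)%N by rewrite /dm => /negPf ->; rewrite -ltnS.
have real s : exists ath : arch * V, s \in S -> forall i, s i = (t i.2 <= true_out ath.1 ath.2 i.1).
  have [/SF[f [dims [w [b [d0 [dM [fE _]]]]] sf]]|sS] := boolP (s \in S); last first.
    by exists ([ffun=> ord0], 0).
  have dimsQ k : (0 < k <= L)%N -> (dims k <= Q)%N.
    move=> /andP[k0 kL]; apply: leq_trans MQ; rewrite -dM.
    by apply: (@leq_bigmax_seq _ _ xpredT dims k) => //; rewrite mem_index_iota k0.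
  pose a : arch := [ffun k : 'I_L.+1 => inord (dims k)].
  exists (a, pack L Q w b) => _ i; rewrite sf fE nn_evalE /true_out /=; congr (_ <= _).
  have dE k : (k <= L)%N -> dims k = dm a k.
    rewrite /dm; case: eqP => [-> //|/eqP k0 kL].
    by rewrite ffunE [in RHS](_ : nat_of_ord (inord k) = k) ?inordK ?ltnS// dimsQ// lt0n k0.
  have dimsQ' k : (k <= L)%N -> (dims k <= Q)%N.
    by case: k => [_|k kL]; [rewrite d0|exact: dimsQ].
  rewrite /preact /= -dE// /bias param_pack// ltnn; congr (_ + _).
  apply: eq_bigr => l _; have lQ : (l <= Q)%N by rewrite ltnW// (leq_trans (ltn_ord l))// dimsQ'.
  rewrite /weight param_pack; [|by []|by []|exact: leqW].
  rewrite lQ; congr (_ * _).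
  apply: (@eq_act _ _ _ _ _ _ _ L Q) => //.
  - move=> k j l' /andP[k0 kL] jQ ld; have l'Q : (l' <= Q)%N.
      by rewrite ltnW// (leq_trans ld)// dimsQ'// -ltnS prednK.
    by rewrite param_pack ?l'Q ?(ltnW jQ) ?(leqW l'Q).
  - by move=> k j /andP[k0 kL] jQ; rewrite param_pack ?ltnn ?(ltnW jQ).
  - by rewrite ltn_ord.
have {real} /choice[ath athP] := real.
pose sgn s : {ffun FI -> bool} := [ffun u => 0 <= pol (ath s).1 u (ath s).2].
(* [A] below is the true activation pattern of [th]. Equal signs show that [th'] passes the same
   tests along the pass forced by [A], so [A] is its true pattern too and the two outputs are on the
   same side of each threshold. *)
have key a (th th' : V) : (forall u, (0 <= pol a u th) = (0 <= pol a u th')) ->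
    forall i tau, (t tau <= true_out a th i) = (t tau <= true_out a th' i).
  move=> same i tau.
  pose hh := fun th : V => act (dm a) (weight _ _ th) (bias _ _ th) (val (z i)).
  pose A : pat := [ffun kj : 'I_L.+1 * 'I_Q.+1 => 0 <= preact (dm a) (weight _ _ th) (bias _ _ th) (hh th kj.1.-1) kj.1 kj.2].
  have AE k j : (0 < k <= L)%N -> (j < dm a k)%N ->
      AA A k j = (0 <= preact (dm a) (weight _ _ th) (bias _ _ th) (hh th k.-1) k j).
    move=> /andP[k0 kL] jk; have jQ : (j < Q.+1)%N.
      by rewrite ltnW// ltnS (leq_trans jk)// dmQ// -lt0n.
    by rewrite /AA ffunE /= !inordK.
  have F1 k j : (k <= L)%N -> (j < dm a k)%N || (k == 0)%N ->
      forced (dm a) (weight _ _ th) (bias _ _ th) (val (z i)) (AA A) k j = hh th k j.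
    elim: k j => [//|k IH] j kL; rewrite orbF => jk /=; rewrite AE//=.
    have -> : preact (dm a) (weight _ _ th) (bias _ _ th) (forced (dm a) (weight L Q th) (bias L Q th) (z i) (AA A) k) k.+1 j
       = preact (dm a) (weight _ _ th) (bias _ _ th) (hh th k) k.+1 j.
      by apply: eq_preact => l lk; rewrite IH ?lk// ltnW.
    by rewrite /hh /=; case: leP.
  have F2 k j : (k <= L)%N -> (j < dm a k)%N || (k == 0)%N ->
      forced (dm a) (weight _ _ th') (bias _ _ th') (val (z i)) (AA A) k j = hh th' k j.
    move: k j; apply: forced_act => k j /andP[k0 kL] jk.
    have jQ : (j < Q.+1)%N by rewrite ltnW// ltnS (leq_trans jk)// dmQ// -lt0n.
    have := same (i, A, inl (inord k, inord j)); rewrite /= !inordK// => <-.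
    rewrite AE ?k0//; congr (_ <= _); apply/esym; apply: eq_preact => l lk.
    by rewrite F1 ?lk// (leq_trans (leq_pred _)).
  have := same (i, A, inr tau); rewrite /= !subr_ge0.
  rewrite /true_out (@eq_preact _ _ _ _ (hh th L)); last by move=> l lk; rewrite F1 ?lk.
  by rewrite [in X in _ = X -> _](@eq_preact _ _ _ _ (hh th' L)) => // l lk; rewrite F2 ?lk.
have injsgn : {in S &, injective (fun s => ((ath s).1, sgn s))}.
  move=> s s' sS s'S [a_eq sg]; apply/ffunP => i; rewrite (athP s sS) (athP s' s'S) -a_eq.
  apply: key => u; have := congr1 (fun g : {ffun FI -> bool} => g u) sg.
  by rewrite !ffunE -a_eq.
rewrite -(card_in_imset injsgn).
pose Sa (a : arch) : {set {ffun FI -> bool}} :=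
  [set g | [exists s in S, ((ath s).1 == a) && (g == sgn s)]]%SET.
have SaB a : (#|Sa a| <= (2 * (#|FI| * L.+1)).+1 ^ #|pidx L Q|)%N.
  apply: (@card_sign_patterns _ _ FI (pol a) L.+1) => //.
    by rewrite !card_prod !card_ord.
  move=> g; rewrite inE => /existsP[s /andP[sS /andP[/eqP sa /eqP ->]]].
  by exists (ath s).2 => u; rewrite ffunE sa.
have FIE : #|FI| = (N * 2 ^ (L.+1 * Q.+1) * (L.+1 * Q.+1 + T))%N.
  by rewrite !card_prod card_sum card_ffun card_prod !card_ord card_bool.
have pidxE : #|pidx L Q| = (L.+2 * Q.+1 * Q.+2)%N by rewrite !card_prod !card_ord.
have archE : #|{: arch}| = (Q.+1 ^ L.+1)%N by rewrite card_ffun !card_ord.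
rewrite /capacity -FIE -pidxE -archE.
apply: (@leq_trans (\sum_(a : arch) #|Sa a|)%N); last first.
  by rewrite -sum_nat_const; apply: leq_sum => a _; exact: SaB.
apply: (@leq_trans #|[set ag : arch * {ffun FI -> bool} | ag.2 \in Sa ag.1]%SET|).
  apply/subset_leq_card/fintype.subsetP => _ /imsetP[s sS ->]; rewrite !inE /=.
  by apply/existsP; exists s; rewrite sS !eqxx.
rewrite -sum1dep_card (eq_bigr (fun=> 1%N))//.
rewrite (reindex (fun ag : arch * {ffun FI -> bool} => ag))/=; last by exists id.
rewrite -(pair_big_dep xpredT (fun a g => g \in Sa a) (fun _ _ => 1%N))/=.
by apply: leq_sum => a _; rewrite sum1_card.
Qed.

End NetworkPatterns.

(** * Networks as register machines *)

Section Programs.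
Context {R : realType}.
Implicit Types (v : nat -> R) (Phi Psi : (nat -> R) -> nat -> R) (a : (nat -> R) -> R).

Definition layer Q (w : nat -> nat -> R) (b : nat -> R) v : nat -> R :=
  fun j => Num.max (\sum_(l < Q) w j l * v l + b j) 0.

Fixpoint run Q (w : nat -> nat -> nat -> R) (b : nat -> nat -> R) k v : nat -> R :=
  if k is k'.+1 then layer Q (w k) (b k) (run Q w b k' v) else v.

Definition net Q k (F : (nat -> R) -> nat -> R) := exists w b, forall v, F v = run Q w b k v.

Lemma eq_run Q w w' b b' k v :
  (forall i, (0 < i <= k)%N -> w i = w' i /\ b i = b' i) ->
  run Q w b k v = run Q w' b' k v.
Proof.
elim: k => [//|k IH] H /=; rewrite IH.
  by have [|-> ->] := H k.+1; rewrite ?ltnSn.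
by move=> i /andP[i0 ik]; apply: H; rewrite i0 leqW.
Qed.

Lemma run_cat Q w w' b b' k k' v :
  run Q w' b' k' (run Q w b k v) =
  run Q (fun i => if (i <= k)%N then w i else w' (i - k)%N)
        (fun i => if (i <= k)%N then b i else b' (i - k)%N) (k + k') v.
Proof.
elim: k' => [|k' IH]; first by rewrite addn0 /=; apply: eq_run => i /andP[_ ->].
rewrite addnS /= IH; have -> : ((k + k').+1 <= k)%N = false by lia.
by have -> : ((k + k').+1 - k = k'.+1)%N by lia.
Qed.

Lemma net_comp Q k k' F G : net Q k F -> net Q k' G -> net Q (k + k') (G \o F).
Proof.
move=> [w [b Fr]] [w' [b' Gr]]; eexists; eexists => v.
by rewrite /= Fr Gr run_cat.
Qed.

Lemma net_layer Q w b : net Q 1 (layer Q w b).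
Proof. by exists (fun=> w), (fun=> b). Qed.

Definition agree Q v v' := forall j, (j < Q)%N -> v j = v' j.

Lemma run_agree Q w b k v v' : agree Q v v' -> agree Q (run Q w b k v) (run Q w b k v').
Proof.
elim: k => [//|k IH] vv' j jQ /=; rewrite /layer.
by congr (Num.max (_ + _) _); apply: eq_bigr => l _; rewrite IH.
Qed.

Definition nonneg v := forall j, 0 <= v j.

(* [Phi] is the pointwise, eventually exact limit of a sequence of [k]-layer
   ReLU networks of width [Q]. *)
Definition computes Q k Phi :=
  (forall v, nonneg v -> nonneg (Phi v)) /\
  exists2 F : nat -> (nat -> R) -> nat -> R, (forall S, net Q k (F S)) &
    forall v, nonneg v -> exists S0, forall S, (S0 <= S)%N -> agree Q (F S v) (Phi v).

Lemma eq_computes Q k Phi Psi : (forall v, nonneg v -> Phi v = Psi v) ->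
  computes Q k Phi -> computes Q k Psi.
Proof.
move=> PP [nPhi [F Fn FP]]; split=> [v v0|]; first by rewrite -PP//; exact: nPhi.
by exists F => // v v0; rewrite -PP//; exact: FP.
Qed.

(** Eventual exactness is what composes: [Psi] may be discontinuous, so its networks have to be run
    at the very value [Phi v], at least in the [Q] registers that they read. *)
Lemma computes_comp Q k k' Phi Psi : computes Q k Phi -> computes Q k' Psi ->
  computes Q (k + k') (Psi \o Phi).
Proof.
move=> [nPhi [F Fn FP]] [nPsi [G Gn GP]]; split=> [v v0|].
  exact/nPsi/nPhi.
exists (fun S => G S \o F S) => [S|v v0]; first exact: net_comp.
have [S0 S0P] := FP v v0; have [S1 S1P] := GP _ (nPhi v v0).
exists (maxn S0 S1) => S; rewrite geq_max => /andP[S0S S1S] j jQ.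
have [w [b Gr]] := Gn S; rewrite /= -(S1P S S1S j jQ) !Gr.
exact: run_agree (S0P S S0S) j jQ.
Qed.

Definition affine_form Q a := exists (w : nat -> R) c, forall v, a v = \sum_(l < Q) w l * v l + c :> R.

Lemma affine_cst Q c : affine_form Q (fun=> c).
Proof. by exists (fun=> 0), c => v; rewrite big1 ?add0r// => l _; rewrite mul0r. Qed.

Lemma affine_reg Q j : (j < Q)%N -> affine_form Q (fun v => v j).
Proof.
move=> jQ; exists (fun l => (l == j)%:R), 0 => v.
rewrite (bigD1 (Ordinal jQ))//= eqxx mul1r big1 ?addr0// => l lj.
by rewrite (_ : (l == j :> nat) = false) ?mul0r//; apply/negP => /eqP E; case/eqP: lj; apply/val_inj.
Qed.

Lemma affineD Q a a' : affine_form Q a -> affine_form Q a' ->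
  affine_form Q (fun v => a v + a' v).
Proof.
move=> [w [c E]] [w' [c' E']]; exists (fun l => w l + w' l), (c + c') => v.
rewrite E E' addrACA -big_split; congr (_ + _).
by apply: eq_bigr => l _; rewrite mulrDl.
Qed.

Lemma affineZ Q r a : affine_form Q a -> affine_form Q (fun v => r * a v).
Proof.
move=> [w [c E]]; exists (fun l => r * w l), (r * c) => v.
rewrite E mulrDr mulr_sumr; congr (_ + _).
by apply: eq_bigr => l _; rewrite mulrA.
Qed.

Lemma affineN Q a : affine_form Q a -> affine_form Q (fun v => - a v).
Proof.
move=> /(affineZ Q (-1)) [w [c E]]; exists w, c => v.
by rewrite -E mulN1r.
Qed.

Definition upd v j (y : R) : nat -> R := fun i => if i == j then y else v i.
Definition asg j a v := upd v j (Num.max (a v) 0).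
Definition thr j a v := upd v j (if 0 <= a v then 1 else 0).

(** A ReLU leaves nonnegative registers unchanged, so a single layer can overwrite one register and
    copy all the others. *)
Lemma layer_asg Q j a : (j < Q)%N -> affine_form Q a ->
  exists w b, forall v, nonneg v -> agree Q (layer Q w b v) (asg j a v).
Proof.
move=> jQ [w [c E]]; exists (fun i l => if i == j then w l else (l == i)%:R).
exists (fun i => if i == j then c else 0) => v v0 i iQ.
rewrite /layer /asg /upd; case: eqP => // /eqP ij; first by rewrite E.
rewrite addr0 (bigD1 (Ordinal iQ))//= eqxx mul1r big1 ?addr0 => [|l li].
  by rewrite max_l.
by rewrite (_ : (l == i :> nat) = false) ?mul0r//; apply/negP => /eqP F; case/eqP: li; apply/val_inj.
Qed.

Lemma computes_asg Q j a : (j < Q)%N -> affine_form Q a -> computes Q 1 (asg j a).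
Proof.
move=> jQ aff; split=> [v v0 i|].
  by rewrite /asg /upd; case: eqP => // _; rewrite le_max lexx orbT.
have [w [b E]] := layer_asg Q j a jQ aff.
exists (fun=> layer Q w b) => [S|v v0]; first exact: net_layer.
by exists 0%N => S _; exact: E.
Qed.

(** Two layers produce [max (1 - max (- S * a v) 0) 0]. This is 1 when [a v >= 0], and it is exactly
    0 once [S >= 1 / |a v|] when [a v < 0]. The required [S] depends on [v], so the convergence is
    only pointwise. *)
Lemma computes_thr Q j a : (j < Q)%N -> affine_form Q a -> computes Q 2 (thr j a).
Proof.
move=> jQ aff; split=> [v v0 i|].
  by rewrite /thr /upd; case: eqP => // _; case: ifP.
have [w [b E]] := layer_asg Q j (fun v => 1 - v j) jQ
  (affineD _ _ _ (affine_cst _ 1) (affineN _ _ (affine_reg _ _ jQ))).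
have /choice[wb wbE] (S : nat) : exists wb : (nat -> nat -> R) * (nat -> R), forall v,
    nonneg v -> agree Q (layer Q wb.1 wb.2 v) (asg j (fun v => (- S%:R) * a v) v).
  by have [w' [b' E']] := layer_asg Q j _ jQ (affineZ _ (- S%:R) _ aff); exists (w', b').
exists (fun S => layer Q w b \o layer Q (wb S).1 (wb S).2) => [S|v v0].
  by apply: (net_comp Q 1 1); exact: net_layer.
exists (Num.bound (- (a v)^-1)).+1 => S SB i iQ.
have n0 : nonneg (asg j (fun v => (- S%:R) * a v) v).
  by move=> l; rewrite /asg /upd; case: eqP => // _; rewrite le_max lexx orbT.
transitivity (asg j (fun v => 1 - v j) (asg j (fun v => (- S%:R) * a v) v) i).
  rewrite -E//= /layer; congr (Num.max (_ + _) _); apply: eq_bigr => l _.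
  by congr (_ * _); rewrite -[RHS]wbE.
rewrite /asg /thr /upd; case: eqP => // _; rewrite eqxx; have [av|av] := leP 0 (a v).
  rewrite (max_r (_ : - S%:R * a v <= 0)); first by rewrite subr0 max_l.
  by rewrite mulNr oppr_le0 mulr_ge0.
rewrite max_r// lerBlDr add0r le_max; apply/orP; left.
rewrite mulNr -mulrN -ler_pdivrMr ?oppr_gt0// mul1r invrN.
apply: (@le_trans _ _ (Num.bound (- (a v)^-1))%:R); last by rewrite ler_nat ltnW.
by rewrite ltW// archi_boundP// oppr_ge0 invr_le0 ltW.
Qed.

Lemma computes_id Q k : (0 < Q)%N -> computes Q k id.
Proof.
move=> Q0; elim: k => [|k IH].
  split=> //; exists (fun _ => id) => [S|v _]; last by exists 0%N.
  by exists (fun _ _ _ => 0), (fun _ _ => 0).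
have := computes_comp _ _ _ _ _ (computes_asg Q 0 _ Q0 (affine_reg _ _ Q0)) IH.
apply: eq_computes => v v0; apply/funext => i /=; rewrite /asg /upd.
by case: eqP => // ->; rewrite max_l.
Qed.

Lemma computes_leq Q k k' Phi : (0 < Q)%N -> (k <= k')%N -> computes Q k Phi -> computes Q k' Phi.
Proof.
move=> Q0 kk' cP; rewrite -(subnKC kk').
exact: (computes_comp _ _ _ _ _ cP (computes_id _ _ Q0)).
Qed.

Lemma computes_iteri Q k n (Phi : nat -> (nat -> R) -> nat -> R) :
  (0 < Q)%N -> (forall i, (i < n)%N -> computes Q k (Phi i)) ->
  computes Q (n * k) (iteri n Phi).
Proof.
move=> Q0; elim: n => [_|n IH cP]; first exact: computes_id.
rewrite mulSn addnC; apply: (computes_comp _ _ _ _ _ (IH _) (cP _ _)) => // i /ltnW.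
exact: cP.
Qed.

Section Realization.
Variables (d Q : nat) (ro rc : nat) (A : nat -> R) (C : nat -> R) (H : R).
Hypotheses (dQ : (d <= Q)%N) (H0 : 0 <= H) (roQ : (ro < Q)%N) (rcQ : (rc < Q)%N) (roc : ro != rc).

(* The initial affine layer loads the affinely transformed inputs into registers [base + i]. *)
Definition load base (x : seq R) : nat -> R := fun j =>
  if (base <= j < base + d)%N then Num.max (A (j - base) * nth 0 x (j - base) + C (j - base)) 0 else 0.

(** The two additional layers are the loading of the inputs and the computation of
    [max (v ro - H) 0] in register [rc]; the final affine map subtracts it, which clips at [H]. The
    lower bound 0 is automatic after a ReLU. *)
Lemma F_NN_computes base k Phi : (base + d <= Q)%N -> computes Q k Phi ->
  exists2 f : nat -> d.-tuple R -> R, (forall S, @F_NN R d k.+2 Q 0 H (f S)) &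
    forall x, exists S0, forall S, (S0 <= S)%N ->
      f S x = Num.min (Phi (load base x) ro) H.
Proof.
move=> bdQ [nPhi [F Fn FP]].
pose w0 j l : R := if (base <= j < base + d)%N && (l == j - base)%N then A (j - base) else 0.
pose b0 j : R := if (base <= j < base + d)%N then C (j - base) else 0.
have loadE x : size x = d -> layer Q w0 b0 (nth 0 x) = load base x.
  move=> sx; apply/funext => j; rewrite /layer /load /w0 /b0.
  case: ifPn => /= [/andP[bj jb]|_]; last by rewrite big1 ?addr0 ?maxxx// => l _; rewrite mul0r.
  have jbQ : (j - base < Q)%N by apply: leq_trans dQ; rewrite ltn_subLR.
  rewrite (bigD1 (Ordinal jbQ))//= eqxx big1 ?addr0// => l lj.
  by rewrite (_ : (l == j - base :> nat)%N = false) ?mul0r//; apply/negP => /eqP E; case/eqP: lj; apply/val_inj.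
have [wc [bc cE]] := layer_asg Q rc (fun v => v ro - H) rcQ
  (affineD _ _ _ (affine_reg _ _ roQ) (affine_cst _ (- H))).
have netS S : net Q k.+2 (layer Q wc bc \o (F S \o layer Q w0 b0)).
  rewrite -[k.+2]addn1 -[k.+1]add1n; apply: net_comp; last exact: net_layer.
  by apply: net_comp; [exact: net_layer|exact: Fn].
pose f S (x : d.-tuple R) := let u := (layer Q wc bc \o (F S \o layer Q w0 b0)) (nth 0 (val x)) in u ro - u rc.
have clampE y : y - Num.max (y - H) 0 = Num.min y H.
  by have [yH|yH] := leP y H; [rewrite max_r|rewrite max_l]; lra.
have Fge0 S x : nonneg (F S (load base x)).
  have [w [b Fr]] := Fn S; rewrite Fr; case: k {Fn FP Fr netS f nPhi F} => [|k] j /=.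
    by rewrite /load; case: ifP => // _; rewrite le_max lexx orbT.
  by rewrite /layer le_max lexx orbT.
have fE S x : f S x = Num.min (F S (load base x) ro) H.
  rewrite /f /= loadE ?size_tuple// !cE// /asg /upd eqxx (negPf roc).
  exact: clampE.
exists f => [S|x].
  pose dims i := if (i == 0)%N then d else Q.
  have [w [b wbE]] := netS S.
  pose w' i j l := if (i == k.+3)%N then (if l == ro then 1 else if l == rc then -1 else 0) else w i j l.
  pose b' i j := if (i == k.+3)%N then 0 else b i j.
  exists dims, w', b'; split=> //; split; last split.
  - rewrite big_nat (eq_bigr (fun=> Q)) => [|i /andP[i0 _]]; last by rewrite /dims gtn_eqF.
    by rewrite -big_nat big_const_nat subSS subn0 iterS (maxn_idPl _)//; elim: k.+1 => [|m IH] //=; rewrite geq_max leqnn.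
  - move=> x; rewrite nn_evalE /f; cbv zeta; rewrite wbE.
    have runE i : (i <= k.+2)%N -> run Q w b i (nth 0 x) = act dims w' b' x i.
      elim: i => [//|i IH] ik; apply/funext => j /=; rewrite IH ?(ltnW ik)//.
      rewrite /layer /preact /=; congr (Num.max (_ + _) _).
        rewrite /dims; case: i ik {IH} => [ik|i ik] /=.
          (* The first layer has only [d] inputs; the further columns of the uniform layer read the
             default value 0 beyond the end of the input. *)
          rewrite [RHS](big_ord_widen Q (fun l => w' 1%N j l * nth 0 x l))// [RHS]big_mkcond.
          apply: eq_bigr => l _; rewrite /w' /=; case: ifPn => //; rewrite -leqNgt => dl.
          by rewrite nth_default ?mulr0// size_tuple.
        by apply: eq_bigr => l _; rewrite /w' ltn_eqF.
      by rewrite /b' ltn_eqF.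
    rewrite runE//; set u := act _ _ _ _ k.+2.
    rewrite /preact /b' /w' !eqxx -[dims _]/Q addr0 (bigD1 (Ordinal roQ))//= eqxx mul1r; congr (_ + _).
    have rcr : rc == ro = false by apply/negbTE; rewrite eq_sym.
    rewrite (bigD1 (Ordinal rcQ))/=; last by apply/negP => /eqP[] /eqP; rewrite rcr.
    rewrite rcr eqxx mulN1r big1 ?addr0// => l /andP[l1 l2].
    have h r (rQ : (r < Q)%N) : l != Ordinal rQ -> (l == r :> nat) = false.
      by move=> lr; apply/negP => /eqP E; case/eqP: lr; apply/val_inj.
    by rewrite (h _ roQ)// (h _ rcQ)// mul0r.
  - by move=> x; rewrite fE le_min Fge0 H0 /= ge_min lexx orbT.
have n0 : nonneg (load base x).
  by move=> j; rewrite /load; case: ifP => // _; rewrite le_max lexx orbT.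
have [S0 S0P] := FP _ n0; exists S0 => S SS; rewrite fE.
by rewrite S0P.
Qed.
End Realization.
End Programs.

(** * Binary digits of numbers in the closed unit interval *)

Section Digits.
Context {R : realType}.
Implicit Types y : R.

(** At [y = 1] every digit is 1 and the remainder stays 1, so the right end of the interval is
    treated like the other points. *)
Definition bitr y : R := if 1 / 2 <= y then 1 else 0.
Definition bfrac y : R := 2 * y - bitr y.

Lemma bfrac_itv y : 0 <= y <= 1 -> 0 <= bfrac y <= 1.
Proof. by rewrite /bfrac /bitr => y01; have [h|h] := leP (1 / 2) y; lra. Qed.

Lemma iter_bfrac_itv n y : 0 <= y <= 1 -> 0 <= iter n bfrac y <= 1.
Proof. by move=> y01; elim: n => //= n; exact: bfrac_itv. Qed.

Fixpoint dnum y n : nat := if n is n'.+1 then (2 * dnum y n' + (1 / 2 <= iter n' bfrac y)%R)%N else 0.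

Lemma bitrE y : bitr y = (1 / 2 <= y)%R%:R.
Proof. by rewrite /bitr; case: ifP. Qed.

Lemma dnum_frac y n : y * 2 ^+ n = (dnum y n)%:R + iter n bfrac y.
Proof.
elim: n => [|n IH]; first by rewrite mulr1 add0r.
by rewrite exprS mulrCA IH /= natrD natrM /bfrac bitrE; lra.
Qed.

Lemma dnum_lt y n : (dnum y n < 2 ^ n)%N.
Proof. by elim: n => //= n IH; rewrite expnS; case: (_ <= _)%R => /=; lia. Qed.

Lemma dnum_add y n n' : dnum y (n + n') = (dnum y n * 2 ^ n' + dnum (iter n bfrac y) n')%N.
Proof.
elim: n' => [|n' IH]; first by rewrite addn0 muln1 addn0.
rewrite addnS /= IH expnS -iterD [(n' + n)%N]addnC; lia.
Qed.

Fixpoint binval (beta : nat -> bool) n : R :=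
  if n is n'.+1 then ((beta 0%N)%:R + binval (beta \o S) n') / 2 else 0.

Lemma binval_itv beta n : 0 <= binval beta n < 1.
Proof. by elim: n beta => [|n IH] beta /=; [lra|have := IH (beta \o S); case: (beta 0%N) => /=; lra]. Qed.

Lemma bitr_binval beta n : bitr (binval beta n.+1) = (beta 0%N)%:R.
Proof.
rewrite /bitr /=; have := binval_itv (beta \o S) n; set x := binval _ _ => x01.
by case: (beta 0%N) => /=; case: (leP (1 / 2)) => // ?; lra.
Qed.

Lemma bfrac_binval beta n : bfrac (binval beta n.+1) = binval (beta \o S) n.
Proof. by rewrite /bfrac bitr_binval /=; lra. Qed.

Lemma binvalE beta n : binval beta n = \sum_(l < n) (beta l)%:R / 2 ^+ l.+1.
Proof.
elim: n beta => [|n IH] beta /=; first by rewrite big_ord0.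
rewrite IH big_ord_recl expr1 mulrDl; congr (_ + _); rewrite mulr_suml.
by apply: eq_bigr => l _; rewrite [in RHS]exprSr invfM mulrA.
Qed.

Lemma binary_expansion y J : 0 <= y <= 1 ->
  0 <= y - binval (fun l => 1 / 2 <= iter l bfrac y) J <= (2 ^+ J)^-1.
Proof.
elim: J y => [|J IH] y y01 /=; first by rewrite expr0 invr1; lra.
have := IH _ (bfrac_itv _ y01); set b := binval _ J.
rewrite (_ : binval _ J = b); last by congr binval; apply/funext => l /=; rewrite -iterS iterSr.
by rewrite /bfrac bitrE exprS invfM; lra.
Qed.

End Digits.

(** * Subroutines of the register machine *)

Section Procedures.
Context {R : realType}.
Implicit Types (v : nat -> R).

(* Registers 0 and 1 hold the indices of the coarse and the fine cell of the input, 2 the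
   fetched word, 3-6, 8, 9 are scratch, 7 is the value under construction, 10 and 11
   sum the positive and the negative terms; the inputs start at register 12. *)
Definition inp j := j.+4.+4.+4.

Definition pop r v : nat -> R :=
  asg r (fun u => 2 * u r - u 3%N) (thr 3 (fun u => u r - 1 / 2) v).

Lemma popE r v : r != 3%N -> 0 <= v r <= 1 ->
  pop r v = upd (upd v 3 (bitr (v r))) r (bfrac (v r)).
Proof.
move=> r3 vr; rewrite /pop /asg /thr /upd (negPf r3) eqxx subr_ge0 -/(bitr (v r)) -/(bfrac (v r)).
by rewrite max_l//; have /andP[] := bfrac_itv _ vr.
Qed.

Definition read_digits n r k : (nat -> R) -> nat -> R :=
  iteri n (fun _ v => asg k (fun u => 2 * u k + u 3%N) (pop r v)).

Lemma read_digitsE n r k v : r != 3%N -> k != 3%N -> r != k ->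
  0 <= v r <= 1 -> 0 <= v k ->
  let v' := read_digits n r k v in
  [/\ v' r = iter n bfrac (v r), v' k = 2 ^+ n * v k + (dnum (v r) n)%:R &
   forall i, i \notin [:: r; k; 3] -> v' i = v i].
Proof.
move=> r3 k3 rk vr vk; elim: n => [|n [IHr IHk IHi]] /=.
  by split=> //; rewrite mul1r addr0.
rewrite /read_digits /= -/(read_digits n r k v).
have kr : k == r = false by apply/negbTE; rewrite eq_sym.
have k3' : (3 == k)%N = false by apply/negbTE; rewrite eq_sym.
have r3' : (3 == r)%N = false by apply/negbTE; rewrite eq_sym.
rewrite popE// IHr ?iter_bfrac_itv// /asg /upd !eqxx (negPf rk) (negPf k3) kr r3' IHk; split=> //.
  rewrite max_l; first by rewrite natrD natrM bitrE exprS; lra.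
  by rewrite bitrE addr_ge0 ?mulr_ge0 ?addr_ge0 ?mulr_ge0 ?exprn_ge0.
move=> i ir; move: (ir); rewrite !inE !negb_or => /and3P[/negPf -> /negPf -> /negPf ->].
exact: IHi.
Qed.

(** Positional notation in base [2 ^ n], with [f 0] the most significant digit. *)
Fixpoint concat_digits (f : nat -> nat) n k : nat :=
  if k is k'.+1 then (concat_digits f n k' * 2 ^ n + f k')%N else 0.

Lemma concat_digits_lt f n k : (forall j, f j < 2 ^ n)%N -> (concat_digits f n k < 2 ^ (n * k))%N.
Proof.
move=> fn; elim: k => [|k IH] /=; first by rewrite muln0.
rewrite mulnS expnD; have := fn k; nia.
Qed.

Definition digit_of n k x j : nat := ((x %/ 2 ^ (n * (k - j.+1))) %% 2 ^ n)%N.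

Lemma digit_of_concat f n k j : (forall j, f j < 2 ^ n)%N -> (j < k)%N ->
  digit_of n k (concat_digits f n k) j = f j.
Proof.
move=> fn; rewrite /digit_of; elim: k => // k IH; rewrite ltnS leq_eqVlt => /orP[/eqP ->|jk].
  by rewrite subnn muln0 divn1 /= modnMDl modn_small.
rewrite subSS -(subnSK jk) mulnS expnD divnMA /= divnMDl ?expn_gt0//.
by rewrite [(f k %/ _)%N]divn_small// addn0 IH.
Qed.

(** The first [n] bits of each input form the coarse index, the next [n] the fine index. What
    remains in the input register is the relative position within the fine cell, ready for the
    Taylor polynomial. *)
Definition read_cell n d v : nat -> R :=
  iteri d (fun j u => read_digits n (inp j) 1%N (read_digits n (inp j) 0%N u)) v.

Lemma read_cellE n d v : (forall j, (j < d)%N -> 0 <= v (inp j) <= 1) ->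
  v 0%N = 0 -> v 1%N = 0 ->
  let v' := read_cell n d v in
  [/\ v' 0%N = (concat_digits (fun j => dnum (v (inp j)) n) n d)%:R,
      v' 1%N = (concat_digits (fun j => dnum (iter n bfrac (v (inp j))) n) n d)%:R,
      forall j, (j < d)%N -> v' (inp j) = iter (n + n) bfrac (v (inp j)) &
      forall i, i \notin [:: 0; 1; 3]%N -> (forall j, (j < d)%N -> i != inp j) -> v' i = v i].
Proof.
move=> v01 v0 v1; elim: d v01 => [|d IH] v01 /=; first by [].
have {IH}[|IH0 IH1 IHi IHo] := IH; first by move=> j /ltnW; exact: v01.
rewrite /read_cell /= -/(read_cell n d v); set u := read_cell n d v in IH0 IH1 IHi IHo *.
have ud : u (inp d) = v (inp d).
  by apply: IHo => // j jd; rewrite /inp !eqSS gtn_eqF.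
have [||||| a1 a2 a3] := @read_digitsE n (inp d) 0%N u; rewrite ?ud ?IH0 ?v01//.
set u1 := read_digits n (inp d) 0%N u in a1 a2 a3 *.
have u11 : u1 1%N = u 1%N by apply: a3.
have [||||| b1 b2 b3] := @read_digitsE n (inp d) 1%N u1; rewrite ?a1 ?u11 ?IH1 ?ud ?iter_bfrac_itv ?v01//.
set u2 := read_digits n (inp d) 1%N u1 in b1 b2 b3 *.
split.
- by rewrite b3// a2 ud IH0 natrD natrM natrX mulrC.
- by rewrite b2 u11 IH1 a1 ud natrD natrM natrX mulrC.
- move=> j; rewrite ltnS leq_eqVlt => /orP[/eqP ->|jd].
    by rewrite b1 a1 ud iterD.
  have jdn : j == d = false by rewrite ltn_eqF.
  by rewrite b3 ?a3 ?IHi// !inE /= !eqSS jdn.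
- move=> i; rewrite !inE !negb_or => /and3P[i0 i1 i3] ij.
  have id : i != inp d by exact: ij.
  rewrite b3 ?a3 ?IHo// ?inE ?negb_or ?i0 ?i1 ?i3 ?id//.
  by move=> j jd; apply: ij; rewrite ltnW.
Qed.

(** Table lookup by telescoping: the increment from [tab i'] to [tab i] is added exactly when [i] is
    at most the index in register 0. The partial sums are themselves table entries, so for a
    nonnegative table the truncation at 0 has no effect. *)
Definition fetch P (tab : nat -> R) v : nat -> R :=
  iteri P (fun i u => asg 2 (fun u => u 2%N + (tab i - (if i is i'.+1 then tab i' else 0)) * u 4%N)
     (thr 4 (fun u => u 0%N - i%:R) u)) (asg 2 (fun=> 0) v).

Lemma fetchE P tab v X : (forall i, 0 <= tab i) -> v 0%N = X%:R -> (X < P)%N ->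
  fetch P tab v 2%N = tab X /\ forall i, i \notin [:: 2; 4]%N -> fetch P tab v i = v i.
Proof.
move=> tab0 vX XP; rewrite /fetch; set w := asg 2 _ v.
have wi i : i != 2%N -> w i = v i by rewrite /w /asg /upd => /negPf ->.
set body := fun i => _; suff : forall n, iteri n body w 2%N =
    (if n is n'.+1 then tab (minn n' X) else 0) /\
    forall i, i \notin [:: 2; 4]%N -> iteri n body w i = v i.
  by move=> /(_ P)[-> _b]; split=> //; case: (P) XP => // P0; rewrite ltnS => /minn_idPr ->.
elim=> [|n [IH2 IHi]].
  by split=> [|i]; [rewrite /= /w /asg /upd /= maxxx|rewrite !inE negb_or => /andP[i2 _]; exact: wi].
rewrite iteriS /body /=; set u := iteri n body w in IH2 IHi *.
split; last first.
  move=> i i24; rewrite /asg /thr /upd; move: (i24); rewrite !inE negb_or => /andP[/negPf -> /negPf ->].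
  exact: IHi.
rewrite /asg /thr /upd /= IH2 IHi// vX subr_ge0 ler_nat.
case: n {IH2 IHi u} => [|n]; first by rewrite leq0n min0n mulr1 subr0 add0r max_l.
have [nX|nX] := leqP n.+1 X.
  by rewrite mulr1 (minn_idPl (ltnW nX)) addrC subrK max_l.
by rewrite mulr0 addr0 (minn_idPr (nX : (X <= n)%N)) max_l.
Qed.

(** The word in register 2 is read completely, digit after digit, but only block number [u 1] is
    kept. The two thresholds differ exactly when the current block [t %/ J] is that one, and a sum
    of two bits minus 1, truncated at 0, is their conjunction. *)
Definition select P J v : nat -> R :=
  iteri (P * J) (fun t u =>
     asg 7 (fun u => u 7%N + (2 ^+ (t %% J).+1)^-1 * u 6%N)
    (asg 6 (fun u => u 3%N + u 4%N + (- u 5%N) + (- 1))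
    (thr 5 (fun u => u 1%N - (t %/ J).+1%:R)
    (thr 4 (fun u => u 1%N - (t %/ J)%:R) (pop 2 u))))) (asg 7 (fun=> 0) v).

Lemma selectE P J v X (beta : nat -> bool) : v 1%N = X%:R -> (X < P)%N ->
  v 2%N = binval beta (P * J) ->
  select P J v 7%N = binval (fun l => beta (X * J + l)%N) J /\
  forall i, i \notin [:: 2; 3; 4; 5; 6; 7]%N -> select P J v i = v i.
Proof.
move=> vX XP v2.
have sumE : \sum_(t < P * J | (t %/ J == X)%N) (beta t)%:R / 2 ^+ (t %% J).+1 =
    \sum_(l < J) (beta (X * J + l)%N)%:R / 2 ^+ l.+1 :> R.
  case: J {v2} => [|J]; first by rewrite muln0 !big_ord0.
  have inj0 (l : 'I_J.+1) : (X * J.+1 + l < P * J.+1)%N.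
    by have := ltn_ord l; nia.
  rewrite (reindex_onto (fun l : 'I_J.+1 => Ordinal (inj0 l))
    (fun t : 'I_(P * J.+1) => inord (t %% J.+1)))/=; last first.
    move=> t /eqP tX; apply/val_inj => /=; rewrite inordK ?ltn_mod// -tX.
    by rewrite -divn_eq.
  apply: eq_big => [l|l _].
    by rewrite divnMDl// divn_small// addn0 eqxx modnMDl modn_small// inord_val eqxx.
  by rewrite modnMDl modn_small.
rewrite /select; set w := asg 7 _ v.
have wi i : i != 7%N -> w i = v i by rewrite /w /asg /upd => /negPf ->.
set body := fun t => _; suff : forall n, (n <= P * J)%N ->
    [/\ iteri n body w 7%N = \sum_(t < n | (t %/ J == X)%N) (beta t)%:R / 2 ^+ (t %% J).+1,
        iteri n body w 2%N = binval (fun t => beta (n + t)%N) (P * J - n) &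
    forall i, i \notin [:: 2; 3; 4; 5; 6; 7]%N -> iteri n body w i = v i].
  by move=> /(_ _ (leqnn _)) [-> _ Hi]; split=> //; rewrite binvalE.
elim=> [_|n IH nPJ].
  split=> [||i]; first by rewrite big_ord0 /= /w /asg /upd /= maxxx.
    by rewrite /= wi// v2 subn0.
  rewrite !inE !negb_or => /and5P[_ _ _ _ /andP[_ i7]]; exact: wi.
have {IH}[IH7 IH2 IHi] := IH (ltnW nPJ).
rewrite iteriS /body -/body; set u := iteri n body w in IH7 IH2 IHi *.
have u2 : 0 <= u 2%N <= 1 by rewrite IH2; have := @binval_itv R (fun t => beta (n + t)%N) (P * J - n); lra.
have PJn : (P * J - n = (P * J - n.+1).+1)%N by rewrite subnSK.
have u7 : 0 <= u 7%N.
  by rewrite IH7; apply: sumr_ge0 => t _; rewrite divr_ge0// exprn_ge0.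
rewrite popE//; split; last first.
- move=> i i24; rewrite /asg /thr /upd.
  move: (i24); rewrite !inE !negb_or => /and5P[/negPf -> /negPf -> /negPf -> /negPf -> /andP[/negPf -> /negPf ->]].
  exact: IHi.
- rewrite /asg /thr /upd /= IH2 PJn bfrac_binval; congr (binval _ _); apply/funext => t /=.
  by rewrite addSnnS.
rewrite /asg /thr /upd /= IH2 PJn bitr_binval (IHi 1%N)// vX !subr_ge0 !ler_nat addn0.
rewrite big_mkcond big_ord_recr -big_mkcond /= -IH7.
set c := _^-1; have c0 : 0 <= c by rewrite invr_ge0 exprn_ge0.
rewrite (_ : Num.max (_ + _ - _ - 1) 0 = if (n %/ J == X)%N then (beta n)%:R else 0).
  rewrite max_l; last by case: ifP => _; rewrite ?mulr0 ?addr0// addr_ge0// mulr_ge0.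
  by case: ifP => _; rewrite ?mulr0// [_ / _]mulrC.
case: eqP => [->|/eqP nX]; first by rewrite leqnn ltnn subr0 max_l; case: (beta n) => /=; lra.
move: nX; rewrite neq_ltn => /orP[nX|nX].
  by rewrite ltnW// nX max_r//; case: (beta n) => /=; lra.
by rewrite leqNgt nX ltnNge ltnW//= max_r//; case: (beta n) => /=; lra.
Qed.

(** Multiplication by the binary digits of register [r]: for [x] in [0,1] and a bit [b], the product
    is [max (x + b - 1) 0]. Register 8 is a working copy, since the input is read again by later
    terms. *)
Definition mul_step J r v : nat -> R :=
  asg 7 (fun u => u 9%N) (iteri J (fun l u =>
     asg 9 (fun u => u 9%N + (2 ^+ l.+1)^-1 * u 6%N)
    (asg 6 (fun u => u 7%N + u 3%N + (- 1)) (pop 8 u)))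
   (asg 9 (fun=> 0) (asg 8 (fun u => u r) v))).

Lemma mul_stepE J j v : 0 <= v 7%N <= 1 -> 0 <= v (inp j) <= 1 ->
  let v' := mul_step J (inp j) v in
  [/\ 0 <= v' 7%N <= 1, `|v' 7%N - v 7%N * v (inp j)| <= (2 ^+ J)^-1 &
   forall i, i \notin [:: 3; 6; 7; 8; 9]%N -> v' i = v i].
Proof.
move=> v7 vj; rewrite /mul_step; set w := asg 9 _ _; set body := (X in iteri J X w).
have w8 : w 8 = v (inp j) by rewrite /w /asg /upd /= max_l//; case/andP: vj.
have w7 : w 7 = v 7%N by [].
have w9 : w 9 = 0 by rewrite /w /asg /upd /= maxxx.
have : [/\ iteri J body w 7%N = v 7%N, iteri J body w 8%N = iter J bfrac (v (inp j)),
    iteri J body w 9%N = v 7%N * (v (inp j) - iter J bfrac (v (inp j)) / 2 ^+ J) &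
    forall i, i \notin [:: 3; 6; 7; 8; 9]%N -> iteri J body w i = v i].
  elim: J => [|J [I7 I8 I9 Ii]].
    split=> //; first by rewrite /= w9 expr0 divr1 subrr mulr0.
    move=> i; rewrite !inE !negb_or => /and5P[_ _ _ i8 i9].
    by rewrite /= /w /asg /upd (negPf i8) (negPf i9).
  rewrite iteriS; set u := iteri J body w in I7 I8 I9 Ii *; rewrite /body -/body.
  rewrite popE ?I8 ?iter_bfrac_itv//; split.
  - by rewrite /asg /upd /= I7.
  - by rewrite /asg /upd.
  - rewrite /asg /upd /= I7 I9.
    have f01 := iter_bfrac_itv J _ vj; set f := iter J bfrac _ in f01 *.
    have J0 : 0 < (2 ^+ J)^-1 :> R by rewrite invr_gt0 exprn_gt0.
    have fJ : f / 2 ^+ J <= v (inp j).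
      have := dnum_frac (v (inp j)) J; rewrite -/f => E.
      by rewrite ler_pdivrMr ?exprn_gt0// E lerDr.
    rewrite (_ : Num.max (v 7%N + bitr f - 1) 0 = v 7%N * bitr f); last first.
      by rewrite /bitr; case: ifP => _; [rewrite max_l|rewrite max_r]; lra.
    rewrite exprS invfM {1}max_l.
      by rewrite /bfrac; lra.
    have b0 : 0 <= bitr f by rewrite bitrE.
    case/andP: v7 => v7 _; apply: addr_ge0; apply: mulr_ge0 => //; rewrite ?subr_ge0//.
      by rewrite mulr_ge0// ltW.
  - move=> i i24; rewrite /asg /upd.
    move: (i24); rewrite !inE !negb_or => /and5P[/negPf -> /negPf -> _ /negPf -> /negPf ->].
    exact: Ii.
move=> [I7 I8 I9 Ii]; have f01 := iter_bfrac_itv J _ vj.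
set f := iter J bfrac _ in f01 I8 I9.
have J0 : 0 < (2 ^+ J)^-1 :> R by rewrite invr_gt0 exprn_gt0.
have fJ : f / 2 ^+ J <= v (inp j).
  have := dnum_frac (v (inp j)) J; rewrite -/f => E.
  by rewrite ler_pdivrMr ?exprn_gt0// E lerDr.
have fJ0 : 0 <= f / 2 ^+ J by case/andP: f01 => f0 _; exact: (mulr_ge0 f0 (ltW J0)).
have fJ1 : f / 2 ^+ J <= (2 ^+ J)^-1.
  by case/andP: f01 => _ f1; apply: ler_piMl => //; exact: ltW.
case/andP: v7 => v70 v71.
have a0 : 0 <= v 7%N * (v (inp j) - f / 2 ^+ J) by rewrite mulr_ge0 ?subr_ge0.
split.
- rewrite /asg /upd /= I9 max_l// a0 mulr_ile1 ?subr_ge0//; lra.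
- rewrite /asg /upd /= I9 max_l//.
  rewrite (_ : _ - _ = - (v 7%N * (f / 2 ^+ J))); last by ring.
  rewrite normrN ger0_norm; last exact: mulr_ge0.
  by apply: le_trans fJ1; exact: ler_piMl.
- move=> i i24; rewrite /asg /upd; have := Ii i i24.
  by move: (i24); rewrite !inE !negb_or => /and5P[_ _ /negPf -> _ _].
Qed.

End Procedures.

Ltac affine := repeat first [apply: affine_cst | apply: affine_reg | apply: affineN
  | apply: affineZ | apply: affineD].

(** * The program that evaluates piecewise polynomials *)

Section Approximant.
Context {R : realType}.
Implicit Types (v : nat -> R).

Lemma eq_sum_In (T : Type) (s : seq T) (F G : T -> R) :
  (forall t, List.In t s -> F t = G t) -> \sum_(t <- s) F t = \sum_(t <- s) G t.
Proof.
elim: s => [|t s IH] FG; first by rewrite !big_nil.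
rewrite !big_cons FG; last by left.
by rewrite IH// => u us; apply: FG; right.
Qed.

Lemma prod_unit_itv (es : seq nat) (F : nat -> R) :
  (forall e, e \in es -> 0 <= F e <= 1) -> 0 <= \prod_(e <- es) F e <= 1.
Proof.
elim: es => [|e es IH] Fe; first by rewrite big_nil; lra.
have /andP[a b] := Fe e (mem_head _ _).
have /andP[a' b'] : 0 <= \prod_(e <- es) F e <= 1.
  by apply: IH => j jes; apply: Fe; rewrite inE jes orbT.
by rewrite big_cons mulr_ge0//= mulr_ile1.
Qed.

(** All factors lie in [0,1], so an earlier error is not amplified by later multiplications and the
    errors simply add up. *)
Lemma mul_step_foldlE J (es : seq nat) v : 0 <= v 7%N <= 1 ->
  (forall e, e \in es -> 0 <= v (inp e) <= 1) ->
  let v' := foldl (fun u e => mul_step J (inp e) u) v es in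
  [/\ 0 <= v' 7%N <= 1,
      `|v' 7%N - v 7%N * \prod_(e <- es) v (inp e)| <= (size es)%:R * (2 ^+ J)^-1 &
      forall i, i \notin [:: 3; 6; 7; 8; 9]%N -> v' i = v i].
Proof.
elim: es v => [|e es IH] v v7 ve /=.
  by rewrite big_nil mulr1 subrr normr0 mul0r.
have [||m7 mE mi] := @mul_stepE R J e v => //; first by apply: ve; rewrite mem_head.
set u := mul_step J (inp e) v in m7 mE mi *.
have ui j : u (inp j) = v (inp j) by apply: mi.
have [|r7 rE ri] := IH u m7.
  by move=> j jes; rewrite ui; apply: ve; rewrite inE jes orbT.
split=> // [|i i3]; last by rewrite ri ?mi.
rewrite big_cons; rewrite (eq_bigr (fun j => v (inp j))) in rE => [|j _]; last exact: ui.
set p := \prod_(_ <- _) _ in rE *.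
have p01 : 0 <= p <= 1.
  by apply: prod_unit_itv => j jes; apply: ve; rewrite inE jes orbT.
rewrite /= -[(size es).+1]addn1 natrD mulrDl mul1r.
rewrite (_ : _ - _ = (foldl (fun u0 e0 => mul_step J (inp e0) u0) u es 7%N - u 7%N * p) +
   (u 7%N - v 7%N * v (inp e)) * p); last by ring.
rewrite (le_trans (ler_normD _ _))// lerD// normrM.
rewrite (@le_trans _ _ (`|u 7%N - v 7%N * v (inp e)| * 1))//; last by rewrite mulr1.
by rewrite ler_wpM2l// ger0_norm; lra.
Qed.

(** A monomial whose coefficient [wt * tab k] depends on the cell [k]. The tables take values in
    [0,1], so that they can be stored as binary digits, while sign and size go into [wt]. [exps]
    lists coordinates with repetition. *)
Record term := Term { wt : R; tab : (nat -> nat) -> R; exps : seq nat }.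

Section Program.
Variables (d n J : nat).
Let P := (2 ^ (n * d))%N.

(** The coordinates of the lower corner of a cell in units of the fine mesh [2 ^ - (n + n)]: coarse
    digits followed by fine digits. *)
Definition corner (i1 i2 j : nat) : nat :=
  if (j < d)%N then (digit_of n d i1 j * 2 ^ n + digit_of n d i2 j)%N else 0.

(* The [J]-bit values of a term at all the [P] fine cells of the coarse cell [i1], packed into
   one weight: this is what makes depth [P] suffice for [P ^ 2] cells. *)
Definition word (tau : term) (i1 : nat) : R :=
  binval (fun t => 1 / 2 <= iter (t %% J) bfrac (tab tau (corner i1 (t %/ J)))) (P * J).

Definition add_term (tau : term) v : nat -> R :=
  asg 11 (fun u => u 11%N + Num.max (- wt tau) 0 * u 7%N)
  (asg 10 (fun u => u 10%N + Num.max (wt tau) 0 * u 7%N)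
  (foldl (fun u e => mul_step J (inp e) u) (select P J (fetch P (word tau) v)) (exps tau))).

(** One error [2 ^ - J] comes from storing only [J] digits of the table value, and one from each
    multiplication. *)
Lemma add_termE tau v X1 X2 : (0 < J)%N -> v 0%N = X1%:R -> v 1%N = X2%:R ->
  (X1 < P)%N -> (X2 < P)%N -> (forall k, 0 <= tab tau k <= 1) ->
  (forall e, e \in exps tau -> 0 <= v (inp e) <= 1) ->
  0 <= v 10%N -> 0 <= v 11%N ->
  let v' := add_term tau v in
  [/\ 0 <= v' 10%N, 0 <= v' 11%N,
      `|(v' 10%N - v' 11%N) - ((v 10%N - v 11%N) +
         wt tau * (tab tau (corner X1 X2) * \prod_(e <- exps tau) v (inp e)))|
        <= `|wt tau| * ((1 + size (exps tau))%:R * (2 ^+ J)^-1) &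
      forall i, (i < 2)%N || (11 < i)%N -> v' i = v i].
Proof.
move=> J0 v0 v1 X1P X2P tab01 ve v10 v11.
have [|//|//|f2 fi] := @fetchE R P (word tau) v X1.
  by move=> i; case/andP: (@binval_itv R (fun t => 1 / 2 <= iter (t %% J) bfrac (tab tau (corner i (t %/ J)))) (P * J)).
set u := fetch P (word tau) v in f2 fi *.
have u1 : u 1%N = X2%:R by rewrite fi.
have [s7 si] := @selectE R P J u X2 _ u1 X2P f2.
set u' := select P J u in s7 si *.
have u'7 : u' 7%N = binval (fun l => 1 / 2 <= iter l bfrac (tab tau (corner X1 X2))) J.
  rewrite s7 !binvalE; apply: eq_bigr => l _.
  by rewrite divnMDl// divn_small// addn0 modnMDl modn_small.
have u'01 : 0 <= u' 7%N <= 1.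
  by rewrite u'7; have := @binval_itv R (fun l => 1 / 2 <= iter l bfrac (tab tau (corner X1 X2))) J; lra.
have u'i i : (i < 2)%N || (9 < i)%N -> u' i = v i.
  by move=> i9; rewrite si ?fi// !inE; apply/negP; lia.
have [|r7 rE ri] := @mul_step_foldlE J (exps tau) u' u'01.
  by move=> e et; rewrite u'i ?ve.
have prodE : \prod_(e <- exps tau) u' (inp e) = \prod_(e <- exps tau) v (inp e).
  by apply: eq_bigr => e _; rewrite u'i.
rewrite prodE in rE; rewrite /add_term.
set z := foldl _ _ _ in r7 rE ri *.
have zi i : (i < 2)%N || (9 < i)%N -> z i = v i.
  by move=> i9; rewrite ri ?u'i// !inE; apply/negP; lia.
have w0 : 0 <= Num.max (wt tau) 0 by rewrite le_max lexx orbT.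
have w1 : 0 <= Num.max (- wt tau) 0 by rewrite le_max lexx orbT.
have z7 : 0 <= z 7%N by case/andP: r7.
rewrite /asg /upd /= (zi 10%N)// (zi 11%N)//.
have g10 : 0 <= v 10%N + Num.max (wt tau) 0 * z 7%N by rewrite addr_ge0 ?mulr_ge0.
have g11 : 0 <= v 11%N + Num.max (- wt tau) 0 * z 7%N by rewrite addr_ge0 ?mulr_ge0.
rewrite (max_l g10) (max_l g11); split => //.
- have p01 : 0 <= \prod_(e <- exps tau) v (inp e) <= 1.
    exact: prod_unit_itv.
  set p := \prod_(_ <- _) _ in rE p01 *; set T := tab _ _ in u'7 *.
  have bT := binary_expansion T J (tab01 _); rewrite -u'7 in bT.
  rewrite (_ : _ - _ = wt tau * (z 7%N - T * p)); last first.
    by have [w|w] := leP (wt tau) 0; [rewrite max_l|rewrite max_r]; lra.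
  rewrite normrM ler_wpM2l//.
  rewrite (_ : _ - _ = (z 7%N - u' 7%N * p) + (u' 7%N - T) * p); last by ring.
  rewrite (le_trans (ler_normD _ _))// natrD mulr1n [leRHS]mulrDl mul1r addrC lerD//.
  rewrite normrM (@le_trans _ _ (`|u' 7%N - T| * 1))//.
    by rewrite ler_wpM2l// ger0_norm; lra.
  by rewrite mulr1 distrC ger0_norm; lra.
- move=> i i2; rewrite (_ : (i == 11)%N = false) 1?(_ : (i == 10)%N = false) ?zi//; clear -i2; lia.
Qed.

Definition approximant (ts : seq term) v : nat -> R :=
  asg 10 (fun u => u 10%N + (- u 11%N))
    (foldl (fun u tau => add_term tau u) (read_cell n d v) ts).

Lemma foldl_add_termE s ts v X1 X2 : (0 < J)%N -> v 0%N = X1%:R -> v 1%N = X2%:R ->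
  (X1 < P)%N -> (X2 < P)%N -> (forall j, (j < d)%N -> 0 <= v (inp j) <= 1) ->
  (forall tau, List.In tau ts -> (size (exps tau) <= s)%N /\
     (forall e, e \in exps tau -> (e < d)%N) /\ forall k, 0 <= tab tau k <= 1) ->
  0 <= v 10%N -> 0 <= v 11%N ->
  let v' := foldl (fun u tau => add_term tau u) v ts in
  `|(v' 10%N - v' 11%N) - ((v 10%N - v 11%N) +
     \sum_(tau <- ts) wt tau * (tab tau (corner X1 X2) * \prod_(e <- exps tau) v (inp e)))|
    <= (\sum_(tau <- ts) `|wt tau|) * ((1 + s)%:R * (2 ^+ J)^-1).
Proof.
move=> J0; elim: ts v => [|tau ts IH] v v0 v1 X1P X2P vd tsP v10 v11 /=.
  by rewrite !big_nil addr0 subrr normr0 mul0r.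
have [es [ed et]] := tsP tau (or_introl erefl).
have [|a10 a11 aE ai] := @add_termE tau v X1 X2 J0 v0 v1 X1P X2P et _ v10 v11.
  by move=> e /ed; exact: vd.
set u := add_term tau v in a10 a11 aE ai *.
have ui j : u (inp j) = v (inp j) by apply: ai; rewrite orbT.
have [ud tsP'] : (forall j, (j < d)%N -> 0 <= u (inp j) <= 1) /\ (forall tau, List.In tau ts -> (size (exps tau) <= s)%N /\
     (forall e, e \in exps tau -> (e < d)%N) /\ forall k, 0 <= tab tau k <= 1).
  split=> [j jd|t tt]; first by rewrite ui; exact: vd.
  by apply: tsP; right.
have u0 : u 0%N = X1%:R by rewrite ai.
have u1 : u 1%N = X2%:R by rewrite ai.
have := IH u u0 u1 X1P X2P ud tsP' a10 a11; cbv zeta.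
set v' := foldl _ _ _; rewrite !big_cons.
rewrite (eq_bigr (fun tau0 => wt tau0 * (tab tau0 (corner X1 X2) * \prod_(e <- exps tau0) v (inp e)))); last first.
  by move=> t _; congr (_ * (_ * _)); apply: eq_bigr => e _; rewrite ui.
set S := \sum_(_ <- _) _ * _; set A := \sum_(_ <- _) `|_|; set c := (_ * _^-1) => IHE.
have cs : `|wt tau| * ((1 + size (exps tau))%:R * (2 ^+ J)^-1) <= `|wt tau| * c.
  apply: ler_wpM2l => //; apply: ler_wpM2r; first by rewrite invr_ge0 exprn_ge0.
  by rewrite ler_nat leq_add2l.
have {aE cs} := le_trans aE cs; set p := wt tau * (_ * _) => aE.
rewrite (_ : _ - _ = (v' 10%N - v' 11%N - (u 10%N - u 11%N + S)) +
   (u 10%N - u 11%N - (v 10%N - v 11%N + p))); last by ring.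
by rewrite (le_trans (ler_normD _ _))// mulrDl addrC lerD.
Qed.

Lemma approximantE s ts v : (0 < J)%N ->
  (forall tau, List.In tau ts -> (size (exps tau) <= s)%N /\
     (forall e, e \in exps tau -> (e < d)%N) /\ forall k, 0 <= tab tau k <= 1) ->
  (forall j, (j < d)%N -> 0 <= v (inp j) <= 1) ->
  (forall i, (i < 12)%N -> v i = 0) ->
  exists2 z, approximant ts v 10%N = Num.max z 0 &
  `|z - \sum_(tau <- ts) wt tau *
       (tab tau (fun j => if (j < d)%N then dnum (v (inp j)) (n + n) else 0%N) *
        \prod_(e <- exps tau) iter (n + n) bfrac (v (inp e)))|
    <= (\sum_(tau <- ts) `|wt tau|) * ((1 + s)%:R * (2 ^+ J)^-1).
Proof.
move=> J0 tsP v01 v0.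
have [||i1 i2 ii io] := @read_cellE R n d v v01; rewrite ?v0//.
set u := read_cell n d v in i1 i2 ii io.
set X1 := concat_digits _ _ _ in i1; set X2 := concat_digits _ _ _ in i2.
have uo i : (9 < i < 12)%N -> u i = 0.
  move=> i9; rewrite io ?v0//; first by lia.
    by rewrite !inE; apply/negP; lia.
  by move=> j _; rewrite /inp; lia.
have X1P : (X1 < P)%N by apply: concat_digits_lt => j; exact: dnum_lt.
have X2P : (X2 < P)%N by apply: concat_digits_lt => j; exact: dnum_lt.
have ud j : (j < d)%N -> 0 <= u (inp j) <= 1.
  by move=> jd; rewrite ii ?iter_bfrac_itv ?v01.
have u10 : u 10%N = 0 by exact: uo.
have u11 : u 11%N = 0 by exact: uo.
have := @foldl_add_termE s ts u X1 X2 J0 i1 i2 X1P X2P ud tsP.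
rewrite u10 u11 lexx => /(_ isT isT); rewrite subrr add0r => E.
exists (foldl (fun u0 tau => add_term tau u0) u ts 10%N - foldl (fun u0 tau => add_term tau u0) u ts 11%N).
  by rewrite /approximant /asg /upd eqxx.
move: E; congr (`| _ - _ | <= _); apply: eq_sum_In => tau tt.
have [_ [ed _]] := tsP _ tt; congr (_ * (tab tau _ * _)).
  apply/funext => j; rewrite /corner; case: ifP => // jd.
  rewrite /X1 /X2 !digit_of_concat// => [|k|k]; [|exact: dnum_lt..].
  by rewrite dnum_add.
by apply: eq_big_seq => e ee; rewrite ii ?ed.
Qed.

(** The layer counts of the subroutines, in order of execution. The dominant one is [P * J], where
    [P = 2 ^ (n * d)] is the square root of the number of cells. *)
Definition approximant_depth s T : nat :=
  (d * (n * 4 + n * 4) + T * ((1 + P * 3) + (1 + P * J * 9) + s * (J * 5 + 3) + 2) + 1)%N.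

Lemma computes_pop Q r : (3 < Q)%N -> (r < Q)%N -> @computes R Q 3 (pop r).
Proof.
move=> Q3 rQ; apply: (computes_comp _ 2 1); first by apply: computes_thr => //; affine.
by apply: computes_asg => //; affine.
Qed.

Lemma computes_read_digits Q m r k : (3 < Q)%N -> (r < Q)%N -> (k < Q)%N ->
  @computes R Q (m * 4)%N (read_digits m r k).
Proof.
move=> Q3 rQ kQ; apply: computes_iteri => [|i _]; first exact: leq_trans Q3.
apply: (computes_comp _ 3 1); first exact: computes_pop.
by apply: computes_asg => //; affine.
Qed.

Lemma computes_add_term Q s tau : (12 + d <= Q)%N -> (size (exps tau) <= s)%N ->
  (forall e, e \in exps tau -> (e < d)%N) ->
  computes Q ((1 + P * 3) + (1 + P * J * 9) + s * (J * 5 + 3) + 2)%N (add_term tau).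
Proof.
move=> dQ es ed; have Q12 : (11 < Q)%N by apply: leq_trans dQ; rewrite leq_addr.
have lQ i : (i < 12)%N -> (i < Q)%N by move=> i12; exact: leq_trans i12 Q12.
have Q0 : (0 < Q)%N by exact: lQ.
have cf : computes Q (1 + P * 3)%N (fetch P (word tau)).
  apply: computes_comp; first by apply: computes_asg; [exact: lQ|affine].
  apply: computes_iteri => // i _; apply: (computes_comp _ 2 1).
    by apply: computes_thr; [exact: lQ|affine; exact: lQ].
  by apply: computes_asg; [exact: lQ|affine; exact: lQ].
have cs : @computes R Q (1 + P * J * 9)%N (select P J).
  apply: computes_comp; first by apply: computes_asg; [exact: lQ|affine].
  apply: computes_iteri => // i _.
  apply: (computes_comp _ 8 1); last by apply: computes_asg; [exact: lQ|affine; exact: lQ].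
  apply: (computes_comp _ 7 1); last by apply: computes_asg; [exact: lQ|affine; exact: lQ].
  apply: (computes_comp _ 5 2); last by apply: computes_thr; [exact: lQ|affine; exact: lQ].
  apply: (computes_comp _ 3 2); last by apply: computes_thr; [exact: lQ|affine; exact: lQ].
  by apply: computes_pop; exact: lQ.
have cm : computes Q (s * (J * 5 + 3))%N (fun v => foldl (fun u e => mul_step J (inp e) u) v (exps tau)).
  apply: (@computes_leq _ _ (size (exps tau) * (J * 5 + 3))%N) => //; first by rewrite leq_mul2r es orbT.
  elim: (exps tau) ed => [|e l IH] ed /=; first exact: computes_id.
  have {}IH : computes Q (size l * (J * 5 + 3))%N (fun v => foldl (fun u e => mul_step J (inp e) u) v l).
    by apply: IH => f fl; apply: ed; rewrite inE fl orbT.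
  have eQ : (inp e < Q)%N.
    by apply: leq_trans dQ; have := ed e (mem_head _ _); rewrite /inp; lia.
  rewrite mulSn; apply: (computes_comp _ _ _ (mul_step J (inp e)) _ _ IH).
  rewrite (_ : (J * 5 + 3 = (1 + 1) + J * 5 + 1)%N); last by lia.
  apply: computes_comp; last by apply: computes_asg; [exact: lQ|affine; exact: lQ].
  apply: computes_comp.
    apply: computes_comp; first by apply: computes_asg; [exact: lQ|affine].
    by apply: computes_asg; [exact: lQ|affine].
  apply: computes_iteri => // i _.
  apply: (computes_comp _ 4 1); last by apply: computes_asg; [exact: lQ|affine; exact: lQ].
  apply: (computes_comp _ 3 1); last by apply: computes_asg; [exact: lQ|affine; exact: lQ].
  by apply: computes_pop; exact: lQ.
have c2 : computes Q (1 + 1)%N (asg 11 (fun u => u 11%N + Num.max (- wt tau) 0 * u 7%N)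
    \o asg 10 (fun u => u 10%N + Num.max (wt tau) 0 * u 7%N)).
  by apply: computes_comp; (apply: computes_asg; [exact: lQ|affine; exact: lQ]).
exact: (computes_comp _ _ _ _ _ (computes_comp _ _ _ _ _ (computes_comp _ _ _ _ _ cf cs) cm) c2).
Qed.

Lemma computes_approximant Q s ts : (12 + d <= Q)%N ->
  (forall tau, List.In tau ts -> (size (exps tau) <= s)%N /\
     (forall e, e \in exps tau -> (e < d)%N)) ->
  computes Q (approximant_depth s (size ts)) (approximant ts).
Proof.
move=> dQ tsP; have Q12 : (11 < Q)%N by apply: leq_trans dQ; rewrite leq_addr.
have lQ i : (i < 12)%N -> (i < Q)%N by move=> i12; exact: leq_trans i12 Q12.
have Q0 : (0 < Q)%N by exact: lQ.
have ca : @computes R Q 1 (asg 10 (fun u => u 10%N + (- u 11%N))).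
  by apply: computes_asg; [exact: lQ|affine; exact: lQ].
have cr : @computes R Q (d * (n * 4 + n * 4))%N (read_cell n d).
  apply: computes_iteri => // j jd.
  have jQ : (inp j < Q)%N by apply: leq_trans dQ; rewrite /inp; lia.
  have crd k : (k < 12)%N -> @computes R Q (n * 4)%N (read_digits n (inp j) k).
    by move=> k12; apply: computes_read_digits => //; exact: lQ.
  exact: (computes_comp _ _ _ _ _ (crd 0%N isT) (crd 1%N isT)).
suff cf : computes Q (size ts * ((1 + P * 3) + (1 + P * J * 9) + s * (J * 5 + 3) + 2))%N
    (fun v => foldl (fun u tau => add_term tau u) v ts).
  exact: (computes_comp _ _ _ _ _ (computes_comp _ _ _ _ _ cr cf) ca).
elim: ts tsP => [|tau ts IH] tsP /=; first exact: computes_id.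
have {}IH : computes Q (size ts * ((1 + P * 3) + (1 + P * J * 9) + s * (J * 5 + 3) + 2))%N
    (fun v => foldl (fun u tau => add_term tau u) v ts).
  by apply: IH => t tt; apply: tsP; right.
rewrite mulSn; apply: (computes_comp _ _ _ (add_term tau) _ _ IH).
by have [es ed] := tsP tau (or_introl erefl); apply: computes_add_term.
Qed.

End Program.
End Approximant.

(** * Taylor polynomials in Hoelder classes *)

Section Taylor.
Context {R : realType} {d : nat}.
Local Notation pt := (d.-tuple R).
Implicit Types (f g : pt -> R) (x k t : pt).

Definition tset x (i : 'I_d) (v : R) : pt := [tuple if j == i then v else tnth x j | j < d].

Lemma tnth_tset x i v j : tnth (tset x i v) j = if j == i then v else tnth x j.
Proof. by rewrite tnth_mktuple. Qed.

Lemma shift_tset x i v h : Defs.shift (tset x i v) i h = tset x i (v + h).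
Proof.
apply: eq_from_tnth => j; rewrite /Defs.shift tnth_mktuple !tnth_tset.
by case: eqP => // _; rewrite addr0.
Qed.

Lemma is_derive_pderiv f x i v : pdiffble i f (tset x i v) ->
  is_derive v (1 : R) (fun v => f (tset x i v)) (pderiv i f (tset x i v)).
Proof.
rewrite /pdiffble /pderiv derive1E.
have E : (fun h => f (Defs.shift (tset x i v) i h)) = (fun h => f (tset x i (v + h))).
  by apply/funext => h; rewrite shift_tset.
rewrite E => df.
pose q (h : R) := h^-1 *: (f (tset x i (v + h)) - f (tset x i v)).
have q1 : (fun h : R => h^-1 *: (((fun h => f (tset x i (v + h))) \o shift 0) (h *: 1) -
    f (tset x i (v + 0)))) = q.
  by apply/funext => h; rewrite /q /= !addr0 /GRing.scale /= mulr1.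
have q2 : (fun h : R => h^-1 *: (((fun v => f (tset x i v)) \o shift v) (h *: 1) -
    f (tset x i v))) = q.
  by apply/funext => h; rewrite /q /= [h%:A]mulr1 [h + v]addrC.
apply: DeriveDef; first by move: df; rewrite /derivable q1 q2.
by rewrite /derive q1 q2.
Qed.

(** The derivative of the remainder is the remainder of order one less for [pderiv i f], so
    induction and the mean value theorem suffice. The bound needs only the oscillation of the last
    derivative, as provided by a Hoelder condition. *)
Lemma taylor_coord i p f x (a b A : R) : a <= b ->
  (forall l v, (l < p)%N -> a <= v <= b -> pdiffble i (iter l (pderiv i) f) (tset x i v)) ->
  (forall v, a <= v <= b ->
     `|iter p (pderiv i) f (tset x i v) - iter p (pderiv i) f (tset x i a)| <= A) ->
  `|f (tset x i b) - \sum_(l < p.+1) (b - a) ^+ l / (l`!)%:R * iter l (pderiv i) f (tset x i a)|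
    <= A * (b - a) ^+ p.
Proof.
elim: p f b => [|p IH] f b ab df fA.
  rewrite big_ord_recl big_ord0 !expr0 fact0 divr1 mul1r addr0 mulr1.
  by apply: fA; rewrite ab lexx.
pose c l := iter l (pderiv i) f (tset x i a).
pose phi v := f (tset x i v) - \sum_(l < p.+2) (v - a) ^+ l / (l`!)%:R * c l.
pose dphi v := pderiv i f (tset x i v) - \sum_(l < p.+1) (v - a) ^+ l / (l`!)%:R * c l.+1.
have dphiE v : a <= v <= b -> is_derive v (1 : R) phi (dphi v).
  move=> vab; apply: is_deriveB; first by apply: is_derive_pderiv; exact: (df 0%N).
  rewrite (_ : (fun _ => _) = \sum_(l < p.+2) (fun v => (v - a) ^+ l / (l`!)%:R * c l)); last first.
    by apply/funext => u; rewrite fct_sumE.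
  have dl l : is_derive v (1 : R) (fun v => (v - a) ^+ l.+1 / (l.+1`!)%:R * c l.+1)
     ((v - a) ^+ l / (l`!)%:R * c l.+1).
    have d0 : is_derive v (1 : R) (fun u => u - a) (1 : R).
      have := is_deriveB (is_derive_id v (1 : R)) (is_derive_cst a v (1 : R)).
      by move=> /is_derive_eq; apply; rewrite subr0.
    have := is_deriveZ (c l.+1 / (l.+1`!)%:R) (is_deriveX l.+1 d0).
    set G := (X in is_derive _ _ X _); rewrite (_ : G = (fun u => (u - a) ^+ l.+1 / (l.+1`!)%:R * c l.+1)); last first.
      by apply/funext => u; rewrite /G exprfctE /= /GRing.scale /= mulrC mulrA mulrAC.
    move=> /is_derive_eq; apply; rewrite /GRing.scale /= mulr1 factS natrM.
    have l0 : (l.+1)%:R != 0 :> R by rewrite pnatr_eq0.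
    have f0 : (l`!)%:R != 0 :> R by rewrite pnatr_eq0 -lt0n fact_gt0.
    move: l0 f0; move: (l.+1%:R : R) (l`!%:R : R) => N M N0 M0.
    by field; rewrite M0 N0.
  have := @is_derive_sum R R R p.+2 (fun l v => (v - a) ^+ l / (l`!)%:R * c l) v 1
    (fun l => if l is Ordinal (l'.+1) _ then (v - a) ^+ l' / (l'`!)%:R * c l'.+1 else 0).
  move=> /(_ _)/is_derive_eq; apply.
    case=> -[|l] ll; last exact: dl.
    rewrite (_ : (fun _ => _) = cst (c 0%N)); first exact: is_derive_cst.
    by apply/funext => u; rewrite /= expr0 fact0 divr1 mul1r.
  by rewrite big_ord_recl add0r; apply: eq_bigr.
have phia : phi a = 0.
  rewrite /phi big_ord_recl big1 => [|l _]; last by rewrite subrr expr0n /= !mul0r.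
  by rewrite expr0 fact0 divr1 mul1r addr0 subrr.
have A0 : 0 <= A.
  by apply: le_trans (fA a _); rewrite ?normr_ge0// lexx.
have [ab0|ab'] := eqVneq a b.
  by rewrite -/c -/(phi b) -ab0 phia normr0 mulr_ge0// exprn_ge0// subr_ge0.
have {ab'} ab' : a < b by rewrite lt_neqAle ab' ab.
have [||v vab E] := @MVT R phi dphi a b ab'.
- by move=> v; rewrite in_itv /= => /andP[v1 v2]; apply: dphiE; lra.
- apply: derivable_within_continuous => v; rewrite in_itv /= => vab.
  by have [] := dphiE v vab.
rewrite phia subr0 in E; rewrite -/c -/(phi b) E normrM exprSr mulrA.
move: vab; rewrite in_itv /= => /andP[va vb].
rewrite [`|b - a|]ger0_norm ?subr_ge0//; apply: ler_wpM2r; first by rewrite subr_ge0.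
apply: (@le_trans _ _ (A * (v - a) ^+ p)).
  have := IH (pderiv i f) v (ltW va); rewrite /dphi /c.
  under eq_bigr do rewrite -iterSr; apply.
  - move=> l w lp wab; rewrite -iterSr; apply: df => //; lra.
  - move=> w wab; rewrite -!iterSr; apply: fA; lra.
by apply: ler_wpM2l => //; apply: lerXn2r; rewrite ?nnegrE; lra.
Qed.

Lemma cube01_tset x i v : cube01 x -> 0 <= v <= 1 -> cube01 (tset x i v).
Proof. by move=> cx v01 j; rewrite tnth_tset; case: eqP. Qed.

(* [pderivs] differentiates along the last coordinate first, so a derivative along [j]
   stays in canonical form as long as the coordinates up to [j] are untouched. *)
Lemma pderivs_iter (a : 'I_d -> nat) (j : 'I_d) l f : (forall i : 'I_d, (i <= j)%N -> a i = 0%N) ->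
  iter l (pderiv j) (pderivs a f) = pderivs (fun i => if i == j then l else a i) f.
Proof.
move=> a0; rewrite /pderivs.
have dropE : drop j (enum 'I_d) = j :: drop j.+1 (enum 'I_d).
  by rewrite (drop_nth j) ?size_enum_ord// nth_ord_enum.
have takeE (b : 'I_d -> nat) g : (forall i : 'I_d, (i < j)%N -> b i = 0%N) ->
    foldr (fun i g => iter (b i) (pderiv i) g) g (take j (enum 'I_d)) = g.
  move=> b0; have : all (fun i : 'I_d => (i < j)%N) (take j (enum 'I_d)).
    by apply/allP => i; rewrite in_take ?mem_enum// index_enum_ord.
  elim: (take _ _) => [//|i r IH] /= /andP[ij /IH ->]; by rewrite b0.
rewrite -(cat_take_drop j (enum 'I_d)) !foldr_cat !takeE; last 2 first.
- move=> i ij; rewrite (_ : i == j = false); first by apply: a0; exact: ltnW.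
  by apply/negP => /eqP E; rewrite E ltnn in ij.
- by move=> i ij; apply: a0; exact: ltnW.
rewrite dropE /= a0// eqxx /=; congr iter.
have : j \notin drop j.+1 (enum 'I_d).
  have := enum_uniq 'I_d; rewrite -{1}(cat_take_drop j (enum 'I_d)) cat_uniq dropE /=.
  by case/and3P => _ _ /andP[].
elim: (drop _ _) => [//|i r IH] /=; rewrite inE negb_or => /andP[ij /IH ->].
by rewrite eq_sym (negPf ij).
Qed.

Lemma mi_order_set (a : 'I_d -> nat) (j : 'I_d) l : a j = 0%N ->
  mi_order (fun i => if i == j then l else a i) = (mi_order a + l)%N.
Proof.
move=> aj; rewrite /mi_order (bigD1 j)//= eqxx [in RHS](bigD1 j)//= aj add0n addnC.
by congr addn; apply: eq_bigr => i /negPf ->.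
Qed.

Definition taylor_term : Type := (R * seq nat * (pt -> R))%type.

Fixpoint taylor_terms (h : R) (js : seq 'I_d) f (p : nat) : seq taylor_term :=
  if js is j :: js' then
    flatten [seq [seq (h ^+ l / (l`!)%:R * tau.1.1, nseq l (nat_of_ord j) ++ tau.1.2, tau.2)
                 | tau <- taylor_terms h js' (iter l (pderiv j) f) (p - l)%N]
            | l <- iota 0 p.+1]
  else [:: (1, [::], f)].

Definition taylor_eval (k : pt) (y : nat -> R) (ts : seq taylor_term) : R :=
  \sum_(tau <- ts) tau.1.1 * (tau.2 k * \prod_(e <- tau.1.2) y e).

Lemma taylor_eval_cons h j js f p k (y : nat -> R) :
  taylor_eval k y (taylor_terms h (j :: js) f p) =
  \sum_(l < p.+1) (h * y j) ^+ l / (l`!)%:R *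
     taylor_eval k y (taylor_terms h js (iter l (pderiv j) f) (p - l)%N).
Proof.
rewrite /taylor_eval /taylor_terms -/taylor_terms big_flatten big_map.
rewrite -[iota 0 _]/(index_iota 0 p.+1) big_mkord.
apply: eq_bigr => l _; rewrite big_map mulr_sumr; apply: eq_bigr => tau _ /=.
by rewrite big_cat big_nseq iter_mulr_1 exprMn /=; ring.
Qed.

Definition mix (js : seq 'I_d) t k : pt :=
  [tuple if j \in js then tnth t j else tnth k j | j < d].

(** The expansion along the head coordinate is made at [mix js t k], whose other coordinates in [js]
    are already those of [t]; its coefficients are then expanded by induction. One new remainder
    plus at most [s.+1] inherited ones yield the geometric sum. *)
Lemma taylor_terms_approx G s (A h : R) k t (y : nat -> R) js p (a : 'I_d -> nat) :
  0 <= A -> 0 <= h <= 1 -> cube01 k -> cube01 t ->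
  (forall j : 'I_d, 0 <= y j <= 1) -> (forall j, tnth t j - tnth k j = h * y j) ->
  (forall (b : 'I_d -> nat) i x, (mi_order b < s)%N -> cube01 x -> pdiffble i (pderivs b G) x) ->
  (forall b x j v w, mi_order b = s -> cube01 x -> 0 <= v <= 1 -> 0 <= w <= 1 -> `|v - w| <= h ->
     `|pderivs b G (tset x j v) - pderivs b G (tset x j w)| <= A) ->
  sorted (fun i j : 'I_d => (j < i)%N) js -> (mi_order a + p = s)%N ->
  (forall i j : 'I_d, j \in js -> (i <= j)%N -> a i = 0%N) ->
  `|pderivs a G (mix js t k) - taylor_eval k y (taylor_terms h js (pderivs a G) p)|
    <= (\sum_(i < size js) s.+1 ^ i)%:R * (A * h ^+ p).
Proof.
move=> A0 h01 ck ct y01 tk dG GA; elim: js p a => [|j js IH] p a js_sorted ap aj.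
  rewrite /taylor_eval big_seq1 /= big_nil mul1r mulr1 big_ord0 mul0r.
  rewrite (_ : mix [::] t k = k) ?subrr ?normr0//.
  by apply: eq_from_tnth => i; rewrite tnth_mktuple.
have jjs : j \notin js.
  apply/negP => jin; move: js_sorted => /= /(order_path_min _)/allP.
  by move=> /(_ (fun a b c ab bc => ltn_trans bc ab) _ jin); rewrite ltnn.
pose x := mix js t k.
have cx : cube01 x by move=> i; rewrite tnth_mktuple; case: ifP.
have mE : mix (j :: js) t k = tset x j (tnth t j).
  apply: eq_from_tnth => i; rewrite tnth_tset !tnth_mktuple inE.
  by case: eqP => // ->.
have xE : x = tset x j (tnth k j).
  apply: eq_from_tnth => i; rewrite tnth_tset !tnth_mktuple.
  by case: eqP => // ->; rewrite (negPf jjs).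
have aj0 (i : 'I_d) : (i <= j)%N -> a i = 0%N by apply: aj; rewrite mem_head.
have tkh : 0 <= tnth t j - tnth k j <= h.
  by rewrite tk mulr_ge0 ?ler_piMr//; case/andP: (y01 j); case/andP: h01.
pose al l := fun i : 'I_d => if i == j then l else a i.
have iterE l : iter l (pderiv j) (pderivs a G) = pderivs (al l) G by exact: pderivs_iter.
have alE l : mi_order (al l) = (mi_order a + l)%N by rewrite mi_order_set ?aj0.
have kj := ck j; have tj := ct j.
have T1 : `|pderivs a G (tset x j (tnth t j)) - \sum_(l < p.+1) (tnth t j - tnth k j) ^+ l / (l`!)%:R *
    iter l (pderiv j) (pderivs a G) (tset x j (tnth k j))| <= A * (tnth t j - tnth k j) ^+ p.
  apply: taylor_coord => [|l v lp vk|v vk]; first lra.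
- rewrite iterE; apply: dG; first by rewrite alE; clear -lp ap; lia.
  by apply: cube01_tset => //; lra.
- rewrite iterE; apply: GA => //; [by rewrite alE|lra|].
  by rewrite ger0_norm; lra.
rewrite -mE -xE in T1.
rewrite taylor_eval_cons.
rewrite (_ : _ - _ = (pderivs a G (mix (j :: js) t k) -
    \sum_(l < p.+1) (tnth t j - tnth k j) ^+ l / (l`!)%:R * iter l (pderiv j) (pderivs a G) x)
  + \sum_(l < p.+1) (h * y j) ^+ l / (l`!)%:R * (iter l (pderiv j) (pderivs a G) x -
     taylor_eval k y (taylor_terms h js (iter l (pderiv j) (pderivs a G)) (p - l)%N))); last first.
  rewrite tk; under [X in _ = _ + X]eq_bigr do rewrite mulrBr.
  by rewrite sumrB; ring.
apply: (le_trans (ler_normD _ _)).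
rewrite [leRHS](_ : _ = A * h ^+ p + (\sum_(i < size js) s.+1 ^ i.+1)%:R * (A * h ^+ p)); last first.
  by rewrite /= big_ord_recl natrD mulrDl mul1r.
apply: lerD.
  apply: le_trans T1 _; apply: ler_wpM2l => //.
  by apply: lerXn2r; rewrite ?nnegrE; lra.
rewrite (le_trans (ler_norm_sum _ _ _))//.
set C := (\sum_(i < size js) s.+1 ^ i)%N in IH.
apply: (@le_trans _ _ (\sum_(l < p.+1) C%:R * (A * h ^+ p))).
  apply: ler_sum => l _; have lp : (l <= p)%N by rewrite -ltnS.
  have := IH (p - l)%N (al l); rewrite -iterE -/x => IHl.
  have {}IHl : `|iter l (pderiv j) (pderivs a G) x -
     taylor_eval k y (taylor_terms h js (iter l (pderiv j) (pderivs a G)) (p - l)%N)| <= C%:R * (A * h ^+ (p - l)).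
    apply: IHl.
    - exact: path_sorted js_sorted.
    - by rewrite alE -addnA subnKC.
    - move=> i i' i'js ii'; rewrite /al; have i'j : (i' < j)%N.
        move: js_sorted => /= /(order_path_min _)/allP; apply => //.
        by move=> u v w uv vw; exact: ltn_trans vw uv.
      rewrite (_ : i == j = false); first by apply: aj ii'; rewrite inE i'js orbT.
      by apply/negP => /eqP E; rewrite E leqNgt i'j in ii'.
  rewrite normrM; have y0 := y01 j.
  have hy : 0 <= h * y j <= h by rewrite -tk.
  have hl : `|(h * y j) ^+ l / (l`!)%:R| <= h ^+ l.
    rewrite ger0_norm; last by rewrite divr_ge0// exprn_ge0//; case/andP: hy.
    rewrite ler_pdivrMr ?ltr0n ?fact_gt0//.
    apply: (@le_trans _ _ (h ^+ l)); first by apply: lerXn2r; rewrite ?nnegrE; lra.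
    by rewrite ler_peMr ?exprn_ge0 ?ler1n ?fact_gt0//; case/andP: h01.
  apply: le_trans (ler_pM _ _ hl IHl) _ => //.
  have -> : h ^+ p = h ^+ l * h ^+ (p - l) by rewrite -exprD subnKC.
  by rewrite le_eqVlt; apply/orP; left; apply/eqP; ring.
rewrite sumr_const card_ord -[leLHS]mulr_natl mulrA -natrM.
apply: ler_wpM2r; first by rewrite mulr_ge0// exprn_ge0//; case/andP: h01.
rewrite ler_nat /C; under [X in (_ <= X)%N]eq_bigr do rewrite expnS.
rewrite -big_distrr /= leq_mul2r; apply/orP; right; rewrite ltnS -ap; exact: leq_addl.
Qed.
End Taylor.

Section TaylorTerms.
Context {R : realType} {d : nat}.
Local Notation pt := (d.-tuple R).

Lemma In_cat (T : Type) (s1 s2 : seq T) x :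
  List.In x (s1 ++ s2) -> List.In x s1 \/ List.In x s2.
Proof.
elim: s1 => [|y s1 IH] /=; first by right.
move=> [->|xs]; first by left; left.
by case: (IH xs) => h; [left; right|right].
Qed.

Lemma In_flatten_map (T U : Type) (g : U -> seq T) (r : seq U) x :
  List.In x (flatten [seq g i | i <- r]) -> exists2 i, List.In i r & List.In x (g i).
Proof.
elim: r => [//|i r IH] /= xir; have [xi|xr] := In_cat _ _ _ _ xir; first by exists i => //; left.
by have [j jr xj] := IH xr; exists j => //; right.
Qed.

Lemma In_map (T U : Type) (g : U -> T) (r : seq U) x :
  List.In x [seq g i | i <- r] -> exists2 i, List.In i r & x = g i.
Proof.
elim: r => [//|i r IH] /= [<-|xr]; first by exists i => //; left.
by have [j jr ->] := IH xr; exists j => //; right.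
Qed.

Lemma In_iota l m n : List.In l (iota m n) -> (l < m + n)%N.
Proof.
elim: n m => [//|n IH] m /= [<-|lm]; first by rewrite addnS ltnS leq_addr.
by rewrite -addSnnS; exact: IH.
Qed.

Lemma taylor_terms_spec (G : pt -> R) h js p (a : 'I_d -> nat) tau : 0 <= h <= 1 ->
  sorted (fun i j : 'I_d => (j < i)%N) js ->
  (forall i j : 'I_d, j \in js -> (i <= j)%N -> a i = 0%N) ->
  List.In tau (taylor_terms h js (pderivs a G) p) ->
  [/\ 0 <= tau.1.1 <= 1, (size tau.1.2 <= p)%N, (forall e, e \in tau.1.2 -> (e < d)%N) &
    exists2 b : 'I_d -> nat, (mi_order b <= mi_order a + p)%N & tau.2 = pderivs b G].
Proof.
move=> h01; elim: js p a tau => [|j js IH] p a tau js_sorted aj.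
  by move=> [<-|//]; split=> //=; [lra|exists a => //; rewrite leq_addr].
rewrite /taylor_terms -/taylor_terms => tj.
have [l lp' tl] := In_flatten_map _ _ _ _ _ tj.
have lp := In_iota _ _ _ lp'; have [t + ->] := In_map _ _ _ _ _ tl; move=> /=.
have aj0 (i : 'I_d) : (i <= j)%N -> a i = 0%N by apply: aj; rewrite mem_head.
rewrite pderivs_iter// => tI; have [||t1 t2 t3 [b bo bE]] := IH _ _ _ _ _ tI.
- exact: path_sorted js_sorted.
- move=> i i' i'js ii'; have i'j : (i' < j)%N.
    move: js_sorted => /= /(order_path_min _)/allP; apply => //.
    by move=> u v w uv vw; exact: ltn_trans vw uv.
  rewrite (_ : i == j = false); first by apply: aj ii'; rewrite inE i'js orbT.
  by apply/negP => /eqP E; rewrite E leqNgt i'j in ii'.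
rewrite add0n ltnS in lp; rewrite mi_order_set ?aj0// in bo.
have f1 : 1 <= (l`!)%:R :> R by rewrite ler1n fact_gt0.
have hl : 0 <= h ^+ l / (l`!)%:R <= 1.
  apply/andP; split; first by rewrite divr_ge0// exprn_ge0//; case/andP: h01.
  rewrite ler_pdivrMr ?mul1r; last by rewrite ltr0n fact_gt0.
  by apply: le_trans f1; apply: exprn_ile1; case/andP: h01.
split.
- case/andP: hl => h1 h2; case/andP: t1 => t10 t11.
  by rewrite mulr_ge0//= mulr_ile1.
- by rewrite size_cat size_nseq; lia.
- by move=> e; rewrite mem_cat mem_nseq => /orP[/andP[_ /eqP ->]|/t3//].
- by exists b => //; lia.
Qed.

Lemma size_taylor_terms h js (f : pt -> R) p s : (p <= s)%N ->
  (size (taylor_terms h js f p) <= s.+1 ^ size js)%N.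
Proof.
elim: js f p => [//|j js IH] f p ps; rewrite /taylor_terms -/taylor_terms.
rewrite size_flatten /shape -map_comp sumnE big_map -[iota 0 _]/(index_iota 0 p.+1) big_mkord.
apply: (@leq_trans (\sum_(l < p.+1) s.+1 ^ size js)%N).
  by apply: leq_sum => l _; rewrite /= size_map; apply: IH; lia.
by rewrite sum_nat_const card_ord [X in (_ <= X)%N]expnS leq_mul2r ltnS ps orbT.
Qed.

Lemma hfloorE (beta : R) : 0 < beta -> 0 < beta - (hfloor beta)%:R <= 1.
Proof.
move=> b0; rewrite /hfloor.
have c1 : 0 < Num.ceil beta by rewrite ceil_gt0.
have -> : (`|Num.ceil beta - 1|%N)%:R = (Num.ceil beta - 1)%:~R :> R.
  by rewrite natr_absz ger0_norm// subr_ge0 -gtz0_ge1.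
have /andP[a b] := ceil_itv beta; move: a b; rewrite intrB.
by lra.
Qed.

Section HolderTaylor.
Variables (beta B : R) (G : pt -> R).
Hypotheses (beta0 : 0 < beta) (holG : holder_cube beta B G).
Let s := hfloor beta.

Lemma holder_ge0 : 0 <= B.
Proof.
have [_ [/(_ (fun=> 0%N)) h _]] := holG.
have c0 : cube01 ([tuple 0 | j < d] : pt) by move=> i; rewrite tnth_mktuple; lra.
by apply: le_trans (h _ _ c0); rewrite ?normr_ge0// /mi_order big1.
Qed.

Lemma holder_diff (b : 'I_d -> nat) (x : pt) j v w h : mi_order b = s -> cube01 x ->
  0 <= v <= 1 -> 0 <= w <= 1 -> `|v - w| <= h ->
  `|pderivs b G (tset x j v) - pderivs b G (tset x j w)| <= B * h `^ (beta - s%:R).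
Proof.
move=> bs cx v01 w01 vwh; have [_ [_ H]] := holG.
have B0 := holder_ge0; have /andP[r0 r1] := hfloorE beta beta0.
have [->|vw] := eqVneq v w.
  by rewrite subrr normr0 mulr_ge0// powR_ge0.
have dE : euclid_dist (tset x j v) (tset x j w) = `|v - w|.
  rewrite /euclid_dist (bigD1 j)//= !tnth_tset eqxx big1 ?addr0 ?sqrtr_sqr// => i ij.
  by rewrite !tnth_tset (negPf ij) subrr expr0n.
have := H b bs (tset x j v) (tset x j w) (cube01_tset _ _ _ cx v01) (cube01_tset _ _ _ cx w01).
have vw0 : 0 < `|v - w| by rewrite normr_gt0 subr_eq0.
move=> /(_ _); rewrite dE ler_pdivrMr ?powR_gt0// => h'.
apply: le_trans (h' _) _.
  by move=> /(congr1 (fun t => tnth t j)); rewrite !tnth_tset eqxx => E; rewrite E eqxx in vw.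
apply: ler_wpM2l => //; apply: ge0_ler_powR; rewrite ?nnegrE ?normr_ge0//; first exact: ltW.
exact: le_trans vwh.
Qed.

(** Decreasing order, because [pderivs] differentiates along the last coordinate first. *)
Definition coords : seq 'I_d := rev (enum 'I_d).

Lemma coords_sorted : sorted (fun i j : 'I_d => (j < i)%N) coords.
Proof.
rewrite /coords rev_sorted; have := iota_ltn_sorted 0 d.
by rewrite -val_enum_ord sorted_map.
Qed.

Lemma mix_coords (t k : pt) : mix coords t k = t.
Proof. by apply: eq_from_tnth => i; rewrite tnth_mktuple mem_rev mem_enum. Qed.

Lemma pderivs0 : pderivs (fun=> 0%N) G = G.
Proof. by rewrite /pderivs; elim: (enum _). Qed.

Lemma holder_taylor h (k t : pt) (y : nat -> R) : 0 <= h <= 1 -> cube01 k -> cube01 t ->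
  (forall j : 'I_d, 0 <= y j <= 1) -> (forall j, tnth t j - tnth k j = h * y j) ->
  `|G t - taylor_eval k y (taylor_terms h coords G s)|
    <= (\sum_(i < d) s.+1 ^ i)%:R * (B * h `^ beta).
Proof.
move=> h01 ck ct y01 tk; have /andP[r0 r1] := hfloorE beta beta0.
have B0 := holder_ge0; have [dG [_ _]] := holG.
have := @taylor_terms_approx R d G s (B * h `^ (beta - s%:R)) h k t y coords s (fun=> 0%N).
rewrite mix_coords pderivs0 size_rev size_enum_ord.
have -> : B * h `^ (beta - s%:R) * h ^+ s = B * h `^ beta.
  rewrite -mulrA -powR_mulrn; last by case/andP: h01.
  rewrite -powRD; first by rewrite subrK.
  by rewrite subrK (gt_eqF beta0).
apply => //.
- by rewrite mulr_ge0 ?powR_ge0.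
- by move=> b i x bs; exact: dG.
- by move=> b x j v w; exact: holder_diff.
- exact: coords_sorted.
- by rewrite /mi_order big1.
Qed.

End HolderTaylor.
End TaylorTerms.

(** * Approximation by narrow deep networks *)

Section NetworkHolder.
Context {R : realType} {d : nat}.
Local Notation pt := (d.-tuple R).

Definition clamp01 (x : R) : R := Num.min (Num.max x 0) 1.

Lemma clamp01_itv x : 0 <= clamp01 x <= 1.
Proof. by rewrite /clamp01 le_min ge_min lexx ler01 orbT !andbT le_max lexx orbT. Qed.

Lemma clamp01_sub x : -1 <= x <= 1 -> clamp01 x - clamp01 (- x) = x.
Proof.
move=> x1; rewrite /clamp01; have min01 : Num.min 0 1 = 0 :> R by rewrite min_l ?ler01.
have [x0|x0] := leP x 0.
  by rewrite min01 max_l ?min_l; lra.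
by rewrite [X in _ - X]minC max_r ?[Num.min 1 0]minC ?min01 ?min_l; lra.
Qed.

Definition grid_point (h : R) (k : nat -> nat) : pt := [tuple (k j)%:R * h | j < d].

(** A derivative bounded by [B] is written as [B] times the difference of two numbers in [0,1], its
    scaled positive and negative parts, since tables hold only such numbers. The clamping keeps the
    table in range even at grid points outside the cube. *)
Definition signed_term (B h : R) (tau : @taylor_term R d) (neg : bool) : @term R :=
  Term ((-1) ^+ neg * (B * tau.1.1))
    (fun k => clamp01 ((-1) ^+ neg * (tau.2 (grid_point h k) / B))) tau.1.2.

Definition network_terms B h (ts : seq (@taylor_term R d)) : seq (@term R) :=
  [seq signed_term B h tau false | tau <- ts] ++ [seq signed_term B h tau true | tau <- ts].

(** The first summand is the constant of the Taylor remainder. The second collects the digit errors: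
    at most [2 * s.+1 ^ d] terms of weight at most [B], each with at most [1 + s] errors. *)
Definition holder_const (beta : R) : R :=
  let s := hfloor beta in
  (\sum_(i < d) s.+1 ^ i + 2 * s.+1 ^ d * (1 + s))%:R.

(** [g] is the clipped output of the program and lies in the class only as a limit. Its error is
    split into the Taylor remainder at the corner of the cell and the digit errors of the
    evaluation. *)
Lemma network_holder (beta B u H : R) (f : pt -> R) n J k :
  0 < beta -> 0 < u -> 0 <= H -> (0 < J)%N -> 0 < B ->
  holder_cube beta B (fun x => f (map_tuple (fun t => 2 * u * t - u) x)) ->
  (approximant_depth d n J (hfloor beta) (2 * (hfloor beta).+1 ^ d) <= k)%N ->
  exists (fS : nat -> pt -> R) (g : pt -> R),
  [/\ forall S, @F_NN R d k.+2 (12 + d) 0 H (fS S),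
      forall x, exists S0, forall S, (S0 <= S)%N -> fS S x = g x &
      forall x, (forall j, `|tnth x j| <= u) -> exists2 z, g x = Num.min (Num.max z 0) H &
        `|z - f x| <= holder_const beta * (B * (((2 ^+ (n + n))^-1) `^ beta + (2 ^+ J)^-1))].
Proof.
move=> beta0 u0 H0 J0 B0; set G := (fun x => f _) => holG depth.
set s := hfloor beta in depth *; pose h : R := (2 ^+ (n + n))^-1.
have h0 : 0 < h by rewrite invr_gt0 exprn_gt0.
have h01 : 0 <= h <= 1.
  by rewrite ltW//= invf_le1 ?exprn_gt0// exprn_ege1// ler1n.
pose ts := taylor_terms h coords G s.
pose nts := network_terms B h ts.
have spec tau : List.In tau ts -> [/\ 0 <= tau.1.1 <= 1, (size tau.1.2 <= s)%N,
    (forall e, e \in tau.1.2 -> (e < d)%N) & forall k, cube01 k -> `|tau.2 k| <= B].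
  rewrite /ts -(pderivs0 G) => tI.
  have [||t1 t2 t3 [b bo ->]] := taylor_terms_spec _ _ _ _ _ _ h01 _ _ tI.
  - exact: coords_sorted.
  - by [].
  - split=> // x cx; have [_ [bG _]] := holG.
    by apply: bG => //; apply: leq_trans bo _; rewrite [mi_order _]big1.
have nspec tau : List.In tau nts -> (size (exps tau) <= s)%N /\
    (forall e, e \in exps tau -> (e < d)%N) /\ forall k, 0 <= tab tau k <= 1.
  move=> ti; have [b [t tt ->]] : exists b, exists2 t, List.In t ts & tau = signed_term B h t b.
    by have [xt|xt] := In_cat _ _ _ _ ti; have [t tt ->] := In_map _ _ _ _ _ xt; [exists false|exists true]; exists t.
  have [t1 t2 t3 _] := spec _ tt; split=> //=; split=> // k'; exact: clamp01_itv.
(* The affine map [x / (2u) + 1/2] sends the interval from [- u] to [u] onto [0,1]; it inverts the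
   rescaling in the Hoelder hypothesis. *)
pose A := (fun _ : nat => (2 * u)^-1); pose C := (fun _ : nat => 1 / 2 : R).
have size_nts : (size nts <= 2 * s.+1 ^ d)%N.
  rewrite size_cat !size_map mul2n -addnn.
  have := size_taylor_terms h coords G s s (leqnn _).
  by rewrite size_rev size_enum_ord => hh; apply: leq_add.
have cP : computes (12 + d) k (approximant d n J nts).
  apply: computes_leq (computes_approximant d n J (12 + d) s nts (leqnn _) _); first by [].
  - apply: leq_trans depth; rewrite /approximant_depth leq_add2r leq_add2l.
    by rewrite leq_mul2r size_nts orbT.
  - by move=> tau /nspec[a [b _]].
have [fS FS fSE] := @F_NN_computes R d (12 + d) 10 11 A C H (leq_addl _ _) H0 isT isT isT
  12 k _ (leqnn _) cP.
exists fS, (fun x => Num.min (approximant d n J nts (load d A C 12 (val x)) 10%N) H); split=> // x xu.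
pose v := load d A C 12 (val x).
pose t : pt := [tuple tnth x j * (2 * u)^-1 + 1 / 2 | j < d].
have ct : cube01 t.
  move=> j; rewrite tnth_mktuple; have := xu j; rewrite ler_norml => /andP[a b].
  have u2 : 0 < 2 * u by lra.
  apply/andP; split.
    suff : - (1 / 2) <= tnth x j * (2 * u)^-1 by lra.
    by rewrite ler_pdivlMr//; lra.
  suff : tnth x j * (2 * u)^-1 <= 1 / 2 by lra.
  by rewrite ler_pdivrMr//; lra.
have vt (j : 'I_d) : v (inp j) = tnth t j.
  rewrite /v /load (_ : (12 <= inp j < 12 + d)%N); last by rewrite /inp; have := ltn_ord j; lia.
  rewrite (_ : (inp j - 12 = j)%N); last by rewrite /inp; lia.
  rewrite /A /C -tnth_nth tnth_mktuple mulrC max_l//.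
  by have := ct j; rewrite tnth_mktuple => /andP[].
have v01 j : (j < d)%N -> 0 <= v (inp j) <= 1.
  by move=> jd; rewrite (vt (Ordinal jd)); exact: ct.
have vlow i : (i < 12)%N -> v i = 0 by move=> i12; rewrite /v /load leqNgt i12.
have [z zE zB] := @approximantE R d n J s nts v J0 nspec v01 vlow.
exists z; first by rewrite -/v zE.
pose kk := fun j => if (j < d)%N then dnum (v (inp j)) (n + n) else 0%N.
pose cc := grid_point h kk; pose y j := iter (n + n) bfrac (v (inp j)).
have y01 (j : 'I_d) : 0 <= y j <= 1 by apply: iter_bfrac_itv; exact: v01.
have tcc j : tnth t j - tnth cc j = h * y j.
  rewrite [tnth cc j]tnth_mktuple /kk ltn_ord -vt /y; have := dnum_frac (v (inp j)) (n + n).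
  move=> E; have {1}-> : v (inp j) = v (inp j) * 2 ^+ (n + n) * h by rewrite mulfK// gt_eqF// exprn_gt0.
  by rewrite E; ring.
have ccc : cube01 cc.
  move=> j; have := tcc j; have := ct j; have := y01 j; rewrite [tnth cc j]tnth_mktuple => y1 t1 E.
  rewrite mulr_ge0 ?(ltW h0)//=.
  have : h * y j >= 0 by rewrite mulr_ge0 ?(ltW h0)//; case/andP: y1.
  lra.
have T := holder_taylor beta B G beta0 holG h cc t y h01 ccc ct y01 tcc.
have Gt : G t = f x.
  rewrite /G; congr f; apply: eq_from_tnth => j; rewrite tnth_map tnth_mktuple.
  by field; rewrite gt_eqF.
rewrite Gt -/s -/ts in T.
have sumE : \sum_(tau <- nts) wt tau * (tab tau kk * \prod_(e <- exps tau) y e) = taylor_eval cc y ts.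
  rewrite /nts /network_terms big_cat !big_map /= -big_split /= /taylor_eval.
  apply: eq_sum_In => tau tt; have [t1 t2 t3 t4] := spec _ tt.
  rewrite expr0 expr1 !mul1r !mulN1r -/cc.
  have FB : -1 <= tau.2 cc / B <= 1.
    have := t4 _ ccc; rewrite ler_norml => /andP[a b].
    by rewrite ler_pdivlMr// ler_pdivrMr//; lra.
  rewrite -[in RHS](divfK (lt0r_neq0 B0) (tau.2 cc)) -[in RHS](clamp01_sub _ FB); ring.
have wtE : \sum_(tau <- nts) `|wt tau| <= (2 * s.+1 ^ d)%:R * B.
  have wB tau : List.In tau nts -> `|wt tau| <= B.
    move=> ti; have [b [t' tt ->]] : exists b, exists2 t, List.In t ts & tau = signed_term B h t b.
      by have [xt|xt] := In_cat _ _ _ _ ti; have [t' tt ->] := In_map _ _ _ _ _ xt; [exists false|exists true]; exists t'.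
    have [/andP[t1 t1'] _ _ _] := spec _ tt.
    rewrite /= normrM normrX normrN1 expr1n mul1r normrM !ger0_norm ?(ltW B0)//.
    by rewrite ler_piMr// ltW.
  apply: (@le_trans _ _ ((size nts)%:R * B)).
    elim: (nts) wB => [|tau l IH] wB; first by rewrite big_nil mul0r.
    rewrite big_cons /= -natr1 mulrDl mul1r addrC lerD//; last by apply: wB; left.
    by apply: IH => t' tt; apply: wB; right.
  by apply: ler_wpM2r; [exact: ltW|rewrite ler_nat].
rewrite (_ : z - f x = (z - taylor_eval cc y ts) - (f x - taylor_eval cc y ts)); last by ring.
rewrite -/kk -/y sumE in zB.
rewrite (le_trans (ler_normB _ _))//.
have J1 : 0 <= (2 ^+ J)^-1 :> R by rewrite invr_ge0 exprn_ge0.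
have {zB} zB : `|z - taylor_eval cc y ts| <= (2 * s.+1 ^ d * (1 + s))%:R * (B * (2 ^+ J)^-1).
  apply: (le_trans zB); rewrite natrM [leRHS](_ : _ = (2 * s.+1 ^ d)%:R * B * ((1 + s)%:R * (2 ^+ J)^-1)); last by ring.
  by apply: ler_wpM2r => //; rewrite mulr_ge0.
have hb : 0 <= h `^ beta by exact: powR_ge0.
apply: (le_trans (lerD zB T)); rewrite /holder_const -/s -/h natrD.
set a := (2 * _ * _)%:R; set b := (\sum_(_ < _) _)%:R.
have a0 : 0 <= a by rewrite ler0n.
have b0 : 0 <= b by rewrite ler0n.
have p1 : 0 <= a * (B * h `^ beta) by rewrite !mulr_ge0// ltW.
have p2 : 0 <= b * (B * (2 ^+ J)^-1) by rewrite !mulr_ge0// ltW.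
move: p1 p2; rewrite -/a -/b; lra.
Qed.

End NetworkHolder.

(** * Iterated integrals *)

Ltac mproj := repeat first [exact: measurable_fst | exact: measurable_snd | exact: measurable_id
  | exact: measurable_cst | apply: (measurableT_comp measurable_fst) | apply: (measurableT_comp measurable_snd)].

(** The choice of swaps is indexed by all naturals, so that its restriction to the tail of the
    tuples is [e \o S]. *)
Definition swap_tuple {T : Type} n (e : nat -> bool) (t t' : n.-tuple T) : n.-tuple T :=
  [tuple if e i then tnth t' i else tnth t i | i < n].

Lemma swap_tuple_cons {T : Type} n e (x x' : T) (t t' : n.-tuple T) :
  swap_tuple n.+1 e (cons_tuple x t) (cons_tuple x' t') =
  cons_tuple (if e 0%N then x' else x) (swap_tuple n (e \o S) t t').
Proof.
apply: eq_from_tnth => i; rewrite tnth_mktuple.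
have [j ->|->] := unliftP ord0 i; last by rewrite !tnth0.
by rewrite !tnthS tnth_mktuple.
Qed.

Section IterInt.
Context {R : realType}.
Local Open Scope ereal_scope.

Section OneSpace.
Context {dT : measure_display} {T : measurableType dT} (P : probability T R).

Lemma iter_int_ge0 n (g : n.-tuple T -> \bar R) : (forall t, 0 <= g t) -> 0 <= iter_int P g.
Proof.
elim: n g => [|n IH] g g0 /=; first exact: g0.
by apply: integral_ge0 => x _; apply: IH.
Qed.

Lemma eq_iter_int n (g g' : n.-tuple T -> \bar R) : g =1 g' -> iter_int P g = iter_int P g'.
Proof. by move=> /funext ->. Qed.

Lemma measurable_cons_tuple dU (U : measurableType dU) n (f : U -> T) (g : U -> n.-tuple T) :
  measurable_fun setT f -> measurable_fun setT g ->
  measurable_fun setT (fun u => cons_tuple (f u) (g u)).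
Proof. exact: measurable_cons. Qed.

(** The parameter space is arbitrary because the induction moves one coordinate at a time from the
    tuple into the parameter. *)
Lemma measurable_iter_int n dU (U : measurableType dU) (g : U * n.-tuple T -> \bar R) :
  measurable_fun setT g -> (forall z, 0 <= g z) ->
  measurable_fun setT (fun u => iter_int P (fun t => g (u, t))).
Proof.
elim: n dU U g => [|n IH] dU U g mg g0 /=.
  apply: (measurableT_comp mg); apply/measurable_fun_pairP; split => /=; first exact: measurable_id.
  exact: measurable_cst.
pose F (ux : U * T) := iter_int P (fun t : n.-tuple T => g (ux.1, cons_tuple ux.2 t)).
have mF : measurable_fun setT F.
  apply: (IH _ _ (fun z : (U * T) * n.-tuple T => g (z.1.1, cons_tuple z.1.2 z.2))) => //.
  apply: (measurableT_comp mg); apply: measurable_fun_pair; first exact: measurableT_comp.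
  by apply: measurable_cons_tuple => //; exact: measurableT_comp.
apply: (measurable_fun_fubini_tonelli_F (m2 := P) F mF).
by move=> z; apply: iter_int_ge0.
Qed.

Lemma measurable_pair_cst dU (U : measurableType dU) dV (V : measurableType dV) (u : U) :
  measurable_fun setT (fun v : V => (u, v)).
Proof. by apply: measurable_fun_pair. Qed.

Lemma measurable_iter_int_cons n (g : n.+1.-tuple T -> \bar R) :
  measurable_fun setT g -> (forall z, 0 <= g z) ->
  measurable_fun setT (fun x => iter_int P (fun t : n.-tuple T => g (cons_tuple x t))).
Proof.
move=> mg g0; apply: (measurable_iter_int _ _ _ (fun z : T * n.-tuple T => g (cons_tuple z.1 z.2))) => //.
by apply: (measurableT_comp mg); exact: measurable_cons_tuple.
Qed.

Lemma measurable_cons_cst n (g : n.+1.-tuple T -> \bar R) x :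
  measurable_fun setT g -> measurable_fun setT (fun t : n.-tuple T => g (cons_tuple x t)).
Proof. by move=> mg; apply: (measurableT_comp mg); exact: measurable_cons_tuple. Qed.

Lemma le_iter_int n (g g' : n.-tuple T -> \bar R) : measurable_fun setT g ->
  measurable_fun setT g' -> (forall t, 0 <= g t) -> (forall t, g t <= g' t) ->
  iter_int P g <= iter_int P g'.
Proof.
elim: n g g' => [|n IH] g g' mg mg' g0 gg' /=; first exact: gg'.
have g'0 t : 0 <= g' t by exact: le_trans (g0 t) (gg' t).
apply: ge0_le_integral => //.
- by move=> x _; apply: iter_int_ge0.
- exact: measurable_iter_int_cons.
- exact: measurable_iter_int_cons.
- by move=> x _; apply: IH => //; exact: measurable_cons_cst.
Qed.

Lemma iter_intD n (g g' : n.-tuple T -> \bar R) : measurable_fun setT g ->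
  measurable_fun setT g' -> (forall t, 0 <= g t) -> (forall t, 0 <= g' t) ->
  iter_int P (fun t => g t + g' t) = iter_int P g + iter_int P g'.
Proof.
elim: n g g' => [//|n IH] g g' mg mg' g0 g0' /=.
rewrite -ge0_integralD//.
- by apply: eq_integral => x _; rewrite IH//; exact: measurable_cons_cst.
- by move=> x _; apply: iter_int_ge0.
- exact: measurable_iter_int_cons.
- by move=> x _; apply: iter_int_ge0.
- exact: measurable_iter_int_cons.
Qed.

Lemma iter_intZ n (g : n.-tuple T -> \bar R) (k : R) : measurable_fun setT g ->
  (forall t, 0 <= g t) -> (0 <= k)%R ->
  iter_int P (fun t => k%:E * g t) = k%:E * iter_int P g.
Proof.
elim: n g => [//|n IH] g mg g0 k0 /=.
rewrite -ge0_integralZl//.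
- by apply: eq_integral => x _; rewrite IH//; exact: measurable_cons_cst.
- exact: measurable_iter_int_cons.
- by move=> x _; apply: iter_int_ge0.
Qed.

Lemma iter_int_cst n (c : \bar R) : iter_int P (fun _ : n.-tuple T => c) = c.
Proof.
elim: n => [//|n IH] /=; under eq_integral do rewrite IH.
by rewrite integral_cst// [X in _ * X]probability_setT mule1.
Qed.

Lemma iter_int_sum n (I : Type) (r : seq I) (g : I -> n.-tuple T -> \bar R) :
  (forall i, measurable_fun setT (g i)) -> (forall i t, 0 <= g i t) ->
  iter_int P (fun t => \sum_(i <- r) g i t) = \sum_(i <- r) iter_int P (g i).
Proof.
move=> mg g0; elim: r => [|i r IH].
  by rewrite big_nil -[RHS](iter_int_cst n); apply: eq_iter_int => t; rewrite big_nil.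
rewrite big_cons -IH -iter_intD//.
- by apply: eq_iter_int => t; rewrite big_cons.
- exact: emeasurable_sum.
- by move=> t; apply: sume_ge0.
Qed.

Lemma iter_int_sum_coord n (phi : T -> R) : measurable_fun setT phi ->
  (forall x, 0 <= phi x)%R ->
  iter_int P (fun t : n.-tuple T => \sum_(i < n) (phi (tnth t i))%:E) =
  n%:R%:E * \int[P]_x (phi x)%:E.
Proof.
move=> mphi phi0; elim: n => [|n IH]; first by rewrite /= big_ord0 mul0e.
have mE : measurable_fun setT (EFin \o phi) by exact/measurable_EFinP.
have ms : measurable_fun setT (fun t : n.-tuple T => \sum_(i < n) (phi (tnth t i))%:E).
  by apply: emeasurable_sum => i; apply: (measurableT_comp mE); exact: measurable_tnth.
rewrite /= -natr1 EFinD ge0_muleDl ?lee_fin//.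
rewrite mul1e -IH addeC -[X in _ + X](@iter_int_cst 0).
rewrite -[X in _ = _ + X]mule1 -(@probability_setT _ _ _ P) /=.
rewrite -integral_cst// -ge0_integralD//; last first.
- by move=> x _; apply: iter_int_ge0 => t; apply: sume_ge0 => i _; rewrite lee_fin.
- by move=> x _; rewrite lee_fin.
apply: eq_integral => x _.
rewrite -[in RHS](iter_int_cst n (phi x)%:E) -iter_intD//; last 2 first.
- by move=> t; rewrite lee_fin.
- by move=> t; apply: sume_ge0 => i _; rewrite lee_fin.
apply: eq_iter_int => t; rewrite big_ord_recl; congr (_ + _).
by apply: eq_bigr => i _; rewrite tnthS.
Qed.

End OneSpace.

Section TwoSpaces.
Context {dT : measure_display} {T : measurableType dT} (P : probability T R).
Context {dU : measure_display} {U : measurableType dU} (Q : probability U R).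

Lemma iter_int_integralC n (g : n.-tuple T * U -> \bar R) : measurable_fun setT g ->
  (forall z, 0 <= g z) ->
  iter_int P (fun t => \int[Q]_y g (t, y)) = \int[Q]_y iter_int P (fun t => g (t, y)).
Proof.
elim: n g => [//|n IH] g mg g0 /=.
pose G (xy : T * U) := iter_int P (fun t : n.-tuple T => g (cons_tuple xy.1 t, xy.2)).
have mG : measurable_fun setT G.
  apply: (@measurable_iter_int _ _ P n _ _ (fun z : (T * U) * n.-tuple T => g (cons_tuple z.1.1 z.2, z.1.2))) => //.
  apply: (measurableT_comp mg); apply: measurable_fun_pair; last exact: measurableT_comp.
  by apply: measurable_cons_tuple => //; exact: measurableT_comp.
have G0 z : 0 <= G z by apply: iter_int_ge0.
rewrite -(fubini_tonelli (m1 := P) (m2 := Q) G mG G0); apply: eq_integral => x _.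
rewrite (IH (fun z => g (cons_tuple x z.1, z.2)))//.
apply: (measurableT_comp mg); apply: measurable_fun_pair => //.
by apply: measurable_cons_tuple.
Qed.
End TwoSpaces.

Lemma iter_intC {dT} {T : measurableType dT} (P : probability T R)
  {dU} {U : measurableType dU} (Q : probability U R) n m
  (g : n.-tuple T * m.-tuple U -> \bar R) : measurable_fun setT g -> (forall z, 0 <= g z) ->
  iter_int P (fun t => iter_int Q (fun s => g (t, s))) =
  iter_int Q (fun s => iter_int P (fun t => g (t, s))).
Proof.
elim: m g => [//|m IH] g mg g0 /=.
pose G (z : n.-tuple T * U) := iter_int Q (fun s : m.-tuple U => g (z.1, cons_tuple z.2 s)).
have mG : measurable_fun setT G.
  apply: (@measurable_iter_int _ _ Q m _ _ (fun z : (n.-tuple T * U) * m.-tuple U => g (z.1.1, cons_tuple z.1.2 z.2))) => //.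
  apply: (measurableT_comp mg); apply: measurable_fun_pair; first exact: measurableT_comp.
  by apply: measurable_cons_tuple => //; exact: measurableT_comp.
rewrite (iter_int_integralC P Q n G mG); last by move=> z; apply: iter_int_ge0.
apply: eq_integral => y _; rewrite /G /=.
rewrite (IH (fun z => g (z.1, cons_tuple y z.2)))//.
by apply: (measurableT_comp mg); apply: measurable_fun_pair => //; exact: measurable_cons_tuple.
Qed.

Section Swap.
Context {dT : measure_display} {T : measurableType dT} (P : probability T R).

Lemma measurable_swap_tuple n e dU (U : measurableType dU) (f g : U -> n.-tuple T) :
  measurable_fun setT f -> measurable_fun setT g ->
  measurable_fun setT (fun u => swap_tuple n e (f u) (g u)).
Proof.
move=> mf mg; apply/measurable_fun_tnthP => i.
rewrite (_ : _ \o _ = (fun u => if e i then tnth (g u) i else tnth (f u) i)); last first.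
  by apply/funext => u; rewrite /= tnth_mktuple.
by case: (e i); [exact: (measurableT_comp (measurable_tnth i) mg)|exact: (measurableT_comp (measurable_tnth i) mf)].
Qed.

(** [K] integrates out the tails. The induction hypothesis swaps these, and Tonelli exchanges the
    two head variables when [e 0] asks for it. *)
Lemma iter_int_swap n e (h : n.-tuple T * n.-tuple T -> \bar R) :
  measurable_fun setT h -> (forall z, 0 <= h z) ->
  iter_int P (fun t => iter_int P (fun t' => h (t, t'))) =
  iter_int P (fun t => iter_int P (fun t' => h (swap_tuple n e t t', swap_tuple n e t' t))).
Proof.
elim: n e h => [|n IH] e h mh h0.
  by rewrite /=; congr (h (_, _)); apply: eq_from_tnth => -[].
pose K (h : n.+1.-tuple T * n.+1.-tuple T -> \bar R) (z : T * T) := iter_int P (fun t : n.-tuple T =>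
  iter_int P (fun t' : n.-tuple T => h (cons_tuple z.1 t, cons_tuple z.2 t'))).
have mhc (h' : n.+1.-tuple T * n.+1.-tuple T -> \bar R) : measurable_fun setT h' ->
   measurable_fun setT (fun z : ((T * T) * n.-tuple T) * n.-tuple T =>
     h' (cons_tuple z.1.1.1 z.1.2, cons_tuple z.1.1.2 z.2)).
  move=> mh'; apply: (measurableT_comp mh'); apply: measurable_fun_pair.
    by apply: measurable_cons_tuple; mproj.
  by apply: measurable_cons_tuple; mproj.
have mK h' : measurable_fun setT h' -> (forall z, 0 <= h' z) -> measurable_fun setT (K h').
  move=> mh' h'0; apply: (@measurable_iter_int _ _ P n _ _ (fun z : (T * T) * n.-tuple T =>
    iter_int P (fun t' : n.-tuple T => h' (cons_tuple z.1.1 z.2, cons_tuple z.1.2 t')))).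
    exact: (@measurable_iter_int _ _ P n _ _ (fun z : ((T * T) * n.-tuple T) * n.-tuple T =>
     h' (cons_tuple z.1.1.1 z.1.2, cons_tuple z.1.1.2 z.2)) (mhc _ mh')).
  by move=> z; apply: iter_int_ge0.
have K0 h' z : (forall z, 0 <= h' z) -> 0 <= K h' z.
  by move=> h'0; apply: iter_int_ge0 => t; apply: iter_int_ge0.
have E h' : measurable_fun setT h' -> (forall z, 0 <= h' z) ->
   iter_int P (fun t => iter_int P (fun t' => h' (t, t'))) = \int[P]_x \int[P]_x' K h' (x, x').
  move=> mh' h'0 /=; apply: eq_integral => x _.
  rewrite -(@iter_int_integralC _ _ P _ _ P n (fun z => iter_int P (fun t' : n.-tuple T => h' (cons_tuple x z.1, cons_tuple z.2 t'))))//.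
    apply: (@measurable_iter_int _ _ P n _ _ (fun z : (n.-tuple T * T) * n.-tuple T => h' (cons_tuple x z.1.1, cons_tuple z.1.2 z.2))) => //.
    apply: (measurableT_comp mh'); apply: measurable_fun_pair.
      by apply: measurable_cons_tuple => //; exact: measurableT_comp.
    by apply: measurable_cons_tuple; mproj.
  by move=> z; apply: iter_int_ge0.
pose h' (z : n.+1.-tuple T * n.+1.-tuple T) := h (swap_tuple n.+1 e z.1 z.2, swap_tuple n.+1 e z.2 z.1).
have mh' : measurable_fun setT h'.
  apply: (measurableT_comp mh); apply: measurable_fun_pair; exact: measurable_swap_tuple.
rewrite (E _ mh h0) -[RHS]/(iter_int P (fun t => iter_int P (fun t' => h' (t, t')))).
rewrite (E _ mh'); last by move=> z; exact: h0.
have Kh' x x' : K h' (x, x') = if e 0%N then K h (x', x) else K h (x, x').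
  rewrite /K /h' /=.
  pose a := if e 0%N then x' else x; pose b := if e 0%N then x else x'.
  transitivity (K h (a, b)); last by rewrite /a /b; case: (e 0%N).
  rewrite /K /= (IH (e \o S) (fun z => h (cons_tuple a z.1, cons_tuple b z.2)))//.
    by apply: eq_iter_int => t; apply: eq_iter_int => t'; rewrite !swap_tuple_cons.
  by apply: (measurableT_comp mh); apply: measurable_fun_pair; exact: measurable_cons_tuple.
have [e0|e0] := boolP (e 0%N); last first.
  by apply: eq_integral => x _; apply: eq_integral => x' _; rewrite Kh' (negPf e0).
rewrite (fubini_tonelli (m1 := P) (m2 := P) (K h) (mK h mh h0)); last by move=> z; exact: K0.
by apply: eq_integral => x _; apply: eq_integral => x' _; rewrite Kh' e0.
Qed.
End Swap.
End IterInt.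

(** * Change of measure *)

Section Density.
Context {R : realType}.
Local Open Scope ereal_scope.

Lemma lint_ge0 k (g : k.-tuple R -> \bar R) : (forall t, 0 <= g t) -> 0 <= lint g.
Proof.
elim: k g => [|k IH] g g0 /=; first exact: g0.
by apply: integral_ge0 => x _; apply: IH.
Qed.

Lemma measurable_lint k dU (U : measurableType dU) (g : U * k.-tuple R -> \bar R) :
  measurable_fun setT g -> (forall z, 0 <= g z) ->
  measurable_fun setT (fun u => lint (fun t => g (u, t))).
Proof.
elim: k dU U g => [|k IH] dU U g mg g0 /=.
  apply: (measurableT_comp mg); apply/measurable_fun_pairP; split => /=; first exact: measurable_id.
  exact: measurable_cst.
pose F (ux : U * R) := lint (fun t : k.-tuple R => g (ux.1, cons_tuple ux.2 t)).
have mF : measurable_fun setT F.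
  apply: (IH _ _ (fun z : (U * R) * k.-tuple R => g (z.1.1, cons_tuple z.1.2 z.2))) => //.
  apply: (measurableT_comp mg); apply: measurable_fun_pair; first exact: measurableT_comp.
  by apply: measurable_cons_tuple => //; exact: measurableT_comp.
apply: (measurable_fun_fubini_tonelli_F (m2 := @lebesgue_measure R) F mF).
by move=> z; apply: lint_ge0.
Qed.

Lemma measurable_lint_cons k (g : k.+1.-tuple R -> \bar R) :
  measurable_fun setT g -> (forall z, 0 <= g z) ->
  measurable_fun setT (fun x : R => lint (fun t : k.-tuple R => g (cons_tuple x t))).
Proof.
move=> mg g0; apply: (measurable_lint _ _ _ (fun z : R * k.-tuple R => g (cons_tuple z.1 z.2))) => //.
by apply: (measurableT_comp mg); exact: measurable_cons_tuple.
Qed.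

Lemma le_lint k (g g' : k.-tuple R -> \bar R) : measurable_fun setT g ->
  measurable_fun setT g' -> (forall t, 0 <= g t) -> (forall t, g t <= g' t) ->
  lint g <= lint g'.
Proof.
elim: k g g' => [|k IH] g g' mg mg' g0 gg' /=; first exact: gg'.
have g'0 t : 0 <= g' t by exact: le_trans (g0 t) (gg' t).
apply: ge0_le_integral => //.
- by move=> x _; apply: lint_ge0.
- exact: measurable_lint_cons.
- exact: measurable_lint_cons.
- by move=> x _; apply: IH => //; exact: measurable_cons_cst.
Qed.

Lemma lintZ k (g : k.-tuple R -> \bar R) (c : R) : measurable_fun setT g ->
  (forall t, 0 <= g t) -> (0 <= c)%R -> lint (fun t => c%:E * g t) = c%:E * lint g.
Proof.
elim: k g => [//|k IH] g mg g0 c0 /=.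
rewrite -ge0_integralZl//.
- by apply: eq_integral => x _; rewrite IH//; exact: measurable_cons_cst.
- exact: measurable_lint_cons.
- by move=> x _; apply: lint_ge0.
Qed.

Lemma measurable_funVr dT (T : measurableType dT) (f : T -> R) : (forall x, 0 <= f x)%R ->
  measurable_fun setT f -> measurable_fun setT (fun x => (f x)^-1)%R.
Proof.
move=> f0 mf; rewrite (_ : (fun _ => _) = (fun y => y `^ (-1))%R \o f).
  by apply: measurableT_comp => //; exact: measurable_powR.
by apply/funext => x /=; rewrite powR_inv1.
Qed.

Section Change.
Context {d : nat} (Ps Pt : probability (d.-tuple R) R) (p q : d.-tuple R -> R).
Hypotheses (hp : has_lebesgue_density Ps p) (hq : has_lebesgue_density Pt q).
Hypothesis hsupp : forall x, (0 < q x -> 0 < p x)%R.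

Let r x := (q x / p x)%R.

Lemma density_ratio_ge0 x : (0 <= r x)%R.
Proof. by have [p0 _] := hp; have [q0 _] := hq; rewrite /r divr_ge0. Qed.

Lemma measurable_density_ratio : measurable_fun setT r.
Proof.
have [p0 [mp _]] := hp; have [q0 [mq _]] := hq.
by apply: measurable_funM => //; exact: measurable_funVr.
Qed.

Lemma density_ratioK x : (r x * p x = q x)%R.
Proof.
have [p0 _] := hp; have [q0 _] := hq; rewrite /r.
(* Where [p] vanishes the support condition forces [q] to vanish, in accordance with the convention
   0/0 = 0. *)
have [px|px] := eqVneq (p x) 0%R; last by rewrite divfK.
rewrite px mulr0; apply/eqP; rewrite eq_sym eq_le q0 andbT leNgt.
by apply/negP => /hsupp; rewrite px ltxx.
Qed.

Lemma measurable_weighted_indic (A : set (d.-tuple R)) (f : d.-tuple R -> R) :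
  measurable A -> measurable_fun setT f ->
  measurable_fun setT (fun x => ((\1_A x : R) * f x)%:E).
Proof. by move=> mA mf; apply/measurable_EFinP; exact: measurable_funM. Qed.

Lemma density_level_le (A : set (d.-tuple R)) (c : R) : measurable A -> (0 <= c)%R ->
  (forall x, A x -> r x <= c)%R -> Pt A <= c%:E * Ps A.
Proof.
have [p0 [mp pP]] := hp; have [q0 [mq qP]] := hq.
move=> mA c0 rc; rewrite pP// qP//.
have ge0 f x : (forall x, 0 <= f x)%R -> 0 <= ((\1_A x : R) * f x)%:E.
  by move=> f0; rewrite lee_fin mulr_ge0.
rewrite -lintZ//; first last.
- by move=> t; exact: ge0.
- exact: measurable_weighted_indic.
apply: le_lint => [||t|t].
- exact: measurable_weighted_indic.
- by under eq_fun do rewrite -EFinM mulrCA; apply: measurable_weighted_indic => //; exact: measurable_funM.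
- exact: ge0.
- rewrite -EFinM lee_fin mulrCA indicE; have [|tA] := boolP (t \in A); last by rewrite !mul0r.
  by rewrite inE => tA; rewrite !mul1r -(density_ratioK t) ler_wpM2r ?rc.
Qed.

Lemma density_level_ge (A : set (d.-tuple R)) (c : R) : measurable A -> (0 <= c)%R ->
  (forall x, A x -> c <= r x)%R -> c%:E * Ps A <= Pt A.
Proof.
have [p0 [mp pP]] := hp; have [q0 [mq qP]] := hq.
move=> mA c0 rc; rewrite pP// qP//.
have ge0 f x : (forall x, 0 <= f x)%R -> 0 <= ((\1_A x : R) * f x)%:E.
  by move=> f0; rewrite lee_fin mulr_ge0.
rewrite -lintZ//; first last.
- by move=> t; exact: ge0.
- exact: measurable_weighted_indic.
apply: le_lint => [||t|t].
- by under eq_fun do rewrite -EFinM mulrCA; apply: measurable_weighted_indic => //; exact: measurable_funM.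
- exact: measurable_weighted_indic.
- by apply: mule_ge0; [rewrite lee_fin|exact: ge0].
- rewrite -EFinM lee_fin mulrCA indicE; have [|tA] := boolP (t \in A); last by rewrite !mul0r.
  by rewrite inE => tA; rewrite !mul1r -(density_ratioK t) ler_wpM2r ?rc.
Qed.

(** A density is given through iterated integrals of weighted indicators, so [Ps] and [Pt] are first
    compared on sets where the ratio is nearly constant. Slicing [A] at the multiples of [e] gives
    both inequalities up to [e], and [e] is arbitrary. *)
Lemma density_measureE (A : set (d.-tuple R)) : measurable A ->
  Pt A = \int[Ps]_(x in A) (r x)%:E.
Proof.
move=> mA; have mr := measurable_density_ratio; have r0 := density_ratio_ge0.
have mrE : measurable_fun setT (fun x => (r x)%:E) by exact/measurable_EFinP.
suff key : forall e : R, (0 < e)%R -> Pt A <= \int[Ps]_(x in A) (r x)%:E + e%:E /\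
    \int[Ps]_(x in A) (r x)%:E <= Pt A + e%:E.
  by apply/eqP; rewrite eq_le; apply/andP; split; apply/lee_addgt0Pr => e /key[].
move=> e e0; pose F k := A `&` [set x | k%:R * e <= r x < k.+1%:R * e]%R.
have mF k : measurable (F k).
  apply: measurableI => //.
  rewrite (_ : [set x | _] = r @^-1` `[k%:R * e, k.+1%:R * e[%classic)%R.
    by rewrite -[X in measurable X]setTI; exact: mr.
  by apply/seteqP; split => x /=; rewrite in_itv.
have tF : trivIset setT F.
  apply/trivIsetP => i j _ _ ij; apply/seteqP; split => // x [[_ /andP[i1 i2]] [_ /andP[j1 j2]]].
  have := le_lt_trans i1 j2; have := le_lt_trans j1 i2.
  rewrite !ltr_pM2r// !ltr_nat !ltnS => ji ij'; case/eqP: ij.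
  by apply/eqP; rewrite eqn_leq ij'.
have AF : A = \bigcup_k F k.
  apply/seteqP; split => x; last by case=> k _ [].
  move=> Ax; exists (Num.truncn (r x / e)) => //; split=> //=.
  have /truncn_itv/andP[a b] : (0 <= r x / e)%R by rewrite divr_ge0// ltW.
  by rewrite -ler_pdivlMr// a /= -ltr_pdivrMr.
have e1 k : (k.+1%:R * e = k%:R * e + e)%R by rewrite -natr1 mulrDl mul1r.
have ke k : (0 <= k%:R * e)%R by rewrite mulr_ge0// ltW.
have lo k : (k%:R * e)%:E * Ps (F k) <= \int[Ps]_(x in F k) (r x)%:E.
  rewrite -integral_cst//; apply: ge0_le_integral => //.
  - by move=> x _; rewrite /cst lee_fin.
  - exact: measurable_funTS.
  - by move=> x [_ /andP[]]; rewrite /cst lee_fin.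
have hi k : \int[Ps]_(x in F k) (r x)%:E <= (k.+1%:R * e)%:E * Ps (F k).
  rewrite -integral_cst//; apply: ge0_le_integral => //.
  - by move=> x _; rewrite lee_fin.
  - exact: measurable_funTS.
  - by move=> x [_ /andP[_ /ltW]]; rewrite /cst lee_fin.
have PtA : Pt A = \sum_(0 <= k <oo) Pt (F k).
  by rewrite {1}AF measure_semi_bigcup//; exact: bigcup_measurable.
have PsA : Ps A = \sum_(0 <= k <oo) Ps (F k).
  by rewrite {1}AF measure_semi_bigcup//; exact: bigcup_measurable.
have intA : \int[Ps]_(x in A) (r x)%:E = \sum_(0 <= k <oo) \int[Ps]_(x in F k) (r x)%:E.
  rewrite {1}AF ge0_integral_bigcup//; first exact: measurable_funTS.
  by move=> x _; rewrite lee_fin.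
have PsA1 : e%:E * Ps A <= e%:E.
  by rewrite -[leRHS]mule1 lee_wpmul2l ?lee_fin ?(ltW e0)// probability_le1.
have int0 k : 0 <= \int[Ps]_(x in F k) (r x)%:E.
  by apply: integral_ge0 => x _; rewrite lee_fin.
have ePs k : 0 <= e%:E * Ps (F k) by rewrite mule_ge0 ?lee_fin// ltW.
split.
- apply: (@le_trans _ _ (\int[Ps]_(x in A) (r x)%:E + e%:E * Ps A)); last exact: leeD2l.
  rewrite intA PsA PtA -nneseriesZl// -nneseriesD//.
  apply: lee_nneseries => // k _.
  apply: (le_trans (density_level_le (F k) (k.+1%:R * e)%R (mF k) (ke _) _)).
    by move=> x [_ /andP[_ /ltW]].
  by rewrite e1 EFinD ge0_muleDl ?lee_fin ?(ltW e0)//; exact: leeD2r.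
- apply: (@le_trans _ _ (Pt A + e%:E * Ps A)); last exact: leeD2l.
  rewrite intA PsA PtA -nneseriesZl// -nneseriesD//.
  apply: lee_nneseries => // k _.
  apply: (le_trans (hi k)).
  rewrite e1 EFinD ge0_muleDl ?lee_fin ?(ltW e0)//; apply: leeD2r.
  by apply: density_level_ge => // x [_ /andP[]].
Qed.

(** By the identity on sets, [r] has the same integrals as the Radon-Nikodym derivative of [Pt] and
    so equals it almost everywhere. *)
Lemma density_integralE (h : d.-tuple R -> \bar R) : measurable_fun setT h ->
  (forall x, 0 <= h x) -> \int[Pt]_x h x = \int[Ps]_x (h x * (r x)%:E).
Proof.
move=> mh h0; have mr := measurable_density_ratio; have r0 := density_ratio_ge0.
have mrE : measurable_fun setT (fun x => (r x)%:E) by exact/measurable_EFinP.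
have dom : Pt `<< Ps.
  apply/null_content_dominatesP => A mA A0; rewrite density_measureE// null_set_integral//.
  exact: measurable_funTS.
rewrite -(@Radon_Nikodym_SigmaFinite.change_of_variables _ _ _ Pt Ps dom h setT h0 measurableT mh).
set rn := Radon_Nikodym_SigmaFinite.f _ _.
have irn : Ps.-integrable setT rn := Radon_Nikodym_SigmaFinite.f_integrable dom.
have mrn : measurable_fun setT rn by exact: measurable_int irn.
apply: ae_eq_integral => //.
- exact: emeasurable_funM.
- exact: emeasurable_funM.
apply: ae_eqe_mul2l.
apply: integral_ae_eq => // E _ mE.
by rewrite -density_measureE// -Radon_Nikodym_SigmaFinite.f_integral.
Qed.

End Change.
End Density.

(** * Symmetrization *)

Section SwapInequality.
Context {R : realType}.

Lemma expR_le_quadratic (u : R) : u <= 1 / 2 -> expR u <= 1 + u + 2 * u ^+ 2.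
Proof.
move=> u2; have u1 : 0 < 1 - u by lra.
have e1 : 1 - u <= expR (- u) by have := expR_ge1Dx (- u); lra.
rewrite -[u in expR u]opprK expRN.
apply: (@le_trans _ _ (1 - u)^-1); first by rewrite lef_pV2 ?posrE ?expR_gt0.
rewrite -[leLHS]mul1r ler_pdivrMr//.
(* [(1 + u + 2 u^2) (1 - u) = 1 + u^2 (1 - 2 u)]. *)
have : 0 <= u ^+ 2 * (1 - 2 * u) by rewrite mulr_ge0 ?sqr_ge0//; lra.
by rewrite !expr2; lra.
Qed.

(** In the sum over the two orders the linear terms [g' - g] cancel. The quadratic terms are of
    order [lam ^ 2 * (q + q')] because [g ^ 2] is controlled by [q], and for small [lam] the penalty
    [lam * b * (q + q')] outweighs them. *)
Lemma expR_swap_le2 (g g' q q' b lam G : R) : 0 <= q -> 0 <= q' -> 0 < b -> 0 <= lam ->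
  g ^+ 2 <= q / 2 -> g' ^+ 2 <= q' / 2 -> b * q <= G -> b * q' <= G ->
  lam * (8 + 4 * b * G) <= b -> lam * (`|g| + `|g'|) <= 1 / 2 ->
  expR (lam * (g' - g - b * q')) + expR (lam * (g - g' - b * q)) <= 2.
Proof.
move=> q0 q0' b0 l0 gq gq' bq bq' lb lg.
have bq0 : 0 <= b * q by rewrite mulr_ge0// ltW.
have bq0' : 0 <= b * q' by rewrite mulr_ge0// ltW.
set u := lam * _; set w := lam * _.
have gg : g' - g <= `|g| + `|g'| by have := ler_norm g'; have := ler_norm (- g); rewrite normrN; lra.
have gg' : g - g' <= `|g| + `|g'| by have := ler_norm g; have := ler_norm (- g'); rewrite normrN; lra.
have u1 : u <= 1 / 2 by apply: le_trans lg; apply: ler_wpM2l => //; lra.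
have w1 : w <= 1 / 2 by apply: le_trans lg; apply: ler_wpM2l => //; lra.
apply: (le_trans (lerD (expR_le_quadratic _ u1) (expR_le_quadratic _ w1))).
have sq (x y : R) : (x - y) ^+ 2 <= 2 * x ^+ 2 + 2 * y ^+ 2.
  by have := sqr_ge0 (x + y); rewrite !expr2; lra.
have s1 : (g' - g - b * q') ^+ 2 <= 2 * (q + q') + 2 * G * (b * q').
  apply: (le_trans (sq _ _)); have := sq g' g.
  have : (b * q') ^+ 2 <= G * (b * q') by rewrite expr2; exact: ler_wpM2r.
  by lra.
have s2 : (g - g' - b * q) ^+ 2 <= 2 * (q + q') + 2 * G * (b * q).
  apply: (le_trans (sq _ _)); have := sq g g'.
  have : (b * q) ^+ 2 <= G * (b * q) by rewrite expr2; exact: ler_wpM2r.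
  by lra.
have l2 : 0 <= lam ^+ 2 by exact: sqr_ge0.
have us : u ^+ 2 + w ^+ 2 <= lam ^+ 2 * (4 * (q + q') + 2 * G * b * (q + q')).
  rewrite /u /w !exprMn -mulrDr; apply: ler_wpM2l => //; lra.
have uw : u + w = - (lam * b * (q + q')) by rewrite /u /w; ring.
have fin : lam * (lam * (8 + 4 * b * G)) * (q + q') <= lam * b * (q + q').
  by apply: ler_wpM2r; [exact: addr_ge0|exact: ler_wpM2l].
have -> : 1 + u + 2 * u ^+ 2 + (1 + w + 2 * w ^+ 2) = 2 + (u + w) + 2 * (u ^+ 2 + w ^+ 2) by ring.
rewrite uw; move: us; rewrite (expr2 lam); move: fin; lra.
Qed.

Section Pointwise.
Context {X : Type} (F : set (X -> R)) (fstar : X -> R) (H V : R).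
Hypotheses (H0 : 0 <= H) (HV : H ^+ 2 + 1 <= V).
Hypothesis FH : forall f x, F f -> 0 <= f x <= H.
Hypothesis Fstar : F fstar.

(** The total penalty is 8 times [b] times [V] times the squared distance; with 32 it is a quarter
    of that distance and can be absorbed by the risk. In [lam], 288 is 9 times 32, and 9 bounds
    [8 + 4 * b * G]. *)
Let b : R := (32 * V)^-1.
Let lam : R := (288 * V)^-1.

(** The factors of the penalties are twice those in [(f^2 - fstar^2)^2 <= 4 H^2 (f - fstar)^2] and,
    for the target, [(2 (f - fstar))^2 = 4 (f - fstar)^2], as the hypothesis [g ^ 2 <= q / 2] of the
    swap inequality demands. Only the ghost point [x'] is penalized. *)
Definition source_dev (f : X -> R) (x' x : X) : R :=
  lam * ((f x' ^+ 2 - fstar x' ^+ 2) - (f x ^+ 2 - fstar x ^+ 2)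
         - b * (8 * H ^+ 2 * (f x' - fstar x') ^+ 2)).

Definition target_dev (f : X -> R) (y' y : X) : R :=
  lam * (- 2 * (f y' - fstar y') - (- 2 * (f y - fstar y)) - b * (8 * (f y' - fstar y') ^+ 2)).

Let V0 : 0 < V. Proof. by apply: lt_le_trans HV; rewrite ltr_wpDl ?sqr_ge0. Qed.
Let b0 : 0 < b. Proof. by rewrite /b invr_gt0 mulr_gt0. Qed.
Let lam0 : 0 < lam. Proof. by rewrite /lam invr_gt0 mulr_gt0 ?ltr0n. Qed.
Let lamV : lam * V = 1 / 288. Proof. by rewrite /lam; field; rewrite gt_eqF. Qed.
Let bV : b * V = 1 / 32. Proof. by rewrite /b; field; rewrite gt_eqF. Qed.
Let lamb : lam * 9 = b. Proof. by rewrite /lam /b; field; rewrite gt_eqF. Qed.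
Let bH : b * (H ^+ 2 + 1) <= 1 / 32. Proof. by rewrite -bV ler_wpM2l// ltW. Qed.
Let lamH : lam * (H ^+ 2 + 1) <= 1 / 288. Proof. by rewrite -lamV ler_wpM2l// ltW. Qed.

Let diffH f x : F f -> (f x - fstar x) ^+ 2 <= H ^+ 2.
Proof.
move=> Ff; have := FH _ x Ff; have := FH _ x Fstar => fs fx.
rewrite -[leLHS]real_normK ?num_real//; apply: lerXn2r; rewrite ?nnegrE ?normr_ge0//.
by rewrite ler_norml; lra.
Qed.

Lemma source_dev_swap f x x' : F f ->
  expR (source_dev f x' x) + expR (source_dev f x x') <= 2.
Proof.
move=> Ff; rewrite /source_dev.
have := FH _ x Ff; have := FH _ x' Ff; have := FH _ x Fstar; have := FH _ x' Fstar => s1 s2 f1 f2.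
have g2 y : (f y ^+ 2 - fstar y ^+ 2) ^+ 2 <= 8 * H ^+ 2 * (f y - fstar y) ^+ 2 / 2.
  have := FH _ y Ff; have := FH _ y Fstar => sy fy.
  rewrite subr_sqr exprMn; have : (f y + fstar y) ^+ 2 <= 4 * H ^+ 2.
    by rewrite (_ : 4 * H ^+ 2 = (2 * H) ^+ 2); [apply: lerXn2r; rewrite ?nnegrE; lra|ring].
  move=> h; have := sqr_ge0 (f y - fstar y).
  move=> /(ler_wpM2l)/(_ _ _ h); lra.
have gb y : `|f y ^+ 2 - fstar y ^+ 2| <= H ^+ 2.
  have := FH _ y Ff; have := FH _ y Fstar => sy fy.
  have : f y ^+ 2 <= H ^+ 2 by apply: lerXn2r; rewrite ?nnegrE; lra.
  have : fstar y ^+ 2 <= H ^+ 2 by apply: lerXn2r; rewrite ?nnegrE; lra.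
  have := sqr_ge0 (f y); have := sqr_ge0 (fstar y).
  by move=> *; rewrite ler_norml; lra.
have bq y : b * (8 * H ^+ 2 * (f y - fstar y) ^+ 2) <= (H ^+ 2 + 1) / 4.
  have H2 := sqr_ge0 H; have := diffH f y Ff => dH.
  have : H ^+ 2 * (f y - fstar y) ^+ 2 <= H ^+ 2 * (H ^+ 2 + 1).
    by apply: ler_wpM2l => //; lra.
  move=> /(ler_wpM2l (ltW b0)); have := ler_wpM2l H2 bH; lra.
apply: (@expR_swap_le2 _ _ _ _ _ _ ((H ^+ 2 + 1) / 4)) => //.
- by apply: mulr_ge0; [apply: mulr_ge0|]; rewrite ?sqr_ge0.
- by apply: mulr_ge0; [apply: mulr_ge0|]; rewrite ?sqr_ge0.
- exact: ltW.
- by have := ler_wpM2l (ltW lam0) bH; move: lamb lam0; lra.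
- have := gb x; have := gb x' => g1 g3.
  have : `|f x ^+ 2 - fstar x ^+ 2| + `|f x' ^+ 2 - fstar x' ^+ 2| <= 2 * (H ^+ 2 + 1) by lra.
  by move=> /(ler_wpM2l (ltW lam0)); move: lamH; lra.
Qed.

Lemma target_dev_swap f y y' : F f ->
  expR (target_dev f y' y) + expR (target_dev f y y') <= 2.
Proof.
move=> Ff; rewrite /target_dev.
have gb z : `|- 2 * (f z - fstar z)| <= 2 * H.
  by have := FH _ z Ff; have := FH _ z Fstar => sz fz; rewrite ler_norml; lra.
have g2 z : (- 2 * (f z - fstar z)) ^+ 2 <= 8 * (f z - fstar z) ^+ 2 / 2.
  by rewrite exprMn; lra.
have bq z : b * (8 * (f z - fstar z) ^+ 2) <= 1 / 4.
  have := ler_wpM2l (ltW b0) (diffH f z Ff); move: bH b0; lra.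
have H1 : 2 * H <= H ^+ 2 + 1 by have := sqr_ge0 (H - 1); rewrite !expr2; lra.
apply: (@expR_swap_le2 _ _ _ _ _ _ (1 / 4)) => //.
- by apply: mulr_ge0; rewrite ?sqr_ge0.
- by apply: mulr_ge0; rewrite ?sqr_ge0.
- exact: ltW.
- have b1 : b <= 1 / 32 by have := ler_wpM2l (ltW b0) (sqr_ge0 H); move: bH; lra.
  by have := ler_wpM2l (ltW lam0) b1; move: lamb lam0; lra.
- have := gb y; have := gb y' => g1 g3.
  have : `|- 2 * (f y - fstar y)| + `|- 2 * (f y' - fstar y')| <= 2 * (H ^+ 2 + 1) by lra.
  by move=> /(ler_wpM2l (ltW lam0)); move: lamH; lra.
Qed.

Lemma source_dev_close f f' x x' (e : R) : F f -> F f' -> 0 <= e ->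
  `|f x - f' x| <= e -> `|f x' - f' x'| <= e ->
  source_dev f x' x <= source_dev f' x' x + lam * (5 * H) * e.
Proof.
move=> Ff Ff' e0 d d'; rewrite /source_dev.
have := FH _ x Ff; have := FH _ x' Ff; have := FH _ x Ff'; have := FH _ x' Ff'.
have := FH _ x' Fstar => s1 f1 f2 f3 f4.
have sqd y : 0 <= f y <= H -> 0 <= f' y <= H -> `|f y - f' y| <= e -> `|f y ^+ 2 - f' y ^+ 2| <= 2 * H * e.
  move=> a1 a2 a3; rewrite subr_sqr normrM mulrC; apply: ler_pM => //.
  by rewrite ger0_norm; lra.
have := sqd x f4 f2 d; have := sqd x' f3 f1 d'; rewrite !ler_norml => q1 q2.
have q3 : (f' x' - fstar x') ^+ 2 - (f x' - fstar x') ^+ 2 <= 2 * H * e.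
  rewrite subr_sqr; apply: (le_trans (ler_norm _)); rewrite normrM mulrC; apply: ler_pM => //.
    by rewrite ler_norml; lra.
  by move: d'; rewrite !ler_norml; lra.
have q4 : b * (8 * H ^+ 2 * ((f' x' - fstar x') ^+ 2 - (f x' - fstar x') ^+ 2)) <= H * e.
  have c0 : 0 <= b * (8 * H ^+ 2) by apply: mulr_ge0; [exact: ltW|apply: mulr_ge0; rewrite ?sqr_ge0].
  have := ler_wpM2l c0 q3.
  have He : 0 <= H * e by exact: mulr_ge0.
  have := ler_wpM2r He bH; move: b0 He => /ltW bb; have := mulr_ge0 bb; move=> /(_ _) h.
  move=> He; have := h _ He; lra.
have E B : lam * B + lam * (5 * H) * e = lam * (B + 5 * H * e) by ring.
rewrite E ler_wpM2l//; first exact: ltW.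
by move: q1 q2 q4; lra.
Qed.

Lemma target_dev_close f f' y y' (e : R) : F f -> F f' -> 0 <= e ->
  `|f y - f' y| <= e -> `|f y' - f' y'| <= e ->
  target_dev f y' y <= target_dev f' y' y + lam * 5 * e.
Proof.
move=> Ff Ff' e0 d d'; rewrite /target_dev.
have := FH _ y' Ff; have := FH _ y' Ff'.
have := FH _ y' Fstar => s1 f1 f3.
have q3 : (f' y' - fstar y') ^+ 2 - (f y' - fstar y') ^+ 2 <= 2 * H * e.
  rewrite subr_sqr; apply: (le_trans (ler_norm _)); rewrite normrM mulrC; apply: ler_pM => //.
    by rewrite ler_norml; lra.
  by move: d'; rewrite !ler_norml; lra.
have H1 : 2 * H <= H ^+ 2 + 1 by have := sqr_ge0 (H - 1); rewrite !expr2; lra.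
have q4 : b * (8 * ((f' y' - fstar y') ^+ 2 - (f y' - fstar y') ^+ 2)) <= e.
  have := ler_wpM2l (ltW b0) q3; have := ler_wpM2l (ltW b0) (ler_wpM2r e0 H1).
  by have := ler_wpM2r e0 bH; lra.
have E B : lam * B + lam * 5 * e = lam * (B + 5 * e) by ring.
rewrite E ler_wpM2l//; first exact: ltW.
by move: d d' q4; rewrite !ler_norml; lra.
Qed.

(** The price, in the exponent, of replacing a function by one within 1/n of it at all points of the
    four samples. It is the origin of the factor [expR 1] next to [K]. *)
Lemma source_rate : lam * (5 * H) + lam * 5 <= 1.
Proof.
have H1 : 2 * H <= H ^+ 2 + 1 by have := sqr_ge0 (H - 1); rewrite !expr2; lra.
have := ler_wpM2l (ltW lam0) H1; have := ler_wpM2l (ltW lam0) (sqr_ge0 H).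
by move: lamH; lra.
Qed.

End Pointwise.
End SwapInequality.

(** * Averages over all swaps and the union bound *)

Section AveragedSwap.
Context {R : realType} {X : Type} {n : nat}.
Variables (F : set (X -> R)) (fstar : X -> R) (H V : R).
Hypotheses (n0 : (0 < n)%N) (H0 : 0 <= H) (HV : H ^+ 2 + 1 <= V).
Hypothesis FH : forall f x, F f -> 0 <= f x <= H.
Hypothesis Fstar : F fstar.

Definition deviation (f : X -> R) (xs xs' ys ys' : n.-tuple X) : R :=
  \sum_(i < n) source_dev fstar H V f (tnth xs' i) (tnth xs i) +
  \sum_(i < n) target_dev fstar V f (tnth ys' i) (tnth ys i).

Definition extend (e : {ffun 'I_n -> bool}) (i : nat) : bool := odflt false (omap e (insub i)).

Lemma extendE e (i : 'I_n) : extend e i = e i.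
Proof. by rewrite /extend valK. Qed.

(** The coordinates are swapped independently, so the sum over all swaps is a product over
    coordinates of two-term sums. *)
Lemma sum_expR_swap (a : X -> X -> R) (t t' : n.-tuple X) :
  (forall x x', expR (a x' x) + expR (a x x') <= 2) ->
  \sum_(e : {ffun 'I_n -> bool}) expR (\sum_(i < n)
     a (tnth (swap_tuple n (extend e) t' t) i) (tnth (swap_tuple n (extend e) t t') i)) <= 2 ^+ n.
Proof.
move=> a2; pose u (i : 'I_n) (c : bool) := if c then expR (a (tnth t i) (tnth t' i))
   else expR (a (tnth t' i) (tnth t i)).
rewrite (eq_bigr (fun e : {ffun 'I_n -> bool} => \prod_(i < n) u i (e i))); last first.
  move=> e _; rewrite (big_morph _ (@expRD R) (@expR0 R)); apply: eq_bigr => i _.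
  by rewrite !tnth_mktuple extendE /u; case: (e i).
rewrite -(bigA_distr_bigA u) -[X in _ ^+ X]card_ord -prodr_const.
apply: ler_prod => i _; rewrite big_bool /= /u addr_ge0 ?expR_ge0//=.
Qed.

(** The function may depend on the swap through [sel], as does an estimator computed from the
    swapped sample. It is replaced by the representative of its code, and the sum over all codes
    dominates whichever one occurs. *)
Lemma averaged_swap (C : finType) (code : (X -> R) -> C) (S : {set C}) (K : nat)
    (xs xs' ys ys' : n.-tuple X) (sel : {ffun 'I_n -> bool} -> {ffun 'I_n -> bool} -> X -> R) :
  (forall f, F f -> code f \in S) -> (#|S| <= K)%N ->
  (forall f f', F f -> F f' -> code f = code f' -> forall x,
     (exists i, [\/ x = tnth xs i, x = tnth xs' i, x = tnth ys i | x = tnth ys' i]) ->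
     `|f x - f' x| <= n%:R^-1) ->
  (forall e e', F (sel e e')) ->
  \sum_(e : {ffun 'I_n -> bool}) \sum_(e' : {ffun 'I_n -> bool})
    expR (deviation (sel e e') (swap_tuple n (extend e) xs xs') (swap_tuple n (extend e) xs' xs)
       (swap_tuple n (extend e') ys ys') (swap_tuple n (extend e') ys' ys))
  <= 2 ^+ n * 2 ^+ n * (K%:R * expR 1).
Proof.
move=> codeS SK close selF.
(* A code that is not attained gets [fstar], so that every representative lies in the class. *)
have /choice[rep repP] (c : C) : exists f, F f /\ ((exists2 f', F f' & code f' = c) -> code f = c).
  have [[f' Ff' fc]|nf] := pselect (exists2 f', F f' & code f' = c); first by exists f'.
  by exists fstar.
pose dv f e e' := deviation f (swap_tuple n (extend e) xs xs') (swap_tuple n (extend e) xs' xs)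
       (swap_tuple n (extend e') ys ys') (swap_tuple n (extend e') ys' ys).
have dvle e e' : expR (dv (sel e e') e e') <= expR 1 * \sum_(c in S) expR (dv (rep c) e e').
  set f := sel e e'; set c := code f.
  have Ff : F f by exact: selF.
  have [Frc /(_ (ex_intro2 _ _ f Ff erefl)) rc] := repP c.
  apply: (@le_trans _ _ (expR 1 * expR (dv (rep c) e e'))); last first.
    rewrite ler_wpM2l ?expR_ge0// (bigD1 c)/=; last exact: codeS.
    by rewrite lerDl sumr_ge0// => *; exact: expR_ge0.
  rewrite -expRD ler_expR /dv /deviation.
  have n1 : 0 <= n%:R^-1 :> R by rewrite invr_ge0.
  have fx i : [/\ `|f (tnth xs i) - rep c (tnth xs i)| <= n%:R^-1,
      `|f (tnth xs' i) - rep c (tnth xs' i)| <= n%:R^-1,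
      `|f (tnth ys i) - rep c (tnth ys i)| <= n%:R^-1 &
      `|f (tnth ys' i) - rep c (tnth ys' i)| <= n%:R^-1].
    split; apply: close => //; exists i.
    - by constructor 1.
    - by constructor 2.
    - by constructor 3.
    - by constructor 4.
  have S1 : \sum_(i < n) source_dev fstar H V f (tnth (swap_tuple n (extend e) xs' xs) i)
       (tnth (swap_tuple n (extend e) xs xs') i) <=
     \sum_(i < n) (source_dev fstar H V (rep c) (tnth (swap_tuple n (extend e) xs' xs) i)
       (tnth (swap_tuple n (extend e) xs xs') i) + (288 * V)^-1 * (5 * H) * n%:R^-1).
    apply: ler_sum => i _; have [a1 a2 _ _] := fx i; rewrite !tnth_mktuple.
    by apply: (source_dev_close F) => //; case: (extend e i).
  have S2 : \sum_(i < n) target_dev fstar V f (tnth (swap_tuple n (extend e') ys' ys) i)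
       (tnth (swap_tuple n (extend e') ys ys') i) <=
     \sum_(i < n) (target_dev fstar V (rep c) (tnth (swap_tuple n (extend e') ys' ys) i)
       (tnth (swap_tuple n (extend e') ys ys') i) + (288 * V)^-1 * 5 * n%:R^-1).
    apply: ler_sum => i _; have [_ _ a1 a2] := fx i; rewrite !tnth_mktuple.
    by apply: (target_dev_close F _ H) => //; case: (extend e' i).
  apply: (le_trans (lerD S1 S2)); rewrite !big_split /= !sumr_const !card_ord.
  have nn : n%:R * n%:R^-1 = 1 :> R by rewrite divff// pnatr_eq0 -lt0n.
  rewrite -[_ *+ n]mulr_natr -[X in _ + (_ + X)]mulr_natr -!mulrA ![_^-1 * n%:R]mulrC nn !mulr1.
  by have := source_rate H V HV; rewrite !mulrA; lra.
apply: (@le_trans _ _ (\sum_(e : {ffun 'I_n -> bool}) \sum_(e' : {ffun 'I_n -> bool})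
   expR 1 * \sum_(c in S) expR (dv (rep c) e e'))).
  by apply: ler_sum => e _; apply: ler_sum => e' _; exact: dvle.
under eq_bigr do rewrite -mulr_sumr exchange_big /=.
rewrite -mulr_sumr exchange_big /=.
rewrite [leRHS](_ : _ = expR 1 * (K%:R * (2 ^+ n * 2 ^+ n))); last by ring.
apply: ler_wpM2l; first exact: expR_ge0.
apply: (@le_trans _ _ (\sum_(c in S) 2 ^+ n * 2 ^+ n)); last first.
  rewrite sumr_const -[leLHS]mulr_natl; apply: ler_wpM2r; last by rewrite ler_nat.
  by rewrite mulr_ge0// exprn_ge0.
apply: ler_sum => c _; have [Fc _] := repP c.
have h1 := @sum_expR_swap (source_dev fstar H V (rep c)) xs xs' (fun x x' => source_dev_swap F fstar H V H0 HV FH Fstar (rep c) x x' Fc).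
have h2 := @sum_expR_swap (target_dev fstar V (rep c)) ys ys' (fun x x' => target_dev_swap F fstar H V H0 HV FH Fstar (rep c) x x' Fc).
apply: le_trans (ler_pM _ _ h1 h2); rewrite ?sumr_ge0//; try by move=> *; exact: expR_ge0.
rewrite mulr_suml; apply: ler_sum => e _; rewrite mulr_sumr; apply: ler_sum => e' _.
by rewrite /dv /deviation expRD.
Qed.
End AveragedSwap.

(** * Expectations over a pair of samples and over a ghost pair *)

Section Iter2.
Context {R : realType}.
Local Open Scope ereal_scope.

Section General.
Context {d1 d2} {T1 : measurableType d1} {T2 : measurableType d2}.
Variables (P : probability T1 R) (Q : probability T2 R) (n : nat).
Local Notation TT := (n.-tuple T1 * n.-tuple T2)%type.

Definition iter2 (h : TT -> \bar R) : \bar R :=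
  iter_int P (fun t => iter_int Q (fun s => h (t, s))).

Lemma iter2_ge0 h : (forall z, 0 <= h z) -> 0 <= iter2 h.
Proof. by move=> h0; apply: iter_int_ge0 => t; apply: iter_int_ge0. Qed.

Lemma measurable_iter2_inner h : measurable_fun setT h -> (forall z, 0 <= h z) ->
  measurable_fun setT (fun t : n.-tuple T1 => iter_int Q (fun s : n.-tuple T2 => h (t, s))).
Proof. by move=> mh h0; exact: (@measurable_iter_int _ _ _ Q n _ _ h). Qed.

Lemma measurable_pairl (h : TT -> \bar R) t : measurable_fun setT h ->
  measurable_fun setT (fun s : n.-tuple T2 => h (t, s)).
Proof. by move=> mh; apply: (measurableT_comp mh); exact: measurable_pair_cst. Qed.

Lemma measurable_iter2 dU (U : measurableType dU) (h : U * TT -> \bar R) :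
  measurable_fun setT h -> (forall z, 0 <= h z) ->
  measurable_fun setT (fun u : U => iter2 (fun z => h (u, z))).
Proof.
move=> mh h0; apply: (@measurable_iter_int _ _ _ P n _ _ (fun z : U * n.-tuple T1 =>
   iter_int Q (fun s => h (z.1, (z.2, s))))); last by move=> z; apply: iter_int_ge0.
apply: (@measurable_iter_int _ _ _ Q n _ _ (fun z : (U * n.-tuple T1) * n.-tuple T2 => h (z.1.1, (z.1.2, z.2)))) => //.
apply: (measurableT_comp mh); apply: measurable_fun_pair; first by mproj.
by apply: measurable_fun_pair; mproj.
Qed.

Lemma le_iter2 h h' : measurable_fun setT h -> measurable_fun setT h' ->
  (forall z, 0 <= h z) -> (forall z, h z <= h' z) -> iter2 h <= iter2 h'.
Proof.
move=> mh mh' h0 hh'; have h'0 z : 0 <= h' z by exact: le_trans (h0 z) (hh' z).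
apply: le_iter_int.
- exact: measurable_iter2_inner.
- exact: measurable_iter2_inner.
- by move=> t; apply: iter_int_ge0.
- by move=> t; apply: le_iter_int => //; exact: measurable_pairl.
Qed.

Lemma iter2D h h' : measurable_fun setT h -> measurable_fun setT h' ->
  (forall z, 0 <= h z) -> (forall z, 0 <= h' z) ->
  iter2 (fun z => h z + h' z) = iter2 h + iter2 h'.
Proof.
move=> mh mh' h0 h'0; rewrite /iter2 -iter_intD.
- by apply: eq_iter_int => t; rewrite -iter_intD//; exact: measurable_pairl.
- exact: measurable_iter2_inner.
- exact: measurable_iter2_inner.
- by move=> t; apply: iter_int_ge0.
- by move=> t; apply: iter_int_ge0.
Qed.

Lemma iter2Z h (k : R) : measurable_fun setT h -> (forall z, 0 <= h z) -> (0 <= k)%R ->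
  iter2 (fun z => k%:E * h z) = k%:E * iter2 h.
Proof.
move=> mh h0 k0; rewrite /iter2 -iter_intZ//.
- by apply: eq_iter_int => t; rewrite -iter_intZ//; exact: measurable_pairl.
- exact: measurable_iter2_inner.
- by move=> t; apply: iter_int_ge0.
Qed.

Lemma iter2_cst c : iter2 (fun=> c) = c.
Proof. by rewrite /iter2 -[RHS](iter_int_cst P n); apply: eq_iter_int => t; rewrite iter_int_cst. Qed.

Lemma iter2_sum (I : Type) (r : seq I) (h : I -> TT -> \bar R) :
  (forall i, measurable_fun setT (h i)) -> (forall i z, 0 <= h i z) ->
  iter2 (fun z => \sum_(i <- r) h i z) = \sum_(i <- r) iter2 (h i).
Proof.
move=> mh h0; rewrite /iter2 -iter_int_sum.
- by apply: eq_iter_int => t; rewrite -iter_int_sum// => i; exact: measurable_pairl.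
- by move=> i; exact: measurable_iter2_inner.
- by move=> i t; apply: iter_int_ge0.
Qed.

Lemma iter2_sum_coord (a : T1 -> R) (b : T2 -> R) : measurable_fun setT a ->
  measurable_fun setT b -> (forall x, 0 <= a x)%R -> (forall x, 0 <= b x)%R ->
  iter2 (fun z => (\sum_(i < n) a (tnth z.1 i) + \sum_(i < n) b (tnth z.2 i))%:E) =
  n%:R%:E * (\int[P]_x (a x)%:E + \int[Q]_x (b x)%:E).
Proof.
move=> ma mb a0 b0; pose A (t : n.-tuple T1) := \sum_(i < n) (a (tnth t i))%:E.
pose B (s : n.-tuple T2) := \sum_(i < n) (b (tnth s i))%:E.
have mA : measurable_fun setT A.
  by apply: emeasurable_sum => i; apply/measurable_EFinP; apply: (measurableT_comp ma); exact: measurable_tnth.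
have mB : measurable_fun setT B.
  by apply: emeasurable_sum => i; apply/measurable_EFinP; apply: (measurableT_comp mb); exact: measurable_tnth.
have A0 t : 0 <= A t by apply: sume_ge0 => i _; rewrite lee_fin.
have B0 t : 0 <= B t by apply: sume_ge0 => i _; rewrite lee_fin.
transitivity (iter2 (fun z => A z.1 + B z.2)).
  by congr iter2; apply/funext => z; rewrite EFinD -!sumEFin.
rewrite iter2D//; last 2 first.
- exact: measurableT_comp.
- exact: measurableT_comp.
rewrite /iter2 /= iter_int_sum_coord// iter_int_cst.
rewrite (eq_iter_int P n _ A) => [|t]; last by rewrite iter_int_cst.
rewrite iter_int_sum_coord// [RHS]ge0_muleDr//.
- by apply: integral_ge0 => x _; rewrite lee_fin.
- by apply: integral_ge0 => x _; rewrite lee_fin.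
Qed.

End General.

Section Symmetrization.
Context {dT} {T : measurableType dT} (Ps Pt : probability T R) (n : nat).
Local Notation tup := (n.-tuple T).

(* Swapping coordinates between a sample and an independent copy of it does not change
   the joint law, so a bound on the average over all swaps bounds the expectation. *)
Lemma symmetrization (Theta : (tup * tup) * (tup * tup) -> \bar R) (K : R) :
  (0 <= K)%R -> measurable_fun setT Theta -> (forall z, 0 <= Theta z) ->
  (forall xs xs' ys ys', \sum_(e : {ffun 'I_n -> bool}) \sum_(e' : {ffun 'I_n -> bool})
     Theta ((swap_tuple n (extend e) xs xs', swap_tuple n (extend e') ys ys'),
            (swap_tuple n (extend e) xs' xs, swap_tuple n (extend e') ys' ys))
     <= (2 ^+ n * 2 ^+ n * K)%:E) ->
  iter2 Ps Pt n (fun z => iter2 Ps Pt n (fun z' => Theta (z, z'))) <= K%:E.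
Proof.
move=> K0 mT T0 TK.
pose I4 (Th : (tup * tup) * (tup * tup) -> \bar R) :=
  iter2 Ps Ps n (fun x => iter2 Pt Pt n (fun y => Th (x, y))).
pose Th0 (z : (tup * tup) * (tup * tup)) := Theta ((z.1.1, z.2.1), (z.1.2, z.2.2)).
have mTh0 : measurable_fun setT Th0.
  apply: (measurableT_comp mT); apply: measurable_fun_pair; apply: measurable_fun_pair; mproj.
(* Tonelli puts each sample next to its ghost, since only variables of the same law may be
   swapped. *)
have E1 : iter2 Ps Pt n (fun z => iter2 Ps Pt n (fun z' => Theta (z, z'))) = I4 Th0.
  rewrite /I4 {1}/iter2 {3}/iter2; apply: eq_iter_int => xs.
  rewrite {1}/iter2 -(@iter_intC _ _ _ Ps _ _ Pt n n (fun z : tup * tup => iter_int Pt (fun ys' : tup => Theta ((xs, z.2), (z.1, ys')))))//.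
    apply: (@measurable_iter_int _ _ _ Pt n _ _ (fun z : (tup * tup) * tup => Theta ((xs, z.1.2), (z.1.1, z.2)))) => //.
    by apply: (measurableT_comp mT); apply: measurable_fun_pair; apply: measurable_fun_pair; mproj.
  by move=> z; apply: iter_int_ge0.
rewrite E1.
pose sw (e e' : {ffun 'I_n -> bool}) (z : (tup * tup) * (tup * tup)) : (tup * tup) * (tup * tup) :=
  ((swap_tuple n (extend e) z.1.1 z.1.2, swap_tuple n (extend e) z.1.2 z.1.1),
   (swap_tuple n (extend e') z.2.1 z.2.2, swap_tuple n (extend e') z.2.2 z.2.1)).
have msw e e' : measurable_fun setT (sw e e').
  by apply: measurable_fun_pair; apply: measurable_fun_pair; apply: measurable_swap_tuple; mproj.
have swE e e' : I4 Th0 = I4 (Th0 \o sw e e').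
  rewrite /I4 /iter2 (@iter_int_swap _ _ _ Ps n (extend e) (fun x => iter2 Pt Pt n (fun y => Th0 (x, y)))); last 2 first.
  - by apply: (@measurable_iter2 _ _ _ _ Pt Pt n _ _ Th0) => // z; exact: T0.
  - by move=> z; apply: iter2_ge0 => y; exact: T0.
  apply: eq_iter_int => xs; apply: eq_iter_int => xs'.
  rewrite {1}/iter2 (@iter_int_swap _ _ _ Pt n (extend e') (fun y => Th0 ((swap_tuple n (extend e) xs xs', swap_tuple n (extend e) xs' xs), y)))//.
    by apply: (measurableT_comp mTh0); exact: measurable_pair_cst.
  by move=> z; exact: T0.
pose card2 := #|{ffun 'I_n -> bool}|.
have I4sum : \sum_(e : {ffun 'I_n -> bool}) \sum_(e' : {ffun 'I_n -> bool}) I4 (Th0 \o sw e e') =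
    I4 (fun z => \sum_(e : {ffun 'I_n -> bool}) \sum_(e' : {ffun 'I_n -> bool}) (Th0 \o sw e e') z).
  have mTs e e' : measurable_fun setT (Th0 \o sw e e') by exact: measurableT_comp.
  have Ts0 e e' z : 0 <= (Th0 \o sw e e') z by exact: T0.
  have mTe e : measurable_fun setT (fun z => \sum_(e' : {ffun 'I_n -> bool}) (Th0 \o sw e e') z).
    by apply: emeasurable_sum => e'; exact: mTs.
  have Te0 e z : 0 <= \sum_(e' : {ffun 'I_n -> bool}) (Th0 \o sw e e') z by apply: sume_ge0 => e' _; exact: Ts0.
  have I4s (g : {ffun 'I_n -> bool} -> (tup * tup) * (tup * tup) -> \bar R) :
      (forall e, measurable_fun setT (g e)) -> (forall e z, 0 <= g e z) ->
      \sum_(e : {ffun 'I_n -> bool}) I4 (g e) = I4 (fun z => \sum_(e : {ffun 'I_n -> bool}) g e z).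
    move=> mg g0; rewrite /I4 -iter2_sum.
    - congr iter2; apply/funext => x; rewrite -iter2_sum//.
      by move=> e; apply: (measurableT_comp (mg e)); exact: measurable_pair_cst.
    - by move=> e; apply: (@measurable_iter2 _ _ _ _ Pt Pt n _ _ (g e)).
    - by move=> e z; apply: iter2_ge0.
  by rewrite -I4s//; apply: eq_bigr => e _; rewrite -I4s.
have card_ffun2 : card2 = (2 ^ n)%N by rewrite /card2 card_ffun card_bool card_ord.
have sumc (x : \bar R) : \sum_(e : {ffun 'I_n -> bool}) x = (2 ^+ n)%:E * x.
  rewrite big_const -/card2 card_ffun2 -natrX; elim: (2 ^ n)%N => [|m IH]; first by rewrite mul0e.
  by rewrite iterS IH -natr1 addrC EFinD ge0_muleDl ?lee_fin// mul1e.
have : (2 ^+ n * 2 ^+ n)%:E * I4 Th0 <= (2 ^+ n * 2 ^+ n * K)%:E.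
  rewrite EFinM -muleA -sumc -sumc.
  rewrite (eq_bigr (fun e => \sum_(e' : {ffun 'I_n -> bool}) I4 (Th0 \o sw e e'))); last first.
    by move=> e _; apply: eq_bigr => e' _; exact: swE.
  rewrite I4sum -[leRHS](@iter2_cst _ _ _ _ Ps Ps n).
  rewrite [leRHS](_ : _ = I4 (fun=> (2 ^+ n * 2 ^+ n * K)%:E)); last first.
    by rewrite /I4; congr iter2; apply/funext => z; rewrite iter2_cst.
  have mS : measurable_fun setT (fun z => \sum_(e : {ffun 'I_n -> bool}) \sum_(e' : {ffun 'I_n -> bool}) (Th0 \o sw e e') z).
    by apply: emeasurable_sum => e; apply: emeasurable_sum => e'; exact: (measurableT_comp mTh0 (msw e e')).
  have S0 z : 0 <= \sum_(e : {ffun 'I_n -> bool}) \sum_(e' : {ffun 'I_n -> bool}) (Th0 \o sw e e') z.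
    by apply: sume_ge0 => e _; apply: sume_ge0 => e' _; exact: T0.
  rewrite /I4; apply: le_iter2.
  - apply: (@measurable_iter2 _ _ _ _ Pt Pt n _ _ (fun z => \sum_(e : {ffun 'I_n -> bool}) \sum_(e' : {ffun 'I_n -> bool}) (Th0 \o sw e e') z)) => //.
  - by under eq_fun do rewrite iter2_cst; exact: measurable_cst.
  - by move=> x; apply: iter2_ge0.
  - move=> x; apply: le_iter2 => //.
    + by apply: (measurableT_comp mS); exact: measurable_pair_cst.
    + by move=> y; exact: TK.
rewrite [in X in _ <= X]EFinM lee_pmul2l// lte_fin mulr_gt0// exprn_gt0//.
Qed.
End Symmetrization.
End Iter2.

(** * Oracle inequality *)

Section HasInt.
Context {R : realType} {dT : measure_display} {T : measurableType dT}.
Implicit Types (P : probability T R) (h : T -> R).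

(** Bundling measurability, sign and a real value of the integral lets identities between integrals
    be settled by linear arithmetic over the reals. *)
Definition has_int P h (a : R) :=
  [/\ measurable_fun setT h, forall x, 0 <= h x & (\int[P]_x (h x)%:E)%E = a%:E].

Lemma has_int_ge0 P h a : has_int P h a -> 0 <= a.
Proof. by move=> [_ h0 E]; rewrite -lee_fin -E integral_ge0// => x _; rewrite lee_fin. Qed.

Lemma has_int_eq P h h' a a' : has_int P h a -> has_int P h' a' -> h =1 h' -> a = a'.
Proof.
move=> [_ _ E] [_ _ E'] /funext hh'; apply: EFin_inj.
by rewrite -E -E' hh'.
Qed.

Lemma has_int_le P h h' a a' : has_int P h a -> has_int P h' a' ->
  (forall x, h x <= h' x) -> a <= a'.
Proof.
move=> [mh h0 E] [mh' h'0 E'] hh'; rewrite -lee_fin -E -E'.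
apply: ge0_le_integral => //.
- by move=> x _; rewrite lee_fin.
- exact/measurable_EFinP.
- exact/measurable_EFinP.
- by move=> x _; rewrite lee_fin.
Qed.

Lemma has_intD P h h' a a' : has_int P h a -> has_int P h' a' ->
  has_int P (fun x => h x + h' x) (a + a').
Proof.
move=> [mh h0 E] [mh' h'0 E']; split.
- exact: measurable_funD.
- by move=> x; exact: addr_ge0.
rewrite EFinD -E -E' -ge0_integralD//.
- by move=> x _; rewrite lee_fin.
- exact/measurable_EFinP.
- by move=> x _; rewrite lee_fin.
- exact/measurable_EFinP.
Qed.

Lemma has_intZ P h a k : 0 <= k -> has_int P h a -> has_int P (fun x => k * h x) (k * a).
Proof.
move=> k0 [mh h0 E]; split.
- exact: measurable_funM.
- by move=> x; exact: mulr_ge0.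
rewrite EFinM -E -ge0_integralZl//.
- exact/measurable_EFinP.
- by move=> x _; rewrite lee_fin.
Qed.

Lemma has_int_cst P (c : R) : 0 <= c -> has_int P (fun=> c) c.
Proof.
by move=> c0; split=> //; rewrite integral_cst// [X in (_ * X)%E]probability_setT mule1.
Qed.

Lemma has_int_dominated P h g a : measurable_fun setT h -> (forall x, 0 <= h x) ->
  has_int P g a -> (forall x, h x <= g x) -> exists2 b, has_int P h b & b <= a.
Proof.
move=> mh h0 [mg g0 E] hg.
have le : (\int[P]_x (h x)%:E <= a%:E)%E.
  rewrite -E; apply: ge0_le_integral => //.
  - by move=> x _; rewrite lee_fin.
  - exact/measurable_EFinP.
  - exact/measurable_EFinP.
  - by move=> x _; rewrite lee_fin.
have ge : (0 <= \int[P]_x (h x)%:E)%E by apply: integral_ge0 => x _; rewrite lee_fin.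
have fin : (\int[P]_x (h x)%:E)%E \is a fin_num.
  by rewrite ge0_fin_numE// (le_lt_trans le)// ltry.
exists (fine (\int[P]_x (h x)%:E)%E); first by split=> //; rewrite fineK.
by rewrite -lee_fin fineK.
Qed.

Lemma has_int_bounded P h c : measurable_fun setT h -> (forall x, 0 <= h x <= c) ->
  exists2 a, has_int P h a & a <= c.
Proof.
move=> mh hc; have c0 : 0 <= c by have /andP[] := hc point; exact: le_trans.
by apply: (has_int_dominated _ _ _ _ mh _ (has_int_cst P c c0)) => x; case/andP: (hc x).
Qed.

End HasInt.

(** [v] is the risk of the estimator and [A] that of the comparison network. From
    [D <= 2 * v + 2 * A] the penalty [D / 4] costs at most half of [v], which moves to the left-hand
    side; hence the factor 3. *)
Lemma risk_arith {R : realType} (tau A D Y1 Y2 Y3 tt s0 s1 t0 t1 v rho X1 X2 : R) :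
  0 <= tau -> 0 <= A -> 0 <= D -> tt <= tau / 4 -> Y1 <= Y2 -> Y3 + Y2 = D / 4 + tt ->
  s1 + 2 * t0 <= s0 + Y3 + (2 * t1 + Y1) + (X1 + X2) ->
  v + 2 * t1 = s1 + rho -> A + 2 * t0 = s0 + rho -> D <= 2 * v + 2 * A ->
  v <= 3 * A + tau + 2 * X1 + 2 * X2.
Proof. lra. Qed.

Section Oracle.
Context {R : realType} {dT : measure_display} {T : measurableType dT}.
Variables (Ps Pt : probability T R) (n : nat) (r : T -> R).
Variables (F : set (T -> R)) (fstar : T -> R) (H Th tau A rho : R) (K : nat).
Hypotheses (n0 : (0 < n)%N) (H0 : 0 <= H) (Th1 : 1 <= Th) (tau0 : 0 <= tau).
Hypotheses (mr : measurable_fun setT r) (r0 : forall x, 0 <= r x).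
Hypothesis change : forall h : T -> \bar R, measurable_fun setT h -> (forall x, (0 <= h x)%E) ->
  (\int[Pt]_x h x = \int[Ps]_x (h x * (r x)%:E))%E.
Hypothesis r2 : has_int Ps (fun x => r x ^+ 2) rho.
Hypothesis mF : forall f, F f -> measurable_fun setT f.
Hypothesis FH : forall f x, F f -> 0 <= f x <= H.
Hypothesis Fstar : F fstar.
Hypothesis tail : forall f, F f -> (\int[Ps]_x (r x * (f x - fstar x) ^+ 2)%:E <=
  Th%:E * \int[Ps]_x ((f x - fstar x) ^+ 2)%:E + tau%:E)%E.
Hypothesis riskA : has_int Ps (fun x => (r x - fstar x) ^+ 2) A.

(** [H ^+ 2] weighs the source penalty. [Th] is the price of moving the target penalty to the source
    side. *)
Let V : R := H ^+ 2 + Th.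
Let b : R := (32 * V)^-1.
Let lam : R := (288 * V)^-1.
Let K' : R := K%:R * expR 1.

Let V1 : 1 <= V. Proof. by rewrite /V; have := sqr_ge0 H; move: Th1; lra. Qed.
Let V0 : 0 < V. Proof. exact: lt_le_trans ltr01 V1. Qed.

Lemma measurable_sqr (h : T -> R) : measurable_fun setT h -> measurable_fun setT (fun x => h x ^+ 2).
Proof. by move=> mh; exact: measurable_funX. Qed.

(** Expand the square; by the change of measure the cross term is an integral over the target. The
    identity is written without subtraction because every integral here is of a nonnegative
    function. *)
Lemma risk_identity f : F f -> exists v s t : R,
  [/\ has_int Ps (fun x => (r x - f x) ^+ 2) v, has_int Ps (fun x => f x ^+ 2) s,
      has_int Pt f t & v + 2 * t = s + rho].
Proof.
move=> Ff; have mf := mF _ Ff.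
have [s sP _] : exists2 s, has_int Ps (fun x => f x ^+ 2) s & s <= H ^+ 2.
  apply: has_int_bounded; first exact: measurable_sqr.
  by move=> x; rewrite sqr_ge0 lerXn2r// ?nnegrE//; case/andP: (FH _ x Ff).
have [t tP _] := has_int_bounded Pt f H mf (fun x => FH _ x Ff).
have [v vP _] : exists2 v, has_int Ps (fun x => (r x - f x) ^+ 2) v & v <= 2 * rho + 2 * s.
  apply: has_int_dominated (has_intD _ _ _ _ _ (has_intZ _ _ _ 2 _ r2) (has_intZ _ _ _ 2 _ sP)) _ => //.
  - by apply: measurable_sqr; exact: measurable_funB.
  - by move=> x; exact: sqr_ge0.
  - by move=> x; have := sqr_ge0 (r x + f x); rewrite !expr2; lra.
exists v, s, t; split=> //.
have frP : has_int Ps (fun x => f x * r x) t.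
  have [_ f0 tE] := tP; split.
  - exact: measurable_funM.
  - by move=> x; exact: mulr_ge0.
  - rewrite -tE (change (fun x => (f x)%:E)).
    + by under eq_integral do rewrite EFinM.
    + exact/measurable_EFinP.
    + by move=> x; rewrite lee_fin.
apply: (has_int_eq Ps _ _ _ _ (has_intD _ _ _ _ _ vP (has_intZ _ _ _ 2 _ frP)) (has_intD _ _ _ _ _ sP r2)) => // x.
by ring.
Qed.

(** The sample is fixed and a pointwise inequality is integrated over the ghost sample, which turns
    ghost sums into expectations. The criterion enters with the favourable sign because [f] does at
    least as well as [fstar] on the sample. *)
Lemma risk_le_ghost f (xs ys : n.-tuple T) : F f -> (0 < K)%N ->
  \sum_(i < n) f (tnth xs i) ^+ 2 - 2 * \sum_(i < n) f (tnth ys i) <=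
  \sum_(i < n) fstar (tnth xs i) ^+ 2 - 2 * \sum_(i < n) fstar (tnth ys i) ->
  (\int[Ps]_x ((r x - f x) ^+ 2)%:E <=
   (3 * A + tau + 576 * V / n%:R * (ln K%:R + 1))%:E +
   (576 * V / n%:R / K')%:E *
     iter2 Ps Pt n (fun z => (expR (deviation fstar H V f xs z.1 ys z.2))%:E))%E.
Proof.
move=> Ff K0 crit; have mf := mF _ Ff; have mfs := mF _ Fstar.
have b0 : 0 < b by rewrite invr_gt0 mulr_gt0.
have lam0 : 0 < lam by rewrite invr_gt0 mulr_gt0 ?ltr0n.
have nR : 0 < n%:R :> R by rewrite ltr0n.
have K'0 : 0 < K' by rewrite mulr_gt0 ?ltr0n ?expR_gt0.
have K1 : 0 <= ln (K%:R : R) by rewrite ln_ge0// ler1n.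
have lnK' : ln K' = ln K%:R + 1.
  by rewrite lnM ?posrE ?ltr0n ?expR_gt0// expRK.
have c0 : 0 < 576 * V / n%:R / K' by rewrite !divr_gt0 ?mulr_gt0 ?ltr0n.
have [v [s1 [t1 [vP s1P t1P E1]]]] := risk_identity f Ff.
have [v' [s0 [t0 [v'P s0P t0P E2]]]] := risk_identity fstar Fstar.
have vA : v' = A by exact: (has_int_eq Ps _ _ _ _ v'P riskA).
have mD : measurable_fun setT (fun x => (f x - fstar x) ^+ 2).
  by apply: measurable_sqr; exact: measurable_funB.
have Db x : 0 <= (f x - fstar x) ^+ 2 <= H ^+ 2.
  rewrite sqr_ge0 -[leLHS]real_normK ?num_real//; apply: lerXn2r; rewrite ?nnegrE ?normr_ge0//.
  by have := FH _ x Ff; have := FH _ x Fstar; rewrite ler_norml; lra.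
have [D DP _] := has_int_bounded Ps _ _ mD Db.
have [Dt DtP _] := has_int_bounded Pt _ _ mD Db.
have E3 : D <= 2 * v + 2 * A.
  rewrite -vA; apply: (has_int_le Ps _ _ _ _ DP (has_intD _ _ _ _ _ (has_intZ _ _ _ 2 _ vP) (has_intZ _ _ _ 2 _ v'P))) => // x.
  by have := sqr_ge0 ((r x - f x) + (r x - fstar x)); rewrite !expr2; lra.
have E4 : Dt <= Th * D + tau.
  have [_ _ DE] := DP; have [_ _ DtE] := DtP.
  rewrite -lee_fin EFinD EFinM -DE; apply: le_trans (tail f Ff).
  rewrite -DtE (change (fun x => ((f x - fstar x) ^+ 2)%:E)); last 2 first.
  - exact/measurable_EFinP.
  - by move=> x; rewrite lee_fin sqr_ge0.
  by under eq_integral do rewrite -EFinM mulrC.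
have D0 := has_int_ge0 _ _ _ DP; have A0 := has_int_ge0 _ _ _ riskA.
set W := iter2 _ _ _ _; have W0 : (0 <= W)%E by apply: iter2_ge0 => z; rewrite lee_fin expR_ge0.
have [_ _ vE] := vP; rewrite vE.
have [->|Wfin] := eqVneq W +oo%E.
  by rewrite gt0_muley ?lte_fin// addey// leey.
have {Wfin} Wfin : W \is a fin_num by rewrite ge0_fin_numE// ltey.
pose w := fine W; have wE : W = w%:E by rewrite fineK.
have w0 : 0 <= w by rewrite -lee_fin -wE.
have ghost : lam * n%:R * (s1 + 2 * t0) <=
    lam * n%:R * (s0 + 8 * b * (H ^+ 2 * D) + (2 * t1 + 8 * b * Dt)) + ln K' + w / K'.
  (* The deviation is signed; its ghost terms are distributed over two sides so that only
     nonnegative functions are integrated. *)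
  pose aL x := lam * f x ^+ 2; pose bL y := lam * (2 * fstar y).
  pose aR x := lam * (fstar x ^+ 2 + 8 * b * (H ^+ 2 * (f x - fstar x) ^+ 2)).
  pose bR y := lam * (2 * f y + 8 * b * (f y - fstar y) ^+ 2).
  have l0 := ltW lam0; have b8 : 0 <= 8 * b by rewrite mulr_ge0// ltW.
  have aLP : has_int Ps aL (lam * s1) by exact: has_intZ.
  have bLP : has_int Pt bL (lam * (2 * t0)) by apply: has_intZ => //; exact: has_intZ.
  have aRP : has_int Ps aR (lam * (s0 + 8 * b * (H ^+ 2 * D))).
    apply: has_intZ => //; apply: has_intD => //; apply: has_intZ => //.
    by apply: has_intZ => //; exact: sqr_ge0.
  have bRP : has_int Pt bR (lam * (2 * t1 + 8 * b * Dt)).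
    by apply: has_intZ => //; apply: has_intD; exact: has_intZ.
  have [maL aL0 aLE] := aLP; have [mbL bL0 bLE] := bLP.
  have [maR aR0 aRE] := aRP; have [mbR bR0 bRE] := bRP.
  pose sL (z : n.-tuple T * n.-tuple T) := \sum_(i < n) aL (tnth z.1 i) + \sum_(i < n) bL (tnth z.2 i).
  pose sR (z : n.-tuple T * n.-tuple T) := \sum_(i < n) aR (tnth z.1 i) + \sum_(i < n) bR (tnth z.2 i).
  have LE : iter2 Ps Pt n (fun z => (sL z)%:E) = (lam * n%:R * (s1 + 2 * t0))%:E.
    by rewrite iter2_sum_coord// aLE bLE -EFinD -EFinM; congr EFin; ring.
  have RE : iter2 Ps Pt n (fun z => (sR z)%:E) =
      (lam * n%:R * (s0 + 8 * b * (H ^+ 2 * D) + (2 * t1 + 8 * b * Dt)))%:E.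
    by rewrite iter2_sum_coord// aRE bRE -EFinD -EFinM; congr EFin; ring.
  have msum (a c : T -> R) : measurable_fun setT a -> measurable_fun setT c ->
      measurable_fun setT (fun z : n.-tuple T * n.-tuple T =>
        \sum_(i < n) a (tnth z.1 i) + \sum_(i < n) c (tnth z.2 i)).
    move=> ma mc; apply: measurable_funD; apply: measurable_sum => i.
      apply: (measurableT_comp ma); exact: (measurableT_comp (measurable_tnth i) measurable_fst).
    apply: (measurableT_comp mc); exact: (measurableT_comp (measurable_tnth i) measurable_snd).
  have sL0 z : 0 <= sL z by rewrite addr_ge0// sumr_ge0.
  have sR0 z : 0 <= sR z by rewrite addr_ge0// sumr_ge0.
  have msL : measurable_fun setT (fun z => (sL z)%:E) by apply/measurable_EFinP; exact: msum.
  have msR : measurable_fun setT (fun z => (sR z)%:E) by apply/measurable_EFinP; exact: msum.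
  have mdev : measurable_fun setT (fun z : n.-tuple T * n.-tuple T =>
      (expR (deviation fstar H V f xs z.1 ys z.2))%:E).
    apply/measurable_EFinP; apply: measurableT_comp => //; rewrite /deviation.
    pose a1 (i : 'I_n) x := source_dev fstar H V f x (tnth xs i).
    pose a2 (i : 'I_n) x := target_dev fstar V f x (tnth ys i).
    have m1 i : measurable_fun setT (a1 i).
      rewrite /a1 /source_dev; apply: measurable_funM => //; apply: measurable_funB.
        by apply: measurable_funB => //; apply: measurable_funB; exact: measurable_sqr.
      by apply: measurable_funM => //; exact: measurable_funM.
    have m2 i : measurable_fun setT (a2 i).
      rewrite /a2 /target_dev; apply: measurable_funM => //; apply: measurable_funB.
        by apply: measurable_funB => //; apply: measurable_funM => //; exact: measurable_funB.
      by apply: measurable_funM => //; exact: measurable_funM.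
    apply: measurable_funD; apply: measurable_sum => i.
      apply: (measurableT_comp (m1 i)); exact: (measurableT_comp (measurable_tnth i) measurable_fst).
    apply: (measurableT_comp (m2 i)); exact: (measurableT_comp (measurable_tnth i) measurable_snd).
  have e0 z : (0 <= (expR (deviation fstar H V f xs z.1 ys z.2))%:E)%E by rewrite lee_fin expR_ge0.
  have lnK0 : 0 <= ln K' by rewrite lnK'; lra.
  have pw z : ((sL z)%:E <= ((sR z)%:E + (ln K')%:E) +
      K'^-1%:E * (expR (deviation fstar H V f xs z.1 ys z.2))%:E)%E.
    rewrite -EFinM -!EFinD lee_fin; set dev := deviation _ _ _ _ _ _ _ _.
    have devE : dev = sL z - sR z + lam * ((\sum_(i < n) fstar (tnth xs i) ^+ 2 - 2 * \sum_(i < n) fstar (tnth ys i))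
        - (\sum_(i < n) f (tnth xs i) ^+ 2 - 2 * \sum_(i < n) f (tnth ys i))).
      have d1 : \sum_(i < n) source_dev fstar H V f (tnth z.1 i) (tnth xs i) =
          \sum_(i < n) aL (tnth z.1 i) - \sum_(i < n) aR (tnth z.1 i) +
          lam * (\sum_(i < n) fstar (tnth xs i) ^+ 2 - \sum_(i < n) f (tnth xs i) ^+ 2).
        rewrite -!sumrB mulr_sumr -big_split /=; apply: eq_bigr => i _.
        by rewrite /source_dev -/b -/lam /aL /aR; ring.
      have d2 : \sum_(i < n) target_dev fstar V f (tnth z.2 i) (tnth ys i) =
          \sum_(i < n) bL (tnth z.2 i) - \sum_(i < n) bR (tnth z.2 i) +
          lam * (2 * \sum_(i < n) f (tnth ys i) - 2 * \sum_(i < n) fstar (tnth ys i)).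
        rewrite !mulr_sumr -!sumrB mulr_sumr -big_split /=; apply: eq_bigr => i _.
        by rewrite /target_dev -/b -/lam /bL /bR; ring.
      by rewrite /dev /deviation d1 d2 /sL /sR; ring.
    (* Linearizing the exponential at [ln K'] bounds the deviation itself, so no logarithm of an
       integral has to be taken. *)
    have ed : dev - ln K' <= K'^-1 * expR dev.
      have -> : K'^-1 * expR dev = expR (dev - ln K').
        by rewrite expRB lnK ?posrE// mulrC.
      by have := expR_ge1Dx (dev - ln K'); lra.
    have : 0 <= lam * ((\sum_(i < n) fstar (tnth xs i) ^+ 2 - 2 * \sum_(i < n) fstar (tnth ys i))
        - (\sum_(i < n) f (tnth xs i) ^+ 2 - 2 * \sum_(i < n) f (tnth ys i))).
      by rewrite mulr_ge0// subr_ge0.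
    by move: devE ed; lra.
  have mdev' : measurable_fun setT (fun z : n.-tuple T * n.-tuple T =>
      K'^-1%:E * (expR (deviation fstar H V f xs z.1 ys z.2))%:E)%E.
    by apply: emeasurable_funM.
  have mR1 : measurable_fun setT (fun z => (sR z)%:E + (ln K')%:E)%E by exact: emeasurable_funD.
  have R10 z : (0 <= (sR z)%:E + (ln K')%:E)%E by rewrite -EFinD lee_fin addr_ge0.
  have d0 z : (0 <= K'^-1%:E * (expR (deviation fstar H V f xs z.1 ys z.2))%:E)%E.
    by rewrite mule_ge0// lee_fin invr_ge0 ltW.
  have := le_iter2 Ps Pt n _ _ msL (emeasurable_funD mR1 mdev') (fun z => sL0 z) pw.
  rewrite LE (iter2D Ps Pt n _ _ mR1 mdev' R10 d0).
  rewrite (iter2D Ps Pt n _ (fun=> (ln K')%:E) msR) //.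
  rewrite (iter2Z Ps Pt n _ _ mdev e0) ?iter2_cst; last by rewrite invr_ge0 ltW.
  by rewrite RE -/W wE -EFinM -!EFinD lee_fin [K'^-1 * w]mulrC.
rewrite wE -EFinM -EFinD lee_fin.
have bV : b * V = 1 / 32 by rewrite /b; field; rewrite gt_eqF.
have lV : (lam * n%:R)^-1 = 288 * V / n%:R by rewrite /lam; field; rewrite !gt_eqF.
have ln0 : 0 < lam * n%:R by rewrite mulr_gt0.
have gX : s1 + 2 * t0 <= s0 + 8 * b * (H ^+ 2 * D) + (2 * t1 + 8 * b * Dt) + 288 * V / n%:R * (ln K' + w / K').
  rewrite -(ler_pM2l ln0) -lV; apply: (le_trans ghost); rewrite [leRHS]mulrDr mulVKf ?gt_eqF//.
  by rewrite -[leLHS]addrA.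
have E5 : 8 * b * Dt <= 8 * b * (Th * D + tau) by apply: ler_wpM2l => //; rewrite mulr_ge0// ltW.
have E6 : 8 * b * (H ^+ 2 * D) + 8 * b * (Th * D + tau) = D / 4 + 8 * (b * tau).
  have -> : 8 * b * (H ^+ 2 * D) + 8 * b * (Th * D + tau) = 8 * (b * V) * D + 8 * (b * tau) by rewrite /V; ring.
  by rewrite bV; field.
have E7 : b * tau <= 1 / 32 * tau.
  apply: ler_wpM2r => //; rewrite -bV -[leLHS]mulr1; apply: ler_wpM2l => //; exact: ltW.
have -> : 576 * V / n%:R / K' * w = 2 * (288 * V / n%:R * (w / K')) by field; rewrite !gt_eqF.
have -> : 576 * V / n%:R * (ln K%:R + 1) = 2 * (288 * V / n%:R * ln K') by rewrite lnK'; ring.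
have {}E7 : 8 * (b * tau) <= tau / 4 by move: E7; lra.
move: gX E1 E2 E3; rewrite vA [288 * V / n%:R * _]mulrDr.
set X1 := 288 * V / n%:R * ln K'; set X2 := 288 * V / n%:R * (w / K').
move: E5 E6; set Y1 := 8 * b * Dt; set Y2 := 8 * b * (Th * D + tau); set Y3 := 8 * b * (H ^+ 2 * D).
move: E7; exact: (risk_arith tau A D Y1 Y2 Y3 (8 * (b * tau)) s0 s1 t0 t1 v rho X1 X2 tau0 A0 D0).
Qed.


Lemma measurable_deviation (f fs : (n.-tuple T * n.-tuple T) * T -> R) : measurable_fun setT f -> measurable_fun setT fs ->
  measurable_fun setT (fun w : (n.-tuple T * n.-tuple T) * (n.-tuple T * n.-tuple T) =>
    deviation (fun x => fs (w.1, x)) H V (fun x => f (w.1, x)) w.1.1 w.2.1 w.1.2 w.2.2).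
Proof.
move=> mf mfs; rewrite /deviation.
have m1 (h : (n.-tuple T * n.-tuple T) * T -> R) (i : 'I_n) (g : (n.-tuple T * n.-tuple T) * (n.-tuple T * n.-tuple T) -> n.-tuple T) :
  measurable_fun setT h -> measurable_fun setT g -> measurable_fun setT (fun w => h (w.1, tnth (g w) i)).
  move=> mh mg; apply: (measurableT_comp mh); apply: measurable_fun_pair; first exact: measurable_fst.
  exact: (measurableT_comp (measurable_tnth i) mg).
have p1 : measurable_fun setT (fun w : (n.-tuple T * n.-tuple T) * (n.-tuple T * n.-tuple T) => w.1.1) by mproj.
have p2 : measurable_fun setT (fun w : (n.-tuple T * n.-tuple T) * (n.-tuple T * n.-tuple T) => w.1.2) by mproj.
have p3 : measurable_fun setT (fun w : (n.-tuple T * n.-tuple T) * (n.-tuple T * n.-tuple T) => w.2.1) by mproj.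
have p4 : measurable_fun setT (fun w : (n.-tuple T * n.-tuple T) * (n.-tuple T * n.-tuple T) => w.2.2) by mproj.
apply: measurable_funD; apply: measurable_sum => i.
  rewrite /source_dev; apply: measurable_funM => //; apply: measurable_funB.
    by apply: measurable_funB; apply: measurable_funB; apply: measurable_funX; exact: m1.
  by apply: measurable_funM => //; apply: measurable_funM => //; apply: measurable_funX; apply: measurable_funB; exact: m1.
rewrite /target_dev; apply: measurable_funM => //; apply: measurable_funB.
  by apply: measurable_funB; apply: measurable_funM => //; apply: measurable_funB; exact: m1.
by apply: measurable_funM => //; apply: measurable_funM => //; apply: measurable_funX; apply: measurable_funB; exact: m1.
Qed.

(** Integrating over the sample as well, symmetrization bounds the mean of the exponential by [K'],
    which cancels the division by [K']. This adds one more [576 * V / n] and turns [ln K + 1] into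
    [ln K + 2]. *)
Lemma expected_risk (est : n.-tuple T -> n.-tuple T -> T -> R)
    (C : finType) (code : n.-tuple T -> n.-tuple T -> n.-tuple T -> n.-tuple T -> (T -> R) -> C)
    (S : n.-tuple T -> n.-tuple T -> n.-tuple T -> n.-tuple T -> {set C}) : (0 < K)%N ->
  measurable_fun setT (fun z : (n.-tuple T * n.-tuple T) * T => est z.1.1 z.1.2 z.2) ->
  (forall xs ys, F (est xs ys)) ->
  (forall xs ys, \sum_(i < n) est xs ys (tnth xs i) ^+ 2 - 2 * \sum_(i < n) est xs ys (tnth ys i) <=
    \sum_(i < n) fstar (tnth xs i) ^+ 2 - 2 * \sum_(i < n) fstar (tnth ys i)) ->
  (forall xs xs' ys ys' f, F f -> code xs xs' ys ys' f \in S xs xs' ys ys') ->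
  (forall xs xs' ys ys', #|S xs xs' ys ys'| <= K)%N ->
  (forall xs xs' ys ys' f f', F f -> F f' -> code xs xs' ys ys' f = code xs xs' ys ys' f' -> forall x,
     (exists i, [\/ x = tnth xs i, x = tnth xs' i, x = tnth ys i | x = tnth ys' i]) ->
     `|f x - f' x| <= n%:R^-1) ->
  (iter2 Ps Pt n (fun z => \int[Ps]_x ((r x - est z.1 z.2 x) ^+ 2)%:E) <=
   (3 * A + tau + 576 * V / n%:R * (ln K%:R + 2))%:E)%E.
Proof.
move=> K0 mest estF crit codeS SK close.
have HV : H ^+ 2 + 1 <= V by rewrite lerD2l.
have nR : 0 < n%:R :> R by rewrite ltr0n.
have K'0 : 0 < K' by rewrite mulr_gt0 ?ltr0n ?expR_gt0.
have K1 : 0 <= ln (K%:R : R) by rewrite ln_ge0// ler1n.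
have c0 : 0 < 576 * V / n%:R / K' by rewrite !divr_gt0 ?mulr_gt0 ?ltr0n.
have A0 := has_int_ge0 _ _ _ riskA.
pose Theta (w : (n.-tuple T * n.-tuple T) * (n.-tuple T * n.-tuple T)) : \bar R :=
  (expR (deviation fstar H V (est w.1.1 w.1.2) w.1.1 w.2.1 w.1.2 w.2.2))%:E.
have mTheta : measurable_fun setT Theta.
  apply/measurable_EFinP; apply: measurableT_comp => //.
  apply: (measurable_deviation _ (fun z => fstar z.2) mest).
  exact: (measurableT_comp (mF _ Fstar) measurable_snd).
have Theta0 w : (0 <= Theta w)%E by rewrite lee_fin expR_ge0.
have symm := symmetrization Ps Pt n Theta K' (ltW K'0) mTheta Theta0.
have {}symm : (iter2 Ps Pt n (fun z => iter2 Ps Pt n (fun z' => Theta (z, z'))) <= K'%:E)%E.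
  apply: symm => xs xs' ys ys'.
  under eq_bigr do rewrite sumEFin.
  rewrite sumEFin lee_fin.
  (* The estimator is recomputed on every swapped sample; this is the selection to which the
     averaged inequality is applied. *)
  exact: (averaged_swap F fstar H V n0 H0 HV FH Fstar C (code xs xs' ys ys') (S xs xs' ys ys') K
    xs xs' ys ys' (fun e e' => est (swap_tuple n (extend e) xs xs') (swap_tuple n (extend e') ys ys'))
    (codeS _ _ _ _) (SK _ _ _ _) (close _ _ _ _)).
pose c1 : R := 3 * A + tau + 576 * V / n%:R * (ln K%:R + 1).
have c10 : 0 <= c1.
  apply: addr_ge0; first by rewrite addr_ge0 ?mulr_ge0.
  by rewrite mulr_ge0 ?addr_ge0 ?divr_ge0 ?mulr_ge0 ?ler0n ?(ltW V0).
have mI : measurable_fun setT (fun z => iter2 Ps Pt n (fun z' => Theta (z, z'))).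
  exact: (@measurable_iter2 _ _ _ _ _ Ps Pt n _ _ Theta).
have I0 z : (0 <= iter2 Ps Pt n (fun z' => Theta (z, z')))%E by exact: iter2_ge0.
apply: (@le_trans _ _ (iter2 Ps Pt n (fun z => c1%:E + (576 * V / n%:R / K')%:E * iter2 Ps Pt n (fun z' => Theta (z, z')))%E)).
  apply: le_iter2.
  - apply: (measurable_fun_fubini_tonelli_F (m2 := Ps) (fun z => ((r z.2 - est z.1.1 z.1.2 z.2) ^+ 2)%:E)).
      apply/measurable_EFinP; apply: measurable_funX; apply: measurable_funB => //.
      exact: (measurableT_comp mr measurable_snd).
    by move=> z; rewrite lee_fin sqr_ge0.
  - by apply: emeasurable_funD => //; exact: emeasurable_funM.
  - by move=> z; apply: integral_ge0 => x _; rewrite lee_fin sqr_ge0.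
  - by move=> z; exact: (risk_le_ghost _ _ _ (estF _ _) K0 (crit _ _)).
have mKI : measurable_fun setT (fun z => (576 * V / n%:R / K')%:E * iter2 Ps Pt n (fun z' => Theta (z, z')))%E.
  by apply: emeasurable_funM.
have KI0 z : (0 <= (576 * V / n%:R / K')%:E * iter2 Ps Pt n (fun z' => Theta (z, z')))%E.
  by apply: mule_ge0; [rewrite lee_fin ltW|exact: I0].
have c1E (z : n.-tuple T * n.-tuple T) : (0 <= c1%:E)%E by rewrite lee_fin.
rewrite (iter2D Ps Pt n (fun=> c1%:E) _ (measurable_cst _) mKI c1E KI0).
rewrite (iter2Z Ps Pt n _ _ mI I0 (ltW c0)) iter2_cst.
have h := lee_wpmul2l (ltW c0 : (0 <= (576 * V / n%:R / K')%:E)%E) symm.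
apply: (le_trans (leeD2l _ h)).
rewrite -EFinM -EFinD lee_fin mulfVK ?gt_eqF//.
by rewrite /c1 le_eqVlt; apply/orP; left; apply/eqP; ring.
Qed.

End Oracle.

Section RealIntegral.
Context {R : realType} {dT : measure_display} {T : measurableType dT}.
Variable P : probability T R.

Lemma integral_EFinZ (h : T -> R) (k : R) : measurable_fun setT h -> (forall x, 0 <= h x) -> 0 <= k ->
  (\int[P]_x (k * h x)%:E = k%:E * \int[P]_x (h x)%:E)%E.
Proof.
move=> mh h0 k0; rewrite -ge0_integralZl//.
- exact/measurable_EFinP.
- by move=> x _; rewrite lee_fin.
Qed.

Lemma integral_EFinD (h h' : T -> R) : measurable_fun setT h -> (forall x, 0 <= h x) ->
  measurable_fun setT h' -> (forall x, 0 <= h' x) ->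
  (\int[P]_x (h x + h' x)%:E = \int[P]_x (h x)%:E + \int[P]_x (h' x)%:E)%E.
Proof.
move=> mh h0 mh' h'0; rewrite -ge0_integralD//.
- by move=> x _; rewrite lee_fin.
- exact/measurable_EFinP.
- by move=> x _; rewrite lee_fin.
- exact/measurable_EFinP.
Qed.

Lemma le_integral_EFin (h h' : T -> R) : measurable_fun setT h -> measurable_fun setT h' ->
  (forall x, 0 <= h x) -> (forall x, h x <= h' x) -> (\int[P]_x (h x)%:E <= \int[P]_x (h' x)%:E)%E.
Proof.
move=> mh mh' h0 hh'; apply: ge0_le_integral => //.
- by move=> x _; rewrite lee_fin.
- exact/measurable_EFinP.
- exact/measurable_EFinP.
- by move=> x _; rewrite lee_fin.
Qed.

Lemma measurable_indic_lt (h : T -> R) (c : R) : measurable_fun setT h ->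
  measurable_fun setT (fun x => (c < h x)%R%:R : R).
Proof.
move=> mh; rewrite (_ : (fun _ => _) = fun x => if c < h x then 1 else 0).
  apply: measurable_fun_ifT => //; exact: measurable_fun_ltr.
by apply/funext => x; case: (c < h x).
Qed.

End RealIntegral.

(** * The oracle inequality for the network class *)

Section Network.
Context {R : realType}.

Lemma measurable_network d L M (lo hi : R) f : @F_NN R d L M lo hi f -> measurable_fun setT f.
Proof.
move=> [dims [w [b [dims0 [_ [fE _]]]]]].
have mact k j : measurable_fun setT (fun x : d.-tuple R => act dims w b (val x) k j).
  elim: k j => [|k IH] j /=.
    have [jd|jd] := ltnP j d.
      rewrite (_ : (fun _ => _) = fun x => tnth x (Ordinal jd)); first exact: measurable_tnth.
      by apply/funext => x; rewrite (tnth_nth 0).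
    rewrite (_ : (fun _ => _) = cst 0); first exact: measurable_cst.
    by apply/funext => x; rewrite nth_default// size_tuple.
  apply: (@measurable_maxr _ _ R setT (fun x : d.-tuple R => preact dims w b (act dims w b (val x) k) k.+1 j) (fun=> 0)) => //.
  by apply: measurable_funD => //; apply: measurable_sum => l; exact: measurable_funM.
rewrite (_ : f = fun x : d.-tuple R => preact dims w b (act dims w b (val x) L) L.+1 0).
  by apply: measurable_funD => //; apply: measurable_sum => l; exact: measurable_funM.
by apply/funext => x; rewrite fE nn_evalE.
Qed.

(** If [a - b > 1/n], the first multiple of [1/n] above [b] is still below [a], and it is one of the
    thresholds because these reach up to [H]. *)
Lemma eq_level_close (n T : nat) (H a b : R) : (0 < n)%N -> H * n%:R <= T%:R ->
  0 <= a <= H -> 0 <= b <= H ->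
  (forall t : 'I_T, (t%:R / n%:R <= a) = (t%:R / n%:R <= b)) -> `|a - b| <= n%:R^-1.
Proof.
move=> n0 HT; have nR : 0 < n%:R :> R by rewrite ltr0n.
wlog ab : a b / b <= a => [hw aH bH ts|aH bH ts].
  have [h|h] := leP b a; first exact: hw.
  by rewrite distrC; apply: hw => //; exact: ltW.
rewrite ger0_norm ?subr_ge0// leNgt; apply/negP => gap.
have na0 : 0 <= n%:R * b by rewrite mulr_ge0//; case/andP: bH.
have /andP[k1 k2] := truncn_itv na0; set k := Num.truncn _ in k1 k2.
have kb : b < k.+1%:R / n%:R by rewrite ltr_pdivlMr// mulrC.
have ka : k.+1%:R / n%:R < a.
  rewrite ltr_pdivrMr// -natr1; apply: (@le_lt_trans _ _ (n%:R * b + 1)); first by rewrite lerD2r.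
  have : n%:R * n%:R^-1 < n%:R * (a - b) by rewrite ltr_pM2l.
  by rewrite divff ?gt_eqF// mulrBr; lra.
have kT : (k.+1 < T)%N.
  rewrite -(ltr_nat R); apply: lt_le_trans HT.
  by rewrite -ltr_pdivrMr//; apply: lt_le_trans ka _; case/andP: aH.
by have := ts (Ordinal kT); rewrite /= (ltW ka) leNgt kb.
Qed.

Section Risk.
Context {d : nat} (Ps Pt : probability (d.-tuple R) R) (p q : d.-tuple R -> R).
Hypotheses (hp : has_lebesgue_density Ps p) (hq : has_lebesgue_density Pt q).
Hypothesis hsupp : forall x, 0 < q x -> 0 < p x.
Local Notation r := (fun x => q x / p x).
Variables (n L M T : nat) (H Th eps A rho : R).
Hypotheses (n0 : (0 < n)%N) (dM : (d <= M)%N) (H0 : 0 <= H) (Th1 : 1 <= Th) (eps0 : 0 <= eps).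
Hypothesis HT : H * n%:R <= T%:R.
Hypothesis r2 : has_int Ps (fun x => r x ^+ 2) rho.
Hypothesis tail : (\int[Ps]_x (r x * (Th < r x)%R%:R)%:E <= eps%:E)%E.
Local Notation F := (@F_NN R d L M 0 H).

(** Where the ratio is at most [Th] it is replaced by [Th]; elsewhere the squared difference is at
    most [H ^+ 2] and the tail of the ratio is left. *)
Lemma network_tail f f' : F f -> F f' ->
  (\int[Ps]_x (r x * (f x - f' x) ^+ 2)%:E <=
   Th%:E * \int[Ps]_x ((f x - f' x) ^+ 2)%:E + (H ^+ 2 * eps)%:E)%E.
Proof.
move=> Ff Ff'; have mr := measurable_density_ratio Ps Pt p q hp hq.
have r0 x := density_ratio_ge0 Ps Pt p q hp hq x.
have mf := measurable_network _ _ _ _ _ _ Ff; have mf' := measurable_network _ _ _ _ _ _ Ff'.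
have mD : measurable_fun setT (fun x => (f x - f' x) ^+ 2).
  by apply: measurable_funX; exact: measurable_funB.
have mtail : measurable_fun setT (fun x => r x * (Th < r x)%R%:R).
  apply: measurable_funM => //; exact: measurable_indic_lt.
have Dle x : (f x - f' x) ^+ 2 <= H ^+ 2.
  have [_ [_ [_ [_ [_ [_ /(_ x) f1]]]]]] := Ff.
  have [_ [_ [_ [_ [_ [_ /(_ x) f2]]]]]] := Ff'.
  rewrite -[leLHS]real_normK ?num_real//; apply: lerXn2r; rewrite ?nnegrE ?normr_ge0//.
  by rewrite ler_norml; lra.
have t0 x : 0 <= r x * (Th < r x)%R%:R by rewrite mulr_ge0.
have Th0 : 0 <= Th by exact: le_trans ler01 Th1.
have D0 x : 0 <= (f x - f' x) ^+ 2 by exact: sqr_ge0.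
have H20 := sqr_ge0 H.
apply: (@le_trans _ _ (\int[Ps]_x (Th * (f x - f' x) ^+ 2 + H ^+ 2 * (r x * (Th < r x)%R%:R))%:E)%E).
  apply: le_integral_EFin => [||x|x].
  - exact: measurable_funM.
  - by apply: measurable_funD; exact: measurable_funM.
  - exact: mulr_ge0.
  - have [Tr|rT] := ltP Th (r x).
      rewrite mulr1; apply: ler_wpDl; first exact: mulr_ge0.
      by rewrite mulrC; apply: ler_wpM2r.
    by rewrite !mulr0 addr0; apply: ler_wpM2r.
have := integral_EFinD Ps (fun x => Th * (f x - f' x) ^+ 2) (fun x => H ^+ 2 * (r x * (Th < r x)%R%:R)).
move=> ->; last 4 first.
- exact: measurable_funM.
- by move=> x; exact: mulr_ge0.
- exact: measurable_funM.
- by move=> x; exact: mulr_ge0.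
rewrite (integral_EFinZ Ps _ _ mD D0 Th0) (integral_EFinZ Ps _ _ mtail t0 H20).
by apply: leeD => //; rewrite EFinM; apply: (@lee_wpmul2l _ (H ^+ 2)%:E _ _ _ tail); rewrite lee_fin.
Qed.

Lemma ls_critE (xs ys : n.-tuple (d.-tuple R)) f :
  \sum_(i < n) f (tnth xs i) ^+ 2 - 2 * \sum_(i < n) f (tnth ys i) = n%:R * ls_crit xs ys f.
Proof.
have nR : n%:R != 0 :> R by rewrite pnatr_eq0 -lt0n.
by rewrite /ls_crit mulrBr mulVKf// mulrA mulrCA divff// mulr1.
Qed.

Lemma network_expected_risk fstar (est : n.-tuple (d.-tuple R) -> n.-tuple (d.-tuple R) -> d.-tuple R -> R) :
  F fstar -> has_int Ps (fun x => (r x - fstar x) ^+ 2) A ->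
  measurable_fun setT (fun z : (n.-tuple (d.-tuple R) * n.-tuple (d.-tuple R)) * d.-tuple R => est z.1.1 z.1.2 z.2) ->
  (forall xs ys, F (est xs ys) /\ forall f, F f -> ls_crit xs ys (est xs ys) <= ls_crit xs ys f) ->
  (iter2 Ps Pt n (fun z => \int[Ps]_x ((r x - est z.1 z.2 x) ^+ 2)%:E) <=
   (3 * A + H ^+ 2 * eps + 576 * (H ^+ 2 + Th) / n%:R *
      (ln (capacity L M (n + (n + (n + n))) T)%:R + 2))%:E)%E.
Proof.
move=> Fs As mest estP.
have [mr r0] := (measurable_density_ratio Ps Pt p q hp hq, density_ratio_ge0 Ps Pt p q hp hq).
have change := density_integralE Ps Pt p q hp hq hsupp.
have FH f x : F f -> 0 <= f x <= H by case=> [_ [_ [_ [_ [_ [_ h]]]]]].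
pose N := (n + (n + (n + n)))%N.
pose z (xs xs' ys ys' : n.-tuple (d.-tuple R)) (i : 'I_N) : d.-tuple R :=
  tnth [tuple of xs ++ (xs' ++ (ys ++ ys'))] i.
pose t (i : 'I_T) : R := i%:R / n%:R.
pose code xs xs' ys ys' (f : d.-tuple R -> R) : {ffun 'I_N * 'I_T -> bool} :=
  [ffun i => t i.2 <= f (z xs xs' ys ys' i.1)].
pose S xs xs' ys ys' : {set {ffun 'I_N * 'I_T -> bool}} :=
  finset (fun c => `[< exists2 f, F f & c = code xs xs' ys ys' f >]).
apply: (expected_risk Ps Pt n r F fstar H Th (H ^+ 2 * eps) A rho _ n0 H0 Th1 _ mr r0 change r2 _ FH Fs _ As
  est _ code S) => //.
- by rewrite mulr_ge0// sqr_ge0.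
- by move=> f; exact: measurable_network.
- by move=> f Ff; exact: network_tail.
- rewrite /capacity muln_gt0 !expn_gt0 /=; lia.
- by move=> xs ys; case: (estP xs ys).
- move=> xs ys; rewrite !ls_critE; have [_ /(_ _ Fs)] := estP xs ys.
  by rewrite ler_pM2l ?ltr0n.
- by move=> xs xs' ys ys' f Ff; rewrite inE; apply/asboolP; exists f.
- move=> xs xs' ys ys'; apply: (card_threshold_patterns d L M M 0 H N T (z xs xs' ys ys') t) => //.
  move=> s; rewrite inE => /asboolP[f Ff ->]; exists f => // i; by rewrite ffunE.
- move=> xs xs' ys ys' f f' Ff Ff' /ffunP ff' x [i xi].
  have [j ->] : exists j, x = z xs xs' ys ys' j.
    apply/tnthP; rewrite /= !mem_cat.
    by case: xi => ->; rewrite mem_tnth ?orbT.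
  apply: (eq_level_close n T H) => //; try exact: FH.
  by move=> k; have := ff' (j, k); rewrite !ffunE.
Qed.

End Risk.
End Network.

(** * Truncation *)

Section Tails.
Context {R : realType}.

Lemma exprn_le_expR (k : nat) (y : R) : (0 < k)%N -> 0 <= y -> y ^+ k <= k%:R ^+ k * expR y.
Proof.
move=> k0 y0; have kR : 0 < k%:R :> R by rewrite ltr0n.
have -> : y = k%:R * (y / k%:R) by rewrite mulrC divfK ?gt_eqF.
have yk0 : 0 <= y / k%:R by rewrite divr_ge0// ltW.
rewrite exprMn ler_wpM2l ?exprn_ge0//.
rewrite expRM_natl; apply: lerXn2r; rewrite ?nnegrE ?expR_ge0//.
by have := expR_ge1Dx (y / k%:R); lra.
Qed.

Lemma exprn_le_expRM (k : nat) (s y : R) : (0 < k)%N -> 0 < s -> 0 <= y ->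
  y ^+ k <= (k%:R / s) ^+ k * expR (s * y).
Proof.
move=> k0 s0 y0; have -> : y ^+ k = s^-1 ^+ k * (s * y) ^+ k.
  by rewrite -exprMn mulKf ?gt_eqF.
rewrite [(k%:R / s) ^+ k]exprMn [_ ^+ k * s^-1 ^+ k]mulrC -mulrA.
by apply: ler_wpM2l; [rewrite exprn_ge0// invr_ge0 ltW|rewrite exprn_le_expR// mulr_ge0// ltW].
Qed.

(** Half of the exponent pays for the power of [y], the other half for the factor decaying in
    [c]. *)
Lemma exprn_tail_le (k : nat) (s c y : R) : (0 < k)%N -> 0 < s -> 0 <= y ->
  y ^+ k * (c < y)%R%:R <= (k%:R / (s / 2)) ^+ k * expR (- (s * c / 2)) * expR (s * y).
Proof.
move=> k0 s0 y0; have s2 : 0 < s / 2 by rewrite divr_gt0.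
have C0 : 0 <= (k%:R / (s / 2)) ^+ k by rewrite exprn_ge0// divr_ge0// ltW.
have [cy|_] := ltP c y; last by rewrite mulr0 !mulr_ge0// expR_ge0.
rewrite mulr1; apply: (le_trans (exprn_le_expRM k (s / 2) y k0 s2 y0)).
rewrite -[leRHS]mulrA; apply: ler_wpM2l => //; rewrite -expRD ler_expR.
have : s * c <= s * y by rewrite ler_pM2l// ltW.
lra.
Qed.

Lemma measurable_sup_norm d : measurable_fun setT (@sup_norm R d).
Proof.
rewrite /sup_norm; elim: (index_enum _) => [|i l IH].
  by under eq_fun do rewrite big_nil; exact: measurable_cst.
under eq_fun do rewrite big_cons.
apply: (@measurable_maxr _ _ R setT (fun x : d.-tuple R => `|tnth x i|)) => //.
by apply: measurableT_comp => //; exact: measurable_tnth.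
Qed.

Lemma le_sup_norm d (x : d.-tuple R) i : `|tnth x i| <= sup_norm x.
Proof. by rewrite /sup_norm; exact: (le_bigmax _ (fun i => `|tnth x i|)). Qed.

Section Selection.
Context {dT : measure_display} {T : measurableType dT} (P : probability T R).

(** Dominated convergence with the bound [r ^+ 2 + H ^+ 2]. If every [fS S] had risk above
    [a + eta], so would the limit. *)
Lemma limit_selection (r : T -> R) (H rho eta : R) (fS : nat -> T -> R) (g : T -> R) :
  measurable_fun setT r -> (forall x, 0 <= r x) -> has_int P (fun x => r x ^+ 2) rho ->
  (forall S, measurable_fun setT (fS S)) -> (forall S x, 0 <= fS S x <= H) ->
  (forall x, exists S0, forall S, (S0 <= S)%N -> fS S x = g x) -> 0 < eta ->
  measurable_fun setT g /\
  forall a, has_int P (fun x => (r x - g x) ^+ 2) a ->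
    exists S, exists2 b, has_int P (fun x => (r x - fS S x) ^+ 2) b & b <= a + eta.
Proof.
move=> mr r0 r2 mfS fH fg eta0.
have cfg x : fS S x @[S --> \oo] --> g x.
  have [S0 SP] := fg x; apply: cvg_near_cst; exists S0 => // S /= S0S; exact: SP.
have mg : measurable_fun setT g by exact: (measurable_fun_cvg mfS (fun x _ => cfg x)).
split=> // a aP.
have H0 : 0 <= H by have /andP[] := fH 0%N point; exact: le_trans.
have domP : has_int P (fun x => r x ^+ 2 + H ^+ 2) (rho + H ^+ 2).
  by apply: has_intD => //; apply: has_int_cst; exact: sqr_ge0.
have dom S x : (r x - fS S x) ^+ 2 <= r x ^+ 2 + H ^+ 2.
  have := fH S x; have := r0 x => rx fx.
  have : 0 <= r x * fS S x by rewrite mulr_ge0//; case/andP: fx.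
  have : fS S x ^+ 2 <= H ^+ 2 by apply: lerXn2r; rewrite ?nnegrE; lra.
  by rewrite !expr2; lra.
have bP S : exists2 b, has_int P (fun x => (r x - fS S x) ^+ 2) b & b <= rho + H ^+ 2.
  apply: has_int_dominated domP _ => //.
  - by apply: measurable_funX; exact: measurable_funB.
  - by move=> x; exact: sqr_ge0.
apply: contrapT => no; have [_ _ aE] := aP; have [mdom dom0 domE] := domP.
pose u S := (\int[P]_x ((r x - fS S x) ^+ 2)%:E)%E.
have ub S : ((a + eta)%:E <= u S)%E.
  have [b [mb b0 bE] _] := bP S; rewrite /u bE lee_fin leNgt; apply/negP => ba.
  by apply: no; exists S, b; [split|exact: ltW].
have cu : u S @[S --> \oo] --> a%:E.
  rewrite -aE; apply: (dominated_cvg measurableT (g := fun x => (r x ^+ 2 + H ^+ 2)%:E)) => //.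
  - by move=> S; apply/measurable_EFinP; apply: measurable_funX; exact: measurable_funB.
  - move=> x _; have [S0 SP] := fg x; apply: cvg_near_cst; exists S0 => // S /= S0S; by rewrite SP.
  - apply/integrableP; split; first exact/measurable_EFinP.
    rewrite (eq_integral (fun x => (r x ^+ 2 + H ^+ 2)%:E)) ?domE ?ltry// => x _.
    by rewrite gee0_abs// lee_fin.
  - by move=> S x _; rewrite gee0_abs lee_fin ?sqr_ge0.
have : ((a + eta)%:E <= limn u)%E.
  by apply: lime_ge; [apply/cvg_ex; exists a%:E|apply: nearW => S; exact: ub].
by rewrite (cvg_lim _ cu)// lee_fin gerDl leNgt eta0.
Qed.

End Selection.

(** Three regions: in the ball with [r <= H], clipping does not increase the approximation error; in
    the ball with [r > H] the tail of [r] pays; outside the ball the tail of the norm [y] pays. All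
    tails are expressed by the two exponential moments. *)
Lemma clipped_error (delta H s sg u r g z y : R) : 0 <= delta -> 0 <= H -> 0 < s -> 0 < sg -> 0 < u -> 0 <= r ->
  g = Num.min (Num.max z 0) H -> (y <= u -> `|z - r| <= delta) ->
  (r - g) ^+ 2 <= 2 * delta ^+ 2 + 2 * ((2%:R / (s / 2)) ^+ 2 * expR (- (s * H / 2)) * expR (s * r)) +
     expR (- (sg * u / 2)) * (H ^+ 2 * expR (sg * y) + ((4%:R / s) ^+ 4 * expR (s * r) + expR (sg * y))).
Proof.
move=> de0 H0 s0 sg0 u0 r0 gE zr.
have gH : 0 <= g <= H by rewrite gE le_min ge_min le_max !lexx H0 !orbT.
have tl := exprn_tail_le 2 s H r isT s0 r0.
have tl0 : 0 <= (2%:R / (s / 2)) ^+ 2 * expR (- (s * H / 2)) * expR (s * r).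
  by apply: mulr_ge0; rewrite ?expR_ge0// mulr_ge0 ?sqr_ge0 ?expR_ge0.
have p4 := exprn_le_expRM 4 s r isT s0 r0.
have E0 := expR_ge0 (sg * y); have E1 := expR_ge0 (s * r); have e0 := expR_ge0 (- (sg * u / 2)).
have H2 := sqr_ge0 H.
have c4 : 0 <= (4%:R / s) ^+ 4 * expR (s * r) by apply: le_trans p4; rewrite exprn_ge0.
have [yu|uy] := leP y u.
  have {}zr := zr yu.
  have far : 0 <= expR (- (sg * u / 2)) * (H ^+ 2 * expR (sg * y) + ((4%:R / s) ^+ 4 * expR (s * r) + expR (sg * y))).
    by rewrite mulr_ge0// addr_ge0 ?mulr_ge0// addr_ge0.
  have : (r - g) ^+ 2 <= 2 * delta ^+ 2 + 2 * (r ^+ 2 * (H < r)%R%:R).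
    have [Hr|rH] := ltP H r.
      rewrite mulr1; have : g <= r by lra.
      move=> gr; have : (r - g) ^+ 2 <= r ^+ 2 by apply: lerXn2r; rewrite ?nnegrE; lra.
      by have := sqr_ge0 delta; have := sqr_ge0 r; lra.
    have : `|r - g| <= delta.
      move: zr; rewrite gE !ler_norml /Num.min /Num.max.
      by case: (ltP z 0) => [h|h]; case: ltP; lra.
    move=> h; have : (r - g) ^+ 2 <= delta ^+ 2.
      by rewrite -[leLHS]real_normK ?num_real//; apply: lerXn2r; rewrite ?nnegrE.
    by rewrite mulr0; have := sqr_ge0 delta; lra.
  by lra.
have : (r - g) ^+ 2 <= H ^+ 2 + r ^+ 2.
  have : 0 <= r * g by rewrite mulr_ge0//; case/andP: gH.
  have : g ^+ 2 <= H ^+ 2 by apply: lerXn2r; rewrite ?nnegrE; lra.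
  by rewrite !expr2; lra.
have suy : sg * u < sg * y by rewrite ltr_pM2l.
have su0 : 0 < sg * u by rewrite mulr_gt0.
have h1 : 1 <= expR (- (sg * u / 2)) * expR (sg * y).
  by rewrite -expRD -[leLHS]expR0 ler_expR; lra.
(* Outside the ball, [r^2] is at most [exp(-sg u / 2) * r^2 * exp(sg y / 2)], and the product
   [r^2 * exp(sg y / 2)] is split by the inequality between arithmetic and geometric means, so no
   joint moment is required. *)
have h2 : r ^+ 2 <= expR (- (sg * u / 2)) * (r ^+ 4 + expR (sg * y)).
  have : 1 <= expR (- (sg * u / 2)) * expR (sg * y / 2).
    by rewrite -expRD -[leLHS]expR0 ler_expR; lra.
  move=> /(ler_wpM2l (sqr_ge0 r)); rewrite mulr1 => /le_trans; apply.
  rewrite mulrCA; apply: ler_wpM2l => //.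
  have -> : expR (sg * y) = expR (sg * y / 2) ^+ 2 by rewrite -expRM_natr; congr expR; field.
  have -> : r ^+ 4 = (r ^+ 2) ^+ 2 by rewrite -exprM.
  have := sqr_ge0 (r ^+ 2 - expR (sg * y / 2)); have := sqr_ge0 (r ^+ 2); have := sqr_ge0 (expR (sg * y / 2)).
  by rewrite !(expr2 (_ - _)) !(expr2 (r ^+ 2)) !(expr2 (expR _)); lra.
have h3 := ler_wpM2l H2 h1; have h4 := ler_wpM2l e0 p4.
have sd := sqr_ge0 delta.
by move: tl0 h2 h3 h4; lra.
Qed.

End Tails.

Section Estimator.
Context {R : realType} {d : nat} (Ps Pt : probability (d.-tuple R) R) (p q : d.-tuple R -> R).
Hypotheses (hp : has_lebesgue_density Ps p) (hq : has_lebesgue_density Pt q).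
Hypothesis hsupp : forall x, 0 < q x -> 0 < p x.
Local Notation r := (fun x => q x / p x).
Variables (s sg Lr Lx : R).
Hypotheses (s0 : 0 < s) (sg0 : 0 < sg).
Hypothesis expr_int : has_int Ps (fun x => expR (s * r x)) Lr.
Hypothesis expx_int : has_int Ps (fun x => expR (sg * sup_norm x)) Lx.

Let mr : measurable_fun setT r := measurable_density_ratio Ps Pt p q hp hq.
Let r0 : forall x, 0 <= r x := density_ratio_ge0 Ps Pt p q hp hq.

Lemma exprn_ratio_int k : (0 < k)%N -> exists rho, has_int Ps (fun x => r x ^+ k) rho.
Proof.
move=> k0; have c0 : 0 <= (k%:R / s) ^+ k by rewrite exprn_ge0// divr_ge0// ltW.
have [rho h _] := has_int_dominated Ps (fun x => r x ^+ k) _ _ (measurable_funX k mr)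
  (fun x => exprn_ge0 k (r0 x)) (has_intZ _ _ _ _ c0 expr_int) (fun x => exprn_le_expRM k s (r x) k0 s0 (r0 x)).
by exists rho.
Qed.

Lemma exprn_ratio_tail k (c : R) : (0 < k)%N -> exists2 a, has_int Ps (fun x => r x ^+ k * (c < r x)%R%:R) a &
  a <= (k%:R / (s / 2)) ^+ k * expR (- (s * c / 2)) * Lr.
Proof.
move=> k0; have s2 : 0 < s / 2 by rewrite divr_gt0.
have c0 : 0 <= (k%:R / (s / 2)) ^+ k * expR (- (s * c / 2)).
  by rewrite mulr_ge0 ?expR_ge0// exprn_ge0// divr_ge0// ltW.
apply: (has_int_dominated Ps _ _ _ _ _ (has_intZ _ _ _ _ c0 expr_int) (fun x => exprn_tail_le k s c (r x) k0 s0 (r0 x))).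
- by apply: measurable_funM; [exact: measurable_funX|exact: measurable_indic_lt].
- by move=> x; rewrite mulr_ge0 ?exprn_ge0.
Qed.

(** The target risk is the source integral of [r * (r - f)^2]. Below the level [Th] the factor [r]
    costs [Th]; above it [(r - f)^2 <= r^2 + H^2] leaves tails of [r^3] and of [r]. *)
Lemma target_risk_le (f : d.-tuple R -> R) (H Th : R) : measurable_fun setT f -> (forall x, 0 <= f x <= H) -> 0 <= Th ->
  (\int[Pt]_x ((r x - f x) ^+ 2)%:E <= Th%:E * \int[Ps]_x ((r x - f x) ^+ 2)%:E +
    (expR (- (s * Th / 2)) * Lr * ((3%:R / (s / 2)) ^+ 3 + H ^+ 2 * (1%:R / (s / 2))))%:E)%E.
Proof.
move=> mf fH Th0.
have mD : measurable_fun setT (fun x => (r x - f x) ^+ 2) by apply: measurable_funX; exact: measurable_funB.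
have D0 x : 0 <= (r x - f x) ^+ 2 by exact: sqr_ge0.
have H20 := sqr_ge0 H.
have [a3 a3P a3le] := exprn_ratio_tail 3 Th isT.
have [a1 a1P a1le] := exprn_ratio_tail 1 Th isT.
have [mt t0 tE] := has_intD _ _ _ _ _ a3P (has_intZ _ _ _ _ H20 a1P).
rewrite (density_integralE Ps Pt p q hp hq hsupp (fun x => ((r x - f x) ^+ 2)%:E)); last 2 first.
- exact/measurable_EFinP.
- by move=> x; rewrite lee_fin.
apply: (@le_trans _ _ (\int[Ps]_x (Th * (r x - f x) ^+ 2 +
   (r x ^+ 3 * (Th < r x)%R%:R + H ^+ 2 * (r x ^+ 1 * (Th < r x)%R%:R)))%:E)%E).
  under eq_integral do rewrite -EFinM.
  apply: le_integral_EFin => [||x|x].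
  - exact: measurable_funM.
  - by apply: measurable_funD => //; exact: measurable_funM.
  - exact: mulr_ge0.
  - have rx := r0 x; have := fH x => fx; have [Tr|rT] := ltP Th (r x).
      have Dle : (r x - f x) ^+ 2 <= r x ^+ 2 + H ^+ 2.
        have : 0 <= r x * f x by rewrite mulr_ge0//; case/andP: fx.
        have : f x ^+ 2 <= H ^+ 2 by apply: lerXn2r; rewrite ?nnegrE; lra.
        by rewrite !expr2; lra.
      rewrite !mulr1 expr1; apply: ler_wpDl; first exact: mulr_ge0.
      by rewrite [r x ^+ 3]exprSr -mulrDl ler_wpM2r.
    by rewrite !mulr0 !addr0 mulrC ler_wpM2r.
have := integral_EFinD Ps (fun x => Th * (r x - f x) ^+ 2) _ _ _ mt t0.
move=> ->; last 2 first.
- exact: measurable_funM.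
- by move=> x; exact: mulr_ge0.
rewrite tE (integral_EFinZ Ps _ _ mD D0 Th0); apply: leeD => //.
rewrite lee_fin; have := ler_wpM2l H20 a1le; rewrite expr1; move: a3le; lra.
Qed.

Lemma clipped_fit (beta B u H eta delta : R) (nu J k : nat) :
  0 < beta -> 0 < u -> 0 <= H -> (0 < J)%N -> 0 < B -> 0 < eta -> 0 <= delta ->
  holder_cube beta B (fun x => r (map_tuple (fun t => 2 * u * t - u) x)) ->
  (approximant_depth d nu J (hfloor beta) (2 * (hfloor beta).+1 ^ d) <= k)%N ->
  holder_const (d:=d) beta * (B * (((2 ^+ (nu + nu))^-1) `^ beta + (2 ^+ J)^-1)) <= delta ->
  exists f A, [/\ @F_NN R d k.+2 (12 + d) 0 H f, has_int Ps (fun x => (r x - f x) ^+ 2) A &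
    A <= 2 * delta ^+ 2 + 2 * ((2%:R / (s / 2)) ^+ 2 * expR (- (s * H / 2)) * Lr) +
      expR (- (sg * u / 2)) * (H ^+ 2 * Lx + ((4%:R / s) ^+ 4 * Lr + Lx)) + eta].
Proof.
move=> beta0 u0 H0 J0 B0 eta0 delta0 hol dk dle.
have [fS [g [fSF fSg gz]]] := network_holder beta B u H r nu J k beta0 u0 H0 J0 B0 hol dk.
have FH f x : @F_NN R d k.+2 (12 + d) 0 H f -> 0 <= f x <= H by case=> [_ [_ [_ [_ [_ [_ h]]]]]].
have [rho rhoP] := exprn_ratio_int 2 isT.
have [mg sel] := limit_selection Ps r H rho eta fS g mr r0 rhoP
  (fun S => measurable_network _ _ _ _ _ _ (fSF S)) (fun S x => FH _ x (fSF S)) fSg eta0.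
have zz (a : R) : 0 <= a -> 0 <= 2 * a by move=> a0; rewrite mulr_ge0.
have cA : 0 <= (2%:R / (s / 2)) ^+ 2 * expR (- (s * H / 2)) by rewrite mulr_ge0 ?expR_ge0 ?sqr_ge0.
have P1 := has_intZ _ _ _ 2 (ler0n _ 2) (has_intZ _ _ _ _ cA expr_int).
have P2 := has_intZ _ _ _ _ (sqr_ge0 H) expx_int.
have c4 : 0 <= (4%:R / s) ^+ 4 by rewrite exprn_ge0// divr_ge0// ltW.
have P3 := has_intD _ _ _ _ _ P2 (has_intD _ _ _ _ _ (has_intZ _ _ _ _ c4 expr_int) expx_int).
have P4 := has_intZ _ _ _ _ (expR_ge0 (- (sg * u / 2))) P3.
have P5 := has_intD _ _ _ _ _ (has_intD _ _ _ _ _ (has_int_cst Ps _ (zz _ (sqr_ge0 delta))) P1) P4.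
have [a aP ale] : exists2 a, has_int Ps (fun x => (r x - g x) ^+ 2) a &
    a <= 2 * delta ^+ 2 + 2 * ((2%:R / (s / 2)) ^+ 2 * expR (- (s * H / 2)) * Lr) +
      expR (- (sg * u / 2)) * (H ^+ 2 * Lx + ((4%:R / s) ^+ 4 * Lr + Lx)).
  apply: (has_int_dominated Ps _ _ _ _ _ P5).
  - by apply: measurable_funX; exact: measurable_funB.
  - by move=> x; exact: sqr_ge0.
  move=> x /=.
  have [xu|ux] := leP (sup_norm x) u.
    have [z' gz' zr'] := gz x (fun j => le_trans (le_sup_norm _ x j) xu).
    by apply: (clipped_error delta H s sg u (r x) (g x) z' (sup_norm x)) => // _; exact: le_trans zr' dle.
  (* Outside the ball [g x] is its own unclipped value, since it already lies between 0 and [H], and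
     the approximation premise is vacuous. *)
  have [S0 /(_ S0 (leqnn _)) gS] := fSg x; have := FH _ x (fSF S0); rewrite gS => gH.
  apply: (clipped_error delta H s sg u (r x) (g x) (g x) (sup_norm x)) => //.
    by case/andP: gH => g0 gH; rewrite max_l// min_l.
  by move=> xu; move: ux; rewrite ltNge xu.
have [S [b bP ba]] := sel a aP.
exists (fS S), b; split=> //; apply: le_trans ba _; lra.
Qed.

Section Rates.
Variables (n : nat) (H Th : R) (k T : nat).
Hypotheses (n0 : (0 < n)%N) (H0 : 0 <= H) (Th1 : 1 <= Th) (HT : H * n%:R <= T%:R).
Local Notation F := (@F_NN R d k.+2 (12 + d) 0 H).
Variable est : n.-tuple (d.-tuple R) -> n.-tuple (d.-tuple R) -> d.-tuple R -> R.
Hypothesis mest :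
  measurable_fun setT (fun z : (n.-tuple (d.-tuple R) * n.-tuple (d.-tuple R)) * d.-tuple R => est z.1.1 z.1.2 z.2).
Hypothesis estP : forall xs ys, F (est xs ys) /\ forall f, F f -> ls_crit xs ys (est xs ys) <= ls_crit xs ys f.

Lemma source_estimator_risk f (A : R) : F f -> has_int Ps (fun x => (r x - f x) ^+ 2) A ->
  (iter2 Ps Pt n (fun z => \int[Ps]_x ((r x - est z.1 z.2 x) ^+ 2)%:E) <=
   (3 * A + H ^+ 2 * (1%:R / (s / 2) * expR (- (s * Th / 2)) * Lr) + 576 * (H ^+ 2 + Th) / n%:R *
      (ln (capacity k.+2 (12 + d) (n + (n + (n + n))) T)%:R + 2))%:E)%E.
Proof.
move=> Ff AP; have [rho rhoP] := exprn_ratio_int 2 isT.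
have [a [_ _ aE]] := exprn_ratio_tail 1 Th isT; rewrite expr1 => ale.
have a0 : 0 <= 1%:R / (s / 2) * expR (- (s * Th / 2)) * Lr.
  by rewrite !mulr_ge0 ?expR_ge0 ?(has_int_ge0 _ _ _ expr_int)// invr_ge0 divr_ge0// ltW.
apply: (network_expected_risk Ps Pt p q hp hq hsupp n k.+2 (12 + d) T H Th _ A rho) => //.
- by rewrite leq_addl.
- move: aE; under eq_integral do rewrite expr1.
  by move=> ->; rewrite lee_fin.
- exact: Ff.
- exact: AP.
Qed.

Lemma target_estimator_risk (a : R) : 0 <= a ->
  (iter2 Ps Pt n (fun z => \int[Ps]_x ((r x - est z.1 z.2 x) ^+ 2)%:E) <= a%:E)%E ->
  (iter2 Ps Pt n (fun z => \int[Pt]_x ((r x - est z.1 z.2 x) ^+ 2)%:E) <=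
   (Th * a + expR (- (s * Th / 2)) * Lr * ((3%:R / (s / 2)) ^+ 3 + H ^+ 2 * (1%:R / (s / 2))))%:E)%E.
Proof.
move=> a0 ale; set c := expR _ * _ * _.
have FH f x : F f -> 0 <= f x <= H by case=> [_ [_ [_ [_ [_ [_ h]]]]]].
have Th0 : 0 <= Th by exact: le_trans ler01 Th1.
have c0 : 0 <= c.
  rewrite /c mulr_ge0 ?mulr_ge0 ?expR_ge0 ?(has_int_ge0 _ _ _ expr_int)// addr_ge0 ?exprn_ge0 ?mulr_ge0 ?sqr_ge0//.
    by rewrite invr_ge0 divr_ge0// ltW.
  by rewrite invr_ge0 divr_ge0// ltW.
have mD : measurable_fun setT (fun z : (n.-tuple (d.-tuple R) * n.-tuple (d.-tuple R)) * d.-tuple R =>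
    ((r z.2 - est z.1.1 z.1.2 z.2) ^+ 2)%:E).
  apply/measurable_EFinP; apply: measurable_funX; apply: measurable_funB => //.
  exact: (measurableT_comp mr measurable_snd).
have D0 z : (0 <= ((r z.2 - est z.1.1 z.1.2 z.2) ^+ 2)%:E)%E by rewrite lee_fin sqr_ge0.
have mI (P : probability (d.-tuple R) R) := measurable_fun_fubini_tonelli_F (m2 := P) _ mD D0.
have I0 (P : probability (d.-tuple R) R) (z : n.-tuple (d.-tuple R) * n.-tuple (d.-tuple R)) :
    (0 <= \int[P]_x ((r x - est z.1 z.2 x) ^+ 2)%:E)%E.
  by apply: integral_ge0 => x _; rewrite lee_fin sqr_ge0.
apply: (@le_trans _ _ (iter2 Ps Pt n (fun z =>
   Th%:E * \int[Ps]_x ((r x - est z.1 z.2 x) ^+ 2)%:E + c%:E)%E)).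
  apply: le_iter2.
  - exact: mI.
  - by apply: emeasurable_funD => //; apply: emeasurable_funM => //; exact: mI.
  - by move=> z; exact: I0.
  - move=> z; have [Fe _] := estP z.1 z.2.
    by apply: target_risk_le => //; [exact: measurable_network Fe|move=> x; exact: FH].
rewrite (iter2D Ps Pt n _ (fun=> c%:E)) //; last 2 first.
- by apply: emeasurable_funM => //; exact: mI.
- by move=> z; rewrite mule_ge0.
rewrite (iter2Z Ps Pt n _ Th (mI Ps) (I0 Ps) Th0) iter2_cst EFinD; apply: leeD => //.
by rewrite EFinM; apply: (@lee_wpmul2l _ Th%:E _ _ _ ale); rewrite lee_fin.
Qed.

End Rates.
End Estimator.

(** * Rates *)

(** Every factor is bounded by a power of 2 with exponent linear in [L]; the number of polynomials
    is then raised to a power linear in [L], which makes the total exponent quadratic. The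
    assumption [n <= 2 ^ L] puts the sample size and the [n ^ 3] thresholds under the same bound. *)
Lemma capacity_le (L Q n : nat) : (n <= 2 ^ L)%N ->
  (capacity L Q (n + (n + (n + n))) (n ^ 3) <= 2 ^ ((Q.+1 + (Q + 6) * (Q.+1 * Q.+2)) * L.+2 ^ 2))%N.
Proof.
move=> nL; rewrite /capacity; set q := Q.+1.
have leX a b e f : (a <= 2 ^ e -> b <= 2 ^ f -> a * b <= 2 ^ (e + f))%N.
  by move=> ae bf; rewrite expnD leq_mul.
have leD a b e : (a <= 2 ^ e -> b <= 2 ^ e -> a + b <= 2 ^ e.+1)%N.
  by move=> ae be; rewrite expnS mul2n -addnn leq_add.
have leW a e f : (a <= 2 ^ e -> e <= f -> a <= 2 ^ f)%N.
  by move=> ae ef; apply: leq_trans ae _; rewrite leq_exp2l.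
have Lb : (L.+1 <= 2 ^ L.+1)%N by rewrite ltnW// ltn_expl.
have qb : (q <= 2 ^ q)%N by rewrite ltnW// ltn_expl.
have e1 : (n + (n + (n + n)) <= 2 ^ L.+2)%N by rewrite !expnS; lia.
have e2 : (L.+1 * q + n ^ 3 <= 2 ^ (3 * L + q + 2))%N.
  rewrite addn2; apply: (leD _ _ _).
    by apply: (leW _ _ _) (leX _ _ _ _ Lb qb) _; lia.
  apply: (@leW _ (3 * L)%N); last by lia.
  by rewrite mulnC expnM leq_exp2r.
set fam := (_ * _ * (L.+1 * q + _))%N.
have e3 : (fam <= 2 ^ (L.+2 + L.+1 * q + (3 * L + q + 2)))%N.
  exact: (leX _ _ _ _ (leX _ _ _ _ e1 (leqnn _)) e2).
have e4 : ((2 * (fam * L.+1)).+1 <= 2 ^ (L.+2 * (Q + 6)))%N.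
  rewrite -addn1; apply: (@leW _ (1 + (L.+2 + L.+1 * q + (3 * L + q + 2) + L.+1)).+1%N).
    apply: (leD _ _ _); last by rewrite expn_gt0.
    exact: (leX 2 _ 1 _ (leqnn 2) (leX _ _ _ _ e3 Lb)).
  by rewrite /q; lia.
have e5 : ((2 * (fam * L.+1)).+1 ^ (L.+2 * q * Q.+2) <= 2 ^ (L.+2 * (Q + 6) * (L.+2 * q * Q.+2)))%N.
  by rewrite [leqRHS]expnM leq_exp2r// /q muln_gt0.
have e6 : (q ^ L.+1 <= 2 ^ (q * L.+1))%N by rewrite expnM leq_exp2r.
apply: (leW _ _ _) (leX _ _ _ _ e6 e5) _.
rewrite mulnDl; apply: leq_add.
  by rewrite leq_mul2l /= -[L.+1]expn1; apply: (@leq_trans (L.+2 ^ 1)); [rewrite !expn1|rewrite leq_exp2l].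
by rewrite leq_eqVlt; apply/orP; left; apply/eqP; rewrite /q -mulnn; ring.
Qed.

Section Arithmetic.
Context {R : realType}.

Lemma ln2_ge_half : 2^-1 <= ln (2 : R).
Proof.
rewrite -ler_expR lnK ?posrE// -[2^-1]opprK expRN -[leRHS]invrK lef_pV2 ?posrE ?expR_gt0 ?invr_gt0//.
by have := expR_ge1Dx (- (2^-1) : R); lra.
Qed.

Lemma ln2_le1 : ln (2 : R) <= 1.
Proof. by have := @le_ln1Dx R 1; rewrite -[2]/(1 + 1); apply; lra. Qed.

Lemma ln_nat_ge_half n : (2 <= n)%N -> 2^-1 <= ln (n%:R : R).
Proof.
move=> n2; apply: le_trans ln2_ge_half _.
by rewrite ler_ln ?posrE ?ltr0n ?ler_nat//; lia.
Qed.

Lemma ln_capacity_le (L Q n : nat) : (0 < L)%N -> (n <= 2 ^ L)%N ->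
  ln (capacity L Q (n + (n + (n + n))) (n ^ 3))%:R <=
    (9 * (Q.+1 + (Q + 6) * (Q.+1 * Q.+2)))%:R * L%:R ^+ 2 :> R.
Proof.
move=> L0 nL; set a := (Q.+1 + _)%N; have := capacity_le L Q n nL; rewrite -/a => Kle.
set K := capacity _ _ _ _ in Kle *.
have [->|K0] := posnP K; first by rewrite ln0// mulr_ge0// sqr_ge0.
apply: (@le_trans _ _ (ln (2 ^+ (a * L.+2 ^ 2) : R))).
  by rewrite ler_ln ?posrE ?ltr0n ?exprn_gt0// -natrX ler_nat.
rewrite lnXn// -[leLHS]mulr_natl.
apply: (@le_trans _ _ ((a * L.+2 ^ 2)%:R)).
  by rewrite -[leRHS]mulr1; apply: ler_wpM2l => //; exact: ln2_le1.
by rewrite -natrX -natrM ler_nat; nia.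
Qed.

(* The resolution [h = 2^-(2 nu)] is the largest such power with [h^-1 <= x]. *)
Lemma dyadic_resolution (x : R) : 1 <= x -> exists nu : nat, 2 ^+ (nu + nu) <= x < 4 * 2 ^+ (nu + nu).
Proof.
move=> x1; have x0 : 0 <= x by exact: le_trans ler01 x1.
have t0 : (0 < Num.truncn x)%N by rewrite truncn_ge_nat.
have /andP[h1 h2] := @trunc_log_bounds 4 _ isT t0; set nu := trunc_log 4 _ in h1 h2.
have /andP[t1 t2] := truncn_itv x0.
have e : 2 ^+ (nu + nu) = (4 ^ nu)%:R :> R.
  by rewrite addnn -mul2n exprM natrX -natrX.
exists nu; rewrite e; apply/andP; split; first by apply: le_trans t1; rewrite ler_nat.
by apply: lt_le_trans t2 _; rewrite -natrM ler_nat -expnS.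
Qed.

Lemma dyadic_resolutionV (x beta : R) nu : 0 < beta -> 1 <= x -> x < 4 * 2 ^+ (nu + nu) ->
  (2 ^+ (nu + nu))^-1 `^ beta <= 4 `^ beta * x `^ (- beta).
Proof.
move=> b0 x1 xlt; have x0 : 0 < x by exact: lt_le_trans ltr01 x1.
rewrite -[- beta]mulN1r powRrM powR_inv1 ?(ltW x0)// -powRM ?invr_ge0 ?(ltW x0)//.
apply: ge0_ler_powR; rewrite ?nnegrE ?invr_ge0 ?exprn_ge0 ?(ltW b0)//.
  by rewrite divr_ge0// ltW.
by rewrite -[leRHS]invrK lef_pV2 ?posrE ?exprn_gt0 ?invr_gt0 ?divr_gt0// invf_div ler_pdivrMr// mulrC ltW.
Qed.

(** Number of stored digits that makes the digit error no larger than the Taylor error. *)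
Lemma dyadic_power_le (beta : R) nu J b : beta <= b%:R -> ((nu + nu) * b <= J)%N ->
  (2 ^+ J)^-1 <= (2 ^+ (nu + nu))^-1 `^ beta :> R.
Proof.
move=> bb bJ; have p0 k : 0 < 2 ^+ k :> R by rewrite exprn_gt0.
apply: (@le_trans _ _ ((2 ^+ (nu + nu))^-1 `^ b%:R)).
  rewrite powR_mulrn ?invr_ge0 ?exprn_ge0// exprVn -exprM lef_pV2 ?posrE//.
  by apply: ler_weXn2l => //; rewrite ler1n.
apply: ger_powR => //; rewrite invr_gt0 p0 /= invf_le1//.
by apply: exprn_ege1; rewrite ler1n.
Qed.

(** The gain from packing: with mesh [1/x] there are of order [x ^ d] cells, while the program
    length depends on the square root of their number. *)
Lemma dyadic_root_le (x : R) nu d : 1 <= x -> 2 ^+ (nu + nu) <= x -> 2 ^+ (nu * d) <= x `^ (d%:R / 2).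
Proof.
move=> x1 lex; have x0 : 0 <= x by exact: le_trans ler01 x1.
have -> : 2 ^+ (nu * d) = (2 ^+ (nu + nu)) `^ (d%:R / 2) :> R.
  rewrite -!powR_mulrn// -powRrM; congr powR.
  by rewrite natrD natrM; field.
by apply: ge0_ler_powR; rewrite ?nnegrE ?divr_ge0 ?exprn_ge0.
Qed.

Lemma dyadic_log_le (x : R) nu : 2 ^+ (nu + nu) <= x -> nu%:R <= ln x.
Proof.
move=> lex; have p0 : 0 < 2 ^+ (nu + nu) :> R by rewrite exprn_gt0.
apply: (@le_trans _ _ (ln (2 ^+ (nu + nu)))); last by rewrite ler_ln ?posrE// (lt_le_trans p0).
rewrite lnXn// -[leRHS]mulr_natr natrD.
by have := ler_wpM2l (ler0n R nu) ln2_ge_half; lra.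
Qed.

End Arithmetic.

Section RateArithmetic.
Context {R : realType}.

Lemma approximant_depth_le (x l : R) nu d b s T : 1 <= x -> 2 ^+ (nu + nu) <= x -> ln x <= l -> 2^-1 <= l ->
  (approximant_depth d nu ((nu + nu) * b + 1) s T + 2)%:R <=
    (8 * d + T * (14 + 9 * (2 * b + 2) + s * (10 * b + 16)) + 6)%:R * (x `^ (d%:R / 2) * l).
Proof.
move=> x1 nux lnx l2; have l0 : 0 <= l by lra.
have Y1 : 1 <= x `^ (d%:R / 2).
  by rewrite -[leLHS](powRr0 x); apply: ler_powR => //; rewrite divr_ge0.
set Y := x `^ _ in Y1 *; set Z := Y * l.
have nuR : nu%:R <= l by exact: le_trans (dyadic_log_le x nu nux) lnx.
have lZ : l <= Z by rewrite -[leLHS]mul1r; apply: ler_wpM2r.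
have PY : (2 ^ (nu * d))%:R <= Y by rewrite natrX; exact: dyadic_root_le.
have JR : ((nu + nu) * b + 1)%:R <= (2 * b + 2)%:R * l.
  have := ler_wpM2l (ler0n R b) nuR; rewrite !(natrD, natrM); lra.
have PJ : (2 ^ (nu * d))%:R * ((nu + nu) * b + 1)%:R <= (2 * b + 2)%:R * Z.
  by rewrite /Z mulrCA; apply: ler_pM.
have PZ : (2 ^ (nu * d))%:R <= 2 * Z.
  apply: (le_trans PY); rewrite /Z mulrCA -[leLHS]mulr1; apply: ler_wpM2l; lra.
have {}JR : ((nu + nu) * b + 1)%:R <= (2 * b + 2)%:R * Z.
  by apply: le_trans JR _; apply: ler_wpM2l.
rewrite /approximant_depth; set J := (_ * b + 1)%N in JR PJ *; set P := (2 ^ _)%N in PY PJ PZ *.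
have dn : d%:R * nu%:R <= d%:R * Z by apply: ler_wpM2l => //; exact: le_trans nuR lZ.
have sJ : s%:R * (J%:R * 5 + 3) <= s%:R * ((2 * b + 2)%:R * Z * 5 + 6 * Z) by apply: ler_wpM2l => //; lra.
have TT : T%:R * ((1 + P%:R * 3) + (1 + P%:R * J%:R * 9) + s%:R * (J%:R * 5 + 3) + 2) <=
   T%:R * ((14 + 9 * (2 * b + 2)%:R + s%:R * (10 * b + 16)%:R) * Z).
  apply: ler_wpM2l => //; apply: (@le_trans _ _ ((2 * Z + 6 * Z) + (2 * Z + 9 * ((2 * b + 2)%:R * Z)) +
     s%:R * ((2 * b + 2)%:R * Z * 5 + 6 * Z) + 4 * Z)); first by lra.
  by rewrite !(natrD, natrM); lra.
by move: TT dn; rewrite !(natrD, natrM); lra.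
Qed.

Lemma absz_ceil_itv (y : R) : 0 <= y -> y <= `|Num.ceil y|%N%:R <= y + 1.
Proof.
move=> y0; have c0 : (0 <= Num.ceil y)%R by rewrite ceil_ge0; lra.
have -> : `|Num.ceil y|%N%:R = (Num.ceil y)%:~R :> R by rewrite natr_absz ger0_norm.
by rewrite ceil_ge /=; have := ceilB1_lt y; rewrite intrB; lra.
Qed.

Section NetworkParameters.
Variables (d : nat) (beta : R).
Hypotheses (d0 : (0 < d)%N) (beta0 : 0 < beta).
Local Notation l n := (ln (n%:R : R)).
Local Notation N n := ((n%:R : R) `^ (- (2 * beta / (d%:R + 2 * beta)))).
Local Notation depth cL n := `| Num.ceil (cL * (n%:R : R) `^ (d%:R / (2 * d%:R + 4 * beta)) * l n) |%N.

Let d1 : 1 <= d%:R :> R. Proof. by rewrite ler1n. Qed.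
Let den0 : 0 < d%:R + 2 * beta. Proof. by move: d1 beta0; lra. Qed.

(** Balances the two errors: the inverse mesh [x] gives squared bias [x ^ (-2 beta)] and depth of
    order [x ^ (d/2)] times a logarithm, so that the squared depth over [n] has the same polynomial
    order. [k] is the depth minus the two layers used for loading and clipping. *)
Lemma network_parameters s T : exists2 cL : R, 0 < cL & forall n, (2 <= n)%N ->
  exists k nu J, [/\ depth cL n = k.+2, (0 < J)%N, (approximant_depth d nu J s T <= k)%N,
     (n <= 2 ^ k.+2)%N &
     k.+2%:R ^+ 2 / n%:R <= 4 * cL ^+ 2 * (N n * l n ^+ 2) /\
     (2 ^+ (nu + nu))^-1 `^ beta + (2 ^+ J)^-1 <= 2 * 4 `^ beta * n%:R `^ (- (beta / (d%:R + 2 * beta)))].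
Proof.
pose b := `|Num.ceil beta|%N.
have [cD [cD2 Dbound]] : exists cD : nat, (2 <= cD)%N /\ forall (x l : R) nu, 1 <= x ->
    2 ^+ (nu + nu) <= x -> ln x <= l -> 2^-1 <= l ->
    (approximant_depth d nu ((nu + nu) * b + 1) s T + 2)%:R <= cD%:R * (x `^ (d%:R / 2) * l).
  exists (8 * d + T * (14 + 9 * (2 * b + 2) + s * (10 * b + 16)) + 6)%N; split; first by lia.
  by move=> x l nu; exact: approximant_depth_le.
have cD2R : 2 <= cD%:R :> R by rewrite (ler_nat R 2).
exists cD%:R; first by rewrite ltr0n; lia.
move=> n n2; have nR : 0 < n%:R :> R by rewrite ltr0n; lia.
have n1 : 1 <= n%:R :> R by rewrite ler1n; lia.
have l2 := ln_nat_ge_half n n2 : 2^-1 <= l n.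
(* The solution of [x ^ (-2 beta) = x ^ d / n]. *)
pose x : R := n%:R `^ (d%:R + 2 * beta)^-1.
have x1 : 1 <= x.
  rewrite -[leLHS](powRr0 n%:R); apply: ler_powR => //; by rewrite invr_ge0 ltW.
have lnx : ln x <= l n.
  rewrite ln_powR -[leRHS]mul1r; apply: ler_wpM2r; first by lra.
  by rewrite invf_le1//; move: d1 beta0; lra.
have [nu /andP[nu1 nu2]] := dyadic_resolution x x1.
have Dle := Dbound x (l n) nu x1 nu1 lnx l2.
have den2 : 2 * d%:R + 4 * beta != 0 by apply: lt0r_neq0; move: den0; lra.
have Ye : x `^ (d%:R / 2) = n%:R `^ (d%:R / (2 * d%:R + 4 * beta)).
  by rewrite /x -powRrM; congr powR; field; rewrite den2 lt0r_neq0.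
rewrite Ye in Dle; set Y := n%:R `^ _ in Dle Ye.
have Y1 : 1 <= Y.
  by rewrite -Ye -[leLHS](powRr0 x); apply: ler_powR => //; rewrite divr_ge0.
have Z2 : 1 <= cD%:R * (Y * l n).
  have := cD2R.
  have : 2^-1 <= Y * l n by apply: (le_trans l2); rewrite -[leLHS]mul1r; apply: ler_wpM2r => //; exact: (le_trans _ l2).
  by move=> h1 h2; have := ler_pM (_ : 0 <= 2) (_ : 0 <= 2^-1) h2 h1; rewrite divff//; apply.
have /andP[L1 L2] : cD%:R * (Y * l n) <= (depth cD%:R n)%:R <= cD%:R * (Y * l n) + 1.
  by rewrite -/Y -mulrA; apply: absz_ceil_itv; lra.
set L := depth _ _ in L1 L2 *.
have DL : (approximant_depth d nu ((nu + nu) * b + 1) s T + 2 <= L)%N.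
  by rewrite -(ler_nat R); exact: le_trans Dle L1.
have L2' : (2 <= L)%N by apply: leq_trans DL; rewrite leq_addl.
have Lk : L = L.-2.+2 by rewrite -[LHS](subnK L2') addn2 subn2.
exists L.-2, nu, ((nu + nu) * b + 1)%N; rewrite -Lk; split=> //.
- by rewrite addn1.
- by move: DL; rewrite {1}Lk addn2 !ltnS.
- rewrite -(ler_nat R) natrX -[leLHS]lnK ?posrE// -[leRHS]lnK ?posrE ?exprn_gt0// ler_expR.
  rewrite lnXn// -[leRHS]mulr_natl.
  have : l n <= Y * l n by rewrite -[leLHS]mul1r; apply: ler_wpM2r => //; exact: (le_trans _ l2).
  have := cD2R.
  move=> h1 h2; have := ler_wpM2l (ler0n R L) (@ln2_ge_half R).
  have : 2 * (Y * l n) <= cD%:R * (Y * l n) by apply: ler_wpM2r => //; lra.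
  by lra.
split.
  have Y2 : Y ^+ 2 / n%:R = N n.
    have -> : n%:R^-1 = n%:R `^ (-1) :> R by rewrite powR_inv1// ltW.
    rewrite -powR_mulrn ?powR_ge0// -powRrM -powRD; last by apply/implyP => _; rewrite gt_eqF.
    by congr powR; field; rewrite den2 lt0r_neq0.
  have -> : 4 * cD%:R ^+ 2 * (N n * l n ^+ 2) = (2 * (cD%:R * (Y * l n))) ^+ 2 / n%:R.
    by rewrite -Y2; field; rewrite gt_eqF.
  apply: ler_wpM2r; first by rewrite invr_ge0 ltW.
  by apply: lerXn2r; rewrite ?nnegrE; lra.
have -> : 2 * 4 `^ beta * n%:R `^ (- (beta / (d%:R + 2 * beta))) = 4 `^ beta * x `^ (- beta) + 4 `^ beta * x `^ (- beta).
  by rewrite /x -powRrM [_^-1 * _]mulrC mulNr; ring.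
have V := dyadic_resolutionV x beta nu beta0 x1 nu2.
apply: lerD => //; apply: le_trans V.
apply: (dyadic_power_le beta nu _ b); last by rewrite leq_addr.
by have /andP[] := absz_ceil_itv beta (ltW beta0).
Qed.

End NetworkParameters.

(** Once [l ^ kappa >= 1/a] the exponent exceeds [l]. Before that, [l] itself is at most
    [a ^ (-1/kappa)], which the constant pays for. *)
Lemma expR_superlinear (kappa a : R) : 0 < kappa -> 0 < a -> exists2 C, 0 <= C & forall l, 0 <= l ->
  expR (- (a * l `^ (1 + kappa))) <= C * expR (- l).
Proof.
move=> k0 a0; exists (expR (a^-1 `^ kappa^-1)); first exact: expR_ge0.
move=> l l0; rewrite -expRD ler_expR.
have -> : l `^ (1 + kappa) = l * l `^ kappa.
  by rewrite powRD ?powRr1// gt_eqF//; lra.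
have [la|la] := leP a^-1 (l `^ kappa).
  have : l <= a * (l * l `^ kappa).
    have := ler_wpM2l l0 (ler_wpM2l (ltW a0) la); rewrite divff ?gt_eqF//; lra.
  by have := powR_ge0 a^-1 kappa^-1; lra.
have : l <= a^-1 `^ kappa^-1.
  have {1}-> : l = (l `^ kappa) `^ kappa^-1 by rewrite -powRrM divff ?gt_eqF// powRr1.
  apply: ge0_ler_powR; rewrite ?nnegrE ?powR_ge0 ?invr_ge0//; exact: ltW.
have : 0 <= a * (l * l `^ kappa) by rewrite !mulr_ge0 ?powR_ge0// ltW.
by lra.
Qed.

(** Since [ln 2 < 1], powers of [ln n] need not increase with the exponent; the powers of [2 * ln n]
    do, hence the factor [2 ^ E]. *)
Lemma powR_le_of_half (E a l : R) : 2^-1 <= l -> 0 <= a <= E -> l `^ a <= 2 `^ E * l `^ E.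
Proof.
move=> l2 /andP[a0 aE]; have l0 : 0 <= l by lra.
rewrite -powRM//; apply: (@le_trans _ _ ((2 * l) `^ a)).
  by apply: ge0_ler_powR; rewrite ?nnegrE//; lra.
by apply: ler_powR => //; lra.
Qed.

Lemma exprn_le_of_half (E l : R) k : 2^-1 <= l -> k%:R <= E -> l ^+ k <= 2 `^ E * l `^ E.
Proof.
by move=> l2 kE; rewrite -powR_mulrn; [apply: powR_le_of_half => //; rewrite ler0n|lra].
Qed.

End RateArithmetic.

Lemma subexponential_int {R : realType} {dT} {T : measurableType dT} (P : probability T R) (v : T -> R) :
  measurable_fun setT v -> (forall x, 0 <= v x) -> subexponential P v ->
  exists2 s : R, 0 < s & exists a, has_int P (fun x => expR (s * v x)) a.
Proof.
move=> mv v0 [s [s0 fin]]; exists s => //; exists (fine (\int[P]_x (expR (s * v x))%:E)%E); split.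
- by apply: measurableT_comp => //; exact: measurable_funM.
- by move=> x; exact: expR_ge0.
rewrite fineK// ge0_fin_numE; last by apply: integral_ge0 => x _; rewrite lee_fin expR_ge0.
by move: fin; under eq_integral do rewrite ger0_norm//.
Qed.

Lemma holder_cube_le {R : realType} d (beta B B' : R) (g : d.-tuple R -> R) : B <= B' ->
  holder_cube beta B g -> holder_cube beta B' g.
Proof.
move=> BB' [h1 [h2 h3]]; split=> //; split.
  by move=> a ha x xc; exact: le_trans (h2 a ha x xc) BB'.
by move=> a ha x y xc yc xy; exact: le_trans (h3 a ha x y xc yc xy) BB'.
Qed.

(** * Collecting the error terms into the final rate *)

Section RateBound.
Context {R : realType}.
Variables (d : nat) (beta c m kappa s sg Lr Lx hc cL Ce CK : R) (n : nat) (k J nu : nat) (logK : R).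
Hypotheses (d0 : (0 < d)%N) (beta0 : 0 < beta) (c0 : 0 < c) (m0 : 0 <= m) (kappa01 : 0 < kappa <= 1).
Hypotheses (s0 : 0 < s) (sg0 : 0 < sg) (Lr0 : 0 <= Lr) (Lx0 : 0 <= Lx) (Ce0 : 0 <= Ce) (CK0 : 0 <= CK).
Hypothesis n2 : (2 <= n)%N.

Local Notation l := (ln (n%:R : R)).
Local Notation E := (Num.max (8 + 4 * kappa) (2 * m)).
Local Notation N := ((n%:R : R) `^ (- (2 * beta / (d%:R + 2 * beta)))).
Local Notation G := (l `^ E).
Local Notation H := (l `^ (1 + kappa)).
(** Chosen to make [exp(- s Th / 2)] at most 1/n, with the 1 ensuring [Th >= 1]. Likewise the radius
    [u] makes [exp(- sg u / 2)] equal to 1/n. *)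
Local Notation Th := (2 / s * l + 1).
Local Notation u := (2 / sg * l).
Local Notation B := (c * (u `^ m + 1)).
Local Notation b0 := (2 `^ E : R).

Let l2 : 2^-1 <= l. Proof. exact: ln_nat_ge_half. Qed.
Let l0 : 0 < l. Proof. by have := l2; lra. Qed.
Let nR : 0 < n%:R :> R. Proof. by rewrite ltr0n (leq_trans _ n2). Qed.
Let E8 : 8 + 4 * kappa <= E. Proof. by rewrite le_max lexx. Qed.
Let b00 : 0 <= b0. Proof. exact: powR_ge0. Qed.
Let G0 : 0 <= G. Proof. exact: powR_ge0. Qed.
Let N0 : 0 <= N. Proof. exact: powR_ge0. Qed.
(** All truncation errors are of order 1/n up to logarithms; this exponent bound places them below
    the rate. *)
Let rho1 : 2 * beta / (d%:R + 2 * beta) <= 1.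
Proof.
have : 0 <= d%:R :> R by []; move=> dR.
by rewrite ler_pdivrMr; have := beta0; lra.
Qed.

Let nV : n%:R^-1 <= N.
Proof.
rewrite -[leLHS]powR_inv1 ?(ltW nR)//; apply: ler_powR; first by rewrite ler1n (leq_trans _ n2).
by rewrite lerN2.
Qed.

Let expNl : expR (- l) = n%:R^-1. Proof. by rewrite expRN lnK// posrE. Qed.

Let G1 : 1 <= b0 * G.
Proof. by have := exprn_le_of_half E l 0 l2 (le_trans _ E8); rewrite expr0; apply; case/andP: kappa01; lra. Qed.

Let H2 : H ^+ 2 <= b0 * G.
Proof.
rewrite -powR_mulrn ?powR_ge0// -powRrM; apply: powR_le_of_half => //.
by apply/andP; split; case/andP: kappa01 => *; [lra|apply: le_trans E8; lra].
Qed.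

Let Th_le : Th <= (2 / s + 2) * l.
Proof. by rewrite [leRHS]mulrDl lerD2l; have := l2; lra. Qed.

Let Th0 : 0 <= Th.
Proof. by rewrite addr_ge0// mulr_ge0 ?(ltW l0)// divr_ge0// ltW. Qed.

(** The estimation error is [V * L^2 / n], whose logarithmic part is [l ^ (2 + 2 kappa) * l ^ 2]
    from [H] and [l ^ 3] from [Th]; both powers are below [8 + 4 * kappa]. *)
Let H2l : (H ^+ 2 + Th) * l ^+ 2 <= (1 + (2 / s + 2)) * b0 * G.
Proof.
have h1 : H ^+ 2 * l ^+ 2 <= b0 * G.
  rewrite -!powR_mulrn ?powR_ge0 ?(ltW l0)// -powRrM -powRD; last by apply/implyP => _; rewrite gt_eqF.
  apply: powR_le_of_half => //.
  by apply/andP; split; case/andP: kappa01 => *; [lra|apply: le_trans E8; lra].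
have h2 : l * l ^+ 2 <= b0 * G.
  rewrite -exprS; apply: exprn_le_of_half => //.
  by apply: le_trans E8; case/andP: kappa01; lra.
have s2 : 0 <= 2 / s + 2 by rewrite addr_ge0// divr_ge0// ltW.
have h3 : Th * l ^+ 2 <= (2 / s + 2) * (b0 * G).
  apply: (@le_trans _ _ ((2 / s + 2) * l * l ^+ 2)).
    by apply: ler_wpM2r => //; exact: sqr_ge0.
  by rewrite -mulrA; apply: ler_wpM2l.
by rewrite mulrDl; lra.
Qed.

Let prodNG a b x : 0 <= x -> 0 <= b -> a <= x * N -> b <= b0 * G -> a * b <= x * b0 * (N * G).
Proof.
move=> x0 b1 ax bG; apply: (@le_trans _ _ (x * N * b)); first exact: ler_wpM2r.
have xN : 0 <= x * N by exact: mulr_ge0.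
have := ler_wpM2l xN bG; lra.
Qed.

(** The three factors come from the network construction, from the bound on [B_u] at [u = 2 l / sg]
    divided by [l ^ m] (where 1 is at most [(2 l) ^ m]), and from the mesh. *)
Definition fit_constant : R := `|hc| * (c * ((2 / sg) `^ m + 2 `^ m)) * (2 * 4 `^ beta).

Lemma fit_error : (2 ^+ (nu + nu))^-1 `^ beta + (2 ^+ J)^-1 <= 2 * 4 `^ beta * n%:R `^ (- (beta / (d%:R + 2 * beta))) ->
  hc * (B * ((2 ^+ (nu + nu))^-1 `^ beta + (2 ^+ J)^-1)) <=
  fit_constant * (l `^ m * n%:R `^ (- (beta / (d%:R + 2 * beta)))).
Proof.
set x := _ + _; set y := n%:R `^ _; move=> xy.
have x0 : 0 <= x by rewrite addr_ge0 ?powR_ge0// invr_ge0 exprn_ge0.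
have Ble : B <= c * ((2 / sg) `^ m + 2 `^ m) * l `^ m.
  rewrite -[leRHS]mulrA; apply: ler_wpM2l; first exact: ltW.
  rewrite powRM ?(ltW l0) ?divr_ge0 ?(ltW sg0)// [leRHS]mulrDl lerD2l -powRM ?(ltW l0)//.
  rewrite -[leLHS](powRr0 (2 * l)); apply: ler_powR => //; have := l2; lra.
have B0 : 0 <= B by rewrite mulr_ge0 ?(ltW c0)// addr_ge0// powR_ge0.
apply: (@le_trans _ _ (`|hc| * (B * x))).
  by apply: ler_wpM2r; [exact: mulr_ge0|exact: ler_norm].
have -> : fit_constant * (l `^ m * y) =
    `|hc| * (c * ((2 / sg) `^ m + 2 `^ m) * l `^ m * (2 * 4 `^ beta * y)) by rewrite /fit_constant; ring.
by apply: ler_wpM2l => //; exact: ler_pM.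
Qed.

(** The squared factor [l ^ m] is the origin of the alternative [2 * m] in the exponent of the
    logarithm. *)
Lemma fit_error_sqr : (fit_constant * (l `^ m * n%:R `^ (- (beta / (d%:R + 2 * beta))))) ^+ 2 <=
  fit_constant ^+ 2 * b0 * (N * G).
Proof.
have y2 : (n%:R `^ (- (beta / (d%:R + 2 * beta)))) ^+ 2 = N.
  by rewrite -powR_mulrn ?powR_ge0// -powRrM; congr powR; ring.
have lm : (l `^ m) ^+ 2 <= b0 * G.
  rewrite -powR_mulrn ?powR_ge0// -powRrM; apply: powR_le_of_half => //.
  by rewrite mulr_ge0//= mulrC le_max lexx orbT.
move: fit_constant => f; rewrite !exprMn y2 -[leRHS]mulrA; apply: ler_wpM2l; first exact: sqr_ge0.
by rewrite [leLHS]mulrC [leRHS]mulrCA; apply: ler_wpM2l.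
Qed.

Definition approximation_constant : R :=
  (2 * fit_constant ^+ 2 + 2 * ((2%:R / (s / 2)) ^+ 2 * Ce * Lr) +
   (Lx + ((4%:R / s) ^+ 4 * Lr + Lx)) + 1) * b0.

Lemma approximation_rate delta A : delta = fit_constant * (l `^ m * n%:R `^ (- (beta / (d%:R + 2 * beta)))) ->
  expR (- (s / 2 * H)) <= Ce * expR (- l) ->
  A <= 2 * delta ^+ 2 + 2 * ((2%:R / (s / 2)) ^+ 2 * expR (- (s * H / 2)) * Lr) +
      expR (- (sg * u / 2)) * (H ^+ 2 * Lx + ((4%:R / s) ^+ 4 * Lr + Lx)) + n%:R^-1 ->
  A <= approximation_constant * (N * G).
Proof.
move=> -> eH; rewrite (_ : s * H / 2 = s / 2 * H); last by ring.
rewrite (_ : sg * u / 2 = l); last by field; rewrite gt_eqF.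
rewrite expNl => Ale; apply: (le_trans Ale).
have h1 := fit_error_sqr.
have e1 : expR (- (s / 2 * H)) * 1 <= Ce * b0 * (N * G).
  apply: prodNG => //; apply: (le_trans eH); rewrite expNl; exact: ler_wpM2l.
have n1 : n%:R^-1 <= 1 * N by rewrite mul1r.
have e2 : n%:R^-1 * 1 <= 1 * b0 * (N * G) by exact: prodNG.
have e3 : n%:R^-1 * H ^+ 2 <= 1 * b0 * (N * G) by apply: prodNG => //; exact: sqr_ge0.
have k1 : 0 <= (2%:R / (s / 2)) ^+ 2 * Lr by rewrite mulr_ge0 ?sqr_ge0.
have k2 : 0 <= (4%:R / s) ^+ 4 * Lr + Lx by rewrite addr_ge0// mulr_ge0// exprn_ge0// divr_ge0// ltW.
have f1 := ler_wpM2l k1 e1; have f2 := ler_wpM2l k2 e2; have f3 := ler_wpM2l Lx0 e3.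
rewrite /approximation_constant; move: h1 f1 f2 f3 e2; rewrite !mulr1 !mul1r; lra.
Qed.

Definition source_constant : R := 3 * approximation_constant + 1%:R / (s / 2) * Lr * b0 +
  576 * ((1 + (2 / s + 2)) * (b0 * ((CK + 2) * (4 * cL ^+ 2)))).

Lemma source_constant_ge0 : 0 <= source_constant.
Proof.
have s2 : 0 <= s / 2 by rewrite divr_ge0// ltW.
have s3 : 0 <= 2 / s by rewrite divr_ge0// ltW.
have cL2 := sqr_ge0 cL; have h2 := sqr_ge0 fit_constant; have h3 : 0 <= (2%:R / (s / 2)) ^+ 2 by exact: sqr_ge0.
have h4 : 0 <= (4%:R / s) ^+ 4 by rewrite exprn_ge0// divr_ge0// ltW.
have h1 : 0 <= approximation_constant.
  rewrite /approximation_constant; apply: mulr_ge0 => //.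
  have a1 := mulr_ge0 (mulr_ge0 h3 Ce0) Lr0; have a2 := mulr_ge0 h4 Lr0.
  apply: addr_ge0 => //; apply: addr_ge0; last by rewrite addr_ge0// addr_ge0.
  by apply: addr_ge0; apply: mulr_ge0.
have h5 : 0 <= 1%:R / (s / 2) * Lr * b0 by rewrite mulr_ge0// mulr_ge0// divr_ge0.
have h6 : 0 <= (1 + (2 / s + 2)) * (b0 * ((CK + 2) * (4 * cL ^+ 2))).
  have t2 : 0 <= 1 + (2 / s + 2) by rewrite addr_ge0// addr_ge0.
  have t3 : 0 <= CK + 2 by rewrite addr_ge0.
  exact: mulr_ge0 t2 (mulr_ge0 b00 (mulr_ge0 t3 (mulr_ge0 (ler0n _ 4) cL2))).
rewrite /source_constant; apply: addr_ge0; last exact: (mulr_ge0 (ler0n _ 576) h6).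
by apply: addr_ge0 => //; exact: mulr_ge0.
Qed.

Let expTh : expR (- (s * Th / 2)) <= n%:R^-1.
Proof.
by rewrite -expNl ler_expR (_ : s * Th / 2 = l + s / 2); [rewrite lerN2; have := s0; lra|field; rewrite gt_eqF].
Qed.

Lemma source_risk_rate A : A <= approximation_constant * (N * G) ->
  logK <= CK * k.+2%:R ^+ 2 -> k.+2%:R ^+ 2 / n%:R <= 4 * cL ^+ 2 * (N * l ^+ 2) ->
  3 * A + H ^+ 2 * (1%:R / (s / 2) * expR (- (s * Th / 2)) * Lr) + 576 * (H ^+ 2 + Th) / n%:R * (logK + 2) <=
  source_constant * (N * G).
Proof.
move=> Ale lK Lle.
have n1 : expR (- (s * Th / 2)) <= 1 * N by rewrite mul1r; exact: le_trans expTh nV.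
have e3 : expR (- (s * Th / 2)) * H ^+ 2 <= 1 * b0 * (N * G) by apply: prodNG => //; exact: sqr_ge0.
have k1 : 0 <= 1%:R / (s / 2) * Lr by rewrite mulr_ge0// divr_ge0// divr_ge0// ltW.
have f3 := ler_wpM2l k1 e3.
have V0 : 0 <= H ^+ 2 + Th by rewrite addr_ge0// sqr_ge0.
have L1 : 1 <= k.+2%:R ^+ 2 :> R by rewrite exprn_ege1// ler1n.
have lK2 : logK + 2 <= (CK + 2) * k.+2%:R ^+ 2 by lra.
have g1 : (H ^+ 2 + Th) / n%:R * (logK + 2) <= (H ^+ 2 + Th) * (CK + 2) * (k.+2%:R ^+ 2 / n%:R).
  have := ler_wpM2l (_ : 0 <= (H ^+ 2 + Th) / n%:R) lK2; rewrite divr_ge0 ?(ltW nR)// => /(_ isT); lra.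
have g2 := ler_wpM2l (mulr_ge0 V0 (_ : 0 <= CK + 2)) Lle.
have CK2 : 0 <= CK + 2 by rewrite addr_ge0.
have c4 : 0 <= (CK + 2) * (4 * cL ^+ 2) * N by rewrite mulr_ge0// mulr_ge0// mulr_ge0// sqr_ge0.
have g3 := ler_wpM2l c4 H2l.
have g4 := g2 CK2.
rewrite /source_constant.
have -> : 576 * (H ^+ 2 + Th) / n%:R * (logK + 2) = 576 * ((H ^+ 2 + Th) / n%:R * (logK + 2)) by ring.
have g5 : (H ^+ 2 + Th) / n%:R * (logK + 2) <= (1 + (2 / s + 2)) * b0 * (CK + 2) * (4 * cL ^+ 2) * (N * G).
  apply: (le_trans g1); apply: (le_trans g4).
  rewrite [leLHS](_ : _ = (CK + 2) * (4 * cL ^+ 2) * N * ((H ^+ 2 + Th) * l ^+ 2)); last by ring.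
  by apply: (le_trans g3); rewrite le_eqVlt; apply/orP; left; apply/eqP; ring.
have -> : H ^+ 2 * (1%:R / (s / 2) * expR (- (s * Th / 2)) * Lr) =
    1%:R / (s / 2) * Lr * (expR (- (s * Th / 2)) * H ^+ 2) by ring.
move: Ale f3 g5; rewrite mul1r; lra.
Qed.

Definition target_constant (cs : R) : R := (2 / s + 2) * cs +
  2 * Lr * ((3%:R / (s / 2)) ^+ 3 + 1%:R / (s / 2)) * b0.

(** The factor [Th], at most a multiple of [l], is the additional logarithm of the target rate. The
    tail terms carry no such factor and are raised to it by [1 <= 2 * l]. *)
Lemma target_risk_rate cs : 0 <= cs ->
  Th * (cs * (N * G)) + expR (- (s * Th / 2)) * Lr * ((3%:R / (s / 2)) ^+ 3 + H ^+ 2 * (1%:R / (s / 2))) <=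
  target_constant cs * (N * G) * l.
Proof.
move=> cs0.
have NG0 : 0 <= N * G by exact: mulr_ge0.
have h1 := ler_wpM2r (mulr_ge0 cs0 NG0) Th_le.
have n1 : expR (- (s * Th / 2)) <= 1 * N by rewrite mul1r; exact: le_trans expTh nV.
have e3 : expR (- (s * Th / 2)) * H ^+ 2 <= 1 * b0 * (N * G) by apply: prodNG => //; exact: sqr_ge0.
have e2 : expR (- (s * Th / 2)) * 1 <= 1 * b0 * (N * G) by exact: prodNG.
have s2 : 0 <= s / 2 by rewrite divr_ge0// ltW.
have k3 : 0 <= Lr * (3%:R / (s / 2)) ^+ 3 by rewrite mulr_ge0// exprn_ge0// divr_ge0.
have k1 : 0 <= Lr * (1%:R / (s / 2)) by rewrite mulr_ge0// divr_ge0.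
have f2 := ler_wpM2l k3 e2; have f3 := ler_wpM2l k1 e3.
have X0 : 0 <= Lr * ((3%:R / (s / 2)) ^+ 3 + 1%:R / (s / 2)) * b0 * (N * G).
  by rewrite mulr_ge0// mulr_ge0// mulr_ge0// addr_ge0// ?exprn_ge0// divr_ge0.
have h2 := ler_wpM2l X0 (_ : 1 <= 2 * l).
have l21 : 1 <= 2 * l by have := l2; lra.
have {}h2 := h2 l21.
rewrite /target_constant; move: h1 f2 f3 h2; rewrite !mulr1 !mul1r; lra.
Qed.

End RateBound.

Theorem theorem3p1 (R : realType) (d : nat) (hd : (0 < d)%N)
  (beta c m kappa : R)
  (hbeta : 0 < beta) (hc : 0 < c) (hm : 0 <= m) (hkappa : 0 < kappa <= 1)
  (Ps Pt : probability (d.-tuple R) R) (p q : d.-tuple R -> R)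
  (hp : has_lebesgue_density Ps p) (hq : has_lebesgue_density Pt q)
  (hsupp : forall x, 0 < q x -> 0 < p x)
  (B : R -> R)
  (hB : forall u : R, 0 < u -> B u <= c * (u `^ m + 1))
  (hr0 : holder_loc beta B (fun x => q x / p x))
  (hsub_r0 : subexponential Ps (fun x => q x / p x))
  (hsub_X : subexponential Ps (@sup_norm R d)) :
  exists (cL : R) (M : nat) (cstar cstarstar : R),
    0 < cL /\
    forall (n : nat), (2 <= n)%N ->
    let L := `| Num.ceil (cL * n%:R `^ (d%:R / (2 * d%:R + 4 * beta)) * ln n%:R) |%N in
    let F := @F_NN R d L M 0 (ln n%:R `^ (1 + kappa)) in
    forall est : n.-tuple (d.-tuple R) -> n.-tuple (d.-tuple R) -> d.-tuple R -> R,
      (forall xs ys, F (est xs ys) /\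
         forall f, F f -> ls_crit xs ys (est xs ys) <= ls_crit xs ys f) ->
      measurable_fun setT
        (fun z : (n.-tuple (d.-tuple R) * n.-tuple (d.-tuple R)) * d.-tuple R =>
           est z.1.1 z.1.2 z.2) ->
      let risk (P : probability (d.-tuple R) R) :=
        iter_int Ps (fun xs => iter_int Pt (fun ys =>
          (\int[P]_x ((q x / p x - est xs ys x) ^+ 2)%:E)%E)) in
      let rate := n%:R `^ (- (2 * beta / (d%:R + 2 * beta))) *
                  ln n%:R `^ (Num.max (8 + 4 * kappa) (2 * m)) in
      (risk Ps <= (cstar * rate)%:E)%E /\
      (risk Pt <= (cstarstar * rate * ln n%:R)%:E)%E.
Proof.
have mr := measurable_density_ratio Ps Pt p q hp hq.
have r0 := density_ratio_ge0 Ps Pt p q hp hq.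
have [s s0 [Lr rP]] := subexponential_int Ps _ mr r0 hsub_r0.
have n0x (x : d.-tuple R) : 0 <= sup_norm x.
  exact: le_trans (normr_ge0 _) (le_sup_norm d x (Ordinal hd)).
have [sg sg0 [Lx xP]] := subexponential_int Ps _ (measurable_sup_norm d) n0x hsub_X.
have Lr0 := has_int_ge0 _ _ _ rP; have Lx0 := has_int_ge0 _ _ _ xP.
have [cL cL0 par] := @network_parameters R d beta hd hbeta (hfloor beta) (2 * (hfloor beta).+1 ^ d)%N.
have [k0 k1] := andP hkappa.
have s20 : 0 < s / 2 by rewrite divr_gt0.
have [Ce Ce0 expH] := expR_superlinear kappa (s / 2) k0 s20.
(* The coefficient of the squared depth in the logarithm of the capacity for width [12 + d]. *)
pose q0 := (9 * ((12 + d).+1 + (12 + d + 6) * ((12 + d).+1 * (12 + d).+2)))%N.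
pose cs := source_constant beta c m kappa s sg Lr Lx (holder_const (d:=d) beta) cL Ce q0%:R.
exists cL, (12 + d)%N, cs, (target_constant m kappa s Lr cs).
split=> // n n2.
have l2 := @ln_nat_ge_half R n n2; have l0 : 0 < ln (n%:R : R) by lra.
have [k [nu [J [-> J0 dk nk [Lrate err]]]]] := par n n2.
move=> /= est estP mest.
set H := ln n%:R `^ (1 + kappa) in estP *.
pose Th : R := 2 / s * ln n%:R + 1; pose u : R := 2 / sg * ln n%:R.
have n0 : (0 < n)%N by exact: leq_trans n2.
have H0 : 0 <= H by exact: powR_ge0.
have u0 : 0 < u by rewrite mulr_gt0// divr_gt0.
have Th1 : 1 <= Th by rewrite lerDr mulr_ge0 ?(ltW l0)// divr_ge0// ltW.
(* The thresholds have spacing 1/n and must reach [H]. Here [kappa <= 1] gives [H <= n ^ 2], so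
   [n ^ 3] of them suffice. *)
have HT : H * n%:R <= (n ^ 3)%N%:R.
  have n1 : 1 <= n%:R :> R by rewrite ler1n.
  have ln_n : ln (n%:R : R) <= n%:R by have := @le_ln1Dx R (n%:R - 1); rewrite [1 + _]addrC subrK; lra.
  rewrite expnSr natrM; apply: ler_wpM2r => //; rewrite natrX -powR_mulrn//.
  apply: (@le_trans _ _ (n%:R `^ (1 + kappa))); last by apply: ler_powR => //; lra.
  by apply: ge0_ler_powR; rewrite ?nnegrE ?(ltW l0)//; lra.
pose delta := fit_constant beta c m sg (holder_const (d:=d) beta) * (ln n%:R `^ m * n%:R `^ (- (beta / (d%:R + 2 * beta)))).
have derr : holder_const (d:=d) beta * (c * (u `^ m + 1) * ((2 ^+ (nu + nu))^-1 `^ beta + (2 ^+ J)^-1)) <= delta.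
  exact: fit_error.
have delta0 : 0 <= delta.
  rewrite mulr_ge0 ?mulr_ge0 ?powR_ge0 ?normr_ge0// ?(ltW hc)// addr_ge0 ?powR_ge0//.
have B0 : 0 < c * (u `^ m + 1) by rewrite mulr_gt0// ltr_wpDl ?powR_ge0.
have nV0 : 0 < (n%:R : R)^-1 by rewrite invr_gt0 ltr0n.
have hol := holder_cube_le d _ _ _ _ (hB u u0) (hr0 u u0).
have [f [A [Ff AP Ale]]] := clipped_fit Ps Pt p q hp hq s sg Lr Lx s0 sg0 rP xP beta _ u H _ delta nu J k
  hbeta u0 H0 J0 B0 nV0 delta0 hol dk derr.
have lnc := @ln_capacity_le R k.+2 (12 + d) n isT nk.
have Abound := approximation_rate d beta c m kappa s sg Lr Lx (holder_const (d:=d) beta) Ce n hbeta hm hkappa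
  s0 sg0 Lr0 Lx0 Ce0 n2 delta A erefl (expH _ (ltW l0)) Ale.
have src := source_estimator_risk Ps Pt p q hp hq hsupp s Lr s0 rP n H Th k (n ^ 3) n0 H0 Th1 HT est mest estP f A Ff AP.
have cs0 : 0 <= cs.
  exact: source_constant_ge0.
set rate := n%:R `^ _ * _.
have src' : (iter2 Ps Pt n (fun z => \int[Ps]_x ((q x / p x - est z.1 z.2 x) ^+ 2)%:E) <= (cs * rate)%:E)%E.
  apply: (le_trans src); rewrite lee_fin.
  exact: (source_risk_rate d beta c m kappa s sg Lr Lx _ cL Ce q0%:R n k _ hbeta hkappa s0 Lr0 (ler0n _ q0) n2 A Abound lnc Lrate).
split; first exact: src'.
have rate0 : 0 <= cs * rate by rewrite mulr_ge0// mulr_ge0 ?powR_ge0.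
apply: (le_trans (target_estimator_risk Ps Pt p q hp hq hsupp s Lr s0 rP n H Th k H0 Th1 est mest estP _ rate0 src')).
rewrite lee_fin; exact: target_risk_rate.
Qed.
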